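(* Let $B=|u|\,b(\mathcal{E},u;dz)$, $b=\alpha(\mathcal{E})\,\beta(\mathcal{E},u;dz)$, be a collision rate with $\alpha:(0,\infty)\to[0,\infty)$ and $\beta(\mathcal{E},u;\cdot)$ a probability measure on $D$, satisfying the following. - Symmetry: $\beta(\mathcal{E},u;dz)=\beta(\mathcal{E},-u;-dz)$. - Continuity: for any $\varphi\in C_c(\mathbb{R}^N)$ the maps $(v,v_*,\mathcal{E})\mapsto\int_D\varphi(v')\beta(\mathcal{E},u;dz)$ and $\mathcal{E}\mapsto\alpha(\mathcal{E})$ are continuous on $\mathbb{R}^N\times\mathbb{R}^N\times(0,\infty)$ and $(0,\infty)$. - Angular spreading: for any $\mathcal{E}>0$ there is a function $j_{\mathcal{E}}(\varepsilon)\ge0$ with $\int_{\{|\hat u\cdot z|>1-\varepsilon\}}\beta(\mathcal{E},u;dz)\le j_{\mathcal{E}}(\varepsilon)$ for all $\varepsilon>0$, $u\ne0$, and $j_{\mathcal{E}}(\varepsilon)\to0$ as $\varepsilon\to0$ uniformly for $\mathcal{E}$ in compact subsets of $(0,\infty)$. Assume in addition that $b(\mathcal{E},u;dz)=\delta_{\{z=(1-e)\hat u/2+(1+e)\sigma/2\}}\,\tilde b(\mathcal{E},|u|,\hat u\cdot\sigma)\,d\sigma$, i.e. $\int_D\Phi(z)\,b(\mathcal{E},u;dz)=\int_{\mathbb{S}^{N-1}}\Phi\big(\tfrac{1-e}2\hat u+\tfrac{1+e}2\sigma\big)\tilde b(\mathcal{E},|u|,\hat u\cdot\sigma)\,d\sigma$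 ($d\sigma$ the uniform measure on the sphere), with $\tilde b\ge0$ measurable and bounded, $e=e(\mathcal{E})\in[0,1]$ continuous, and that for any compact $K'\subset(0,\infty)$ there is $L_{K'}\in(0,\infty)$ such that for all $\mathcal{E},\mathcal{E}'\in K'$: $\sup_{u\in\mathbb{R}^N}\|\tilde b(\mathcal{E}',u,\cdot)-\tilde b(\mathcal{E},u,\cdot)\|_{L^1(\mathbb{S}^{N-1})}\le L_{K'}|\mathcal{E}'-\mathcal{E}|$ (where $\tilde b(\mathcal{E},u,\cdot)$ is $\sigma\mapsto\tilde b(\mathcal{E},|u|,\hat u\cdot\sigma)$) and $|e(\mathcal{E}')-e(\mathcal{E})|\le L_{K'}|\mathcal{E}'-\mathcal{E}|$. Let $f,g\in C([0,T_*];L^1_2)\cap L^\infty(0,T_*;L^1_3)$ be two solutions of the Boltzmann equation $\partial_tf=Q(f,f)$ with mass $1$ and momentum $0$, with initial data $f_{\rm in}$ and $g_{\rm in}$, and such that $\mathcal{E}(f(t,\cdot)),\mathcal{E}(g(t,\cdot))\in K$ on $[0,T_*]$ with $K$ a compact subset of $(0,+\infty)$, and $$\forall\,t\in[0,T_*],\qquad\|f(t,\cdot)\|_{BV_4},\ \|g(t,\cdot)\|_{BV_4}\le C_{T_*}.$$ Then there is a constant $C'_{T_*}$ depending on $B$, $K$ and $C_{T_*}$ such that $$\forall\,t\in[0,T_*],\qquad\|f(t,\cdot)-g(t,\cdot)\|_{L^1_2}\le\|f_{\rm in}-g_{\rm in}\|_{L^1_2}\,e^{C'_{T_*}t}.$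$
   Context: $N\ge2$, $D=\{w\in\mathbb{R}^N:|w|\le1\}$, $\mathbb{S}^{N-1}$ is the unit sphere, $\hat x=x/|x|$ for $x\ne0$. For $v,v_*\in\mathbb{R}^N$: $u=v-v_*$, and for $z\in D$, $v'=\frac{v+v_*}2+z\frac{|v_*-v|}2$, $v'_*=\frac{v+v_*}2-z\frac{|v_*-v|}2$. Shorthand: $\psi=\psi(v)$, $\psi_*=\psi(v_* )$, $\psi'=\psi(v')$, $\psi'_*=\psi(v'_* )$. $\mathcal{E}(f)=\int_{\mathbb{R}^N}f|v|^2dv$. Collision operator associated with a collision rate $B=B(\mathcal{E},u;dz)$: $\langle Q(f,f),\varphi\rangle=\frac12\int\!\int f_*f\int_D(\varphi'_*+\varphi'-\varphi-\varphi_* )B(\mathcal{E},u;dz)\,dv\,dv_*$ with $\mathcal{E}=\mathcal{E}(f)$. Spaces: $L^1_q$ has norm $\|f\|_{L^1_q}=\int|f(v)|(1+|v|^q)dv$; $W^{1,1}_q$ has norm $\sum_{|s|\le1}\|\partial^sf(1+|v|^q)\|_{L^1}$; $BV_q(\mathbb{R}^N)$ is the set of weak limits in $\mathcal{D}'(\mathbb{R}^N)$ of sequences of smooth functions bounded in $W^{1,1}_q$, with the norm extending that of $W^{1,1}_q$: $\|f\|_{BV_q}=\sum_{|s|\le1}\int(1+|v|^q)\,d|\partial^sf|(v)$, where $|\partial^sf|$ is the total variation measure of $\partial^sf$. Solution on $[0,T]$ with initial datum $f_{\rm in}\ge0$ ($f_{\rm in}\in L^1_2$, mass $1$, momentum $0$):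 a nonnegative $f\in C([0,T];L^1_2)$ with $\int_0^T\{\int f\,\partial_t\phi\,dv+\langle Q(f,f),\phi\rangle\}dt=-\int f_{\rm in}\phi(0,\cdot)\,dv$ for all $\phi\in C^1_c([0,T)\times\mathbb{R}^N)$. *)

(* Defs.v *)
From HB Require Import structures.
From mathcomp Require Import all_boot all_order all_algebra.
From mathcomp Require Import all_classical all_reals all_analysis.
From mathcomp Require Import measurable_realfun.

Set Implicit Arguments.
Unset Strict Implicit.
Unset Printing Implicit Defensive.

Import Order.TTheory GRing.Theory Num.Theory.
Import numFieldNormedType.Exports.

Local Open Scope classical_set_scope.
Local Open Scope ring_scope.

Definition measure_row_display : measure_display -> measure_display.
Proof. exact. Qed.

(* The product sigma-algebra on row vectors; for T := R it is the Borel
   sigma-algebra of R^n. *)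
Section measurable_row.
Context {d} {T : sigmaRingType d}.
Variable n : nat.

Let coors : 'I_n -> 'rV[T]_n -> T := fun i v => v ord0 i.

Let row_set0 : g_sigma_preimage coors set0.
Proof. exact: sigma_algebra0. Qed.

Let row_setC A : g_sigma_preimage coors A -> g_sigma_preimage coors (~` A).
Proof. exact: sigma_algebraC. Qed.

Let row_bigcup (F : _^nat) : (forall i, g_sigma_preimage coors (F i)) ->
  g_sigma_preimage coors (\bigcup_i (F i)).
Proof. exact: sigma_algebra_bigcup. Qed.

HB.instance Definition _ := @isMeasurable.Build (measure_row_display d)
  'rV[T]_n (g_sigma_preimage coors) row_set0 row_setC row_bigcup.

End measurable_row.

Lemma measurable_coord d (T : sigmaRingType d) n (i : 'I_n) :
  measurable_fun [set: 'rV[T]_n] (fun v : 'rV[T]_n => v ord0 i).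
Proof.
move=> _ Y mY; rewrite setTI; apply: sub_sigma_algebra => /=.
rewrite -bigcup_seq/=; exists i => /=; first by rewrite mem_index_enum.
by exists Y => //; rewrite setTI.
Qed.

Lemma measurable_fun_row d1 d2 (T1 : measurableType d1)
    (T2 : measurableType d2) n (f : T1 -> 'rV[T2]_n) :
  (forall i, measurable_fun [set: T1] (fun x => f x ord0 i)) ->
  measurable_fun [set: T1] f.
Proof.
move=> mf _ A mA; rewrite setTI.
suff : @measurable _ 'rV[T2]_n `<=` [set B | measurable (f @^-1` B)] by apply.
apply: smallest_sub.
  split=> [|B /= mB|F /= mF].
  - by rewrite /= preimage_set0.
  - by rewrite setTD preimage_setC; exact: measurableC.
  - by rewrite preimage_bigcup; exact: bigcup_measurable.
move=> B /=; rewrite -bigcup_seq/= => -[i _ [C mC <-]].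
by have := mf i measurableT _ mC; rewrite !setTI.
Qed.

Section lebesgue_step.
Context {R : realType} {n : nat}.

Definition row_cons (p : R * 'rV[R]_n) : 'rV[R]_n.+1 :=
  \row_i oapp (p.2 ord0) p.1 (unlift ord0 i).

Definition row_uncons (v : 'rV[R]_n.+1) : R * 'rV[R]_n :=
  (v ord0 ord0, \row_i v ord0 (lift ord0 i)).

Lemma row_consK : cancel row_cons row_uncons.
Proof.
move=> [x v]; rewrite /row_uncons /row_cons mxE unlift_none /=; congr pair.
by apply/rowP => i; rewrite !mxE liftK.
Qed.

Lemma measurable_row_cons : measurable_fun [set: R * 'rV[R]_n] row_cons.
Proof.
apply: measurable_fun_row => i.
under eq_fun do rewrite mxE.
case: (unlift ord0 i) => [k|] /=; last exact: measurable_fst.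
exact: (measurableT_comp (measurable_coord k) measurable_snd).
Qed.

Lemma measurable_row_uncons : measurable_fun [set: 'rV[R]_n.+1] row_uncons.
Proof.
apply/measurable_fun_pairP; split; first exact: measurable_coord.
apply: measurable_fun_row => i.
by under eq_fun do rewrite /= mxE; exact: measurable_coord.
Qed.

Variable mu : {sigma_finite_measure set 'rV[R]_n -> \bar R}.

Definition lebesgue_step : set 'rV[R]_n.+1 -> \bar R :=
  pushforward ((@lebesgue_measure R) \x mu)%E row_cons.

Let lebesgue_step0 : lebesgue_step set0 = 0%E.
Proof. by rewrite /lebesgue_step /pushforward preimage_set0 measure0. Qed.

Let measurable_preimage (A : set 'rV[R]_n.+1) :
  measurable A -> measurable (row_cons @^-1` A).
Proof. by move=> mA; rewrite -[X in measurable X]setTI; exact: measurable_row_cons. Qed.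

Let lebesgue_step_ge0 A : (0 <= lebesgue_step A)%E.
Proof. by rewrite /lebesgue_step /pushforward; exact: measure_ge0. Qed.

Let lebesgue_step_sigma_additive : semi_sigma_additive lebesgue_step.
Proof.
move=> F mF tF mUF; rewrite /lebesgue_step /pushforward preimage_bigcup.
apply: measure_semi_sigma_additive.
- by move=> k; exact: measurable_preimage.
- apply/trivIsetP => /= i j _ _ ij; rewrite -preimage_setI.
  by move/trivIsetP : tF => /(_ _ _ _ _ ij) ->//; rewrite preimage_set0.
- by rewrite -preimage_bigcup; exact: measurable_preimage.
Qed.

HB.instance Definition _ := isMeasure.Build _ _ _ lebesgue_step
  lebesgue_step0 lebesgue_step_ge0 lebesgue_step_sigma_additive.

Let lebesgue_step_sigma_finite : sigma_finite setT lebesgue_step.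
Proof.
pose leb : {sigma_finite_measure set (measurableTypeR R) -> \bar R} :=
  lebesgue_measure.
have /sigma_finiteP[F [FT ndF Foo]] := sigma_finiteT leb.
have /sigma_finiteP[G [GT ndG Goo]] := sigma_finiteT mu.
exists (fun k => row_uncons @^-1` (F k `*` G k)).
  rewrite -preimage_bigcup (_ : \bigcup_i _ = setT) ?preimage_setT//.
  rewrite -setXTT FT GT; apply/seteqP; split => -[x y] /=.
    by move=> [k _ [/= Fx Gy]]; split; exists k.
  move=> [[i _ Fx] [j _ Gy]]; exists (maxn i j) => //; split => /=.
    by move: x Fx; exact/subsetPset/ndF/leq_maxl.
  by move: y Gy; exact/subsetPset/ndG/leq_maxr.
move=> k; have [mF Fk] := Foo k; have [mG Gk] := Goo k; split.
  rewrite -[X in measurable X]setTI; apply: measurable_row_uncons => //.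
  exact: measurableX.
rewrite /lebesgue_step /pushforward -comp_preimage.
rewrite (_ : row_uncons \o row_cons = id); last exact/funext/row_consK.
have -> : id @^-1` (F k `*` G k) = F k `*` G k by [].
by rewrite product_measure1E// lte_mul_pinfty// ge0_fin_numE.
Qed.

HB.instance Definition _ := Measure_isSigmaFinite.Build _ _ _ lebesgue_step
  lebesgue_step_sigma_finite.

End lebesgue_step.

Fixpoint lebesgue_row (R : realType) (n : nat) :
    {sigma_finite_measure set 'rV[R]_n -> \bar R} :=
  match n with
  | 0 => \d_(0 : 'rV[R]_0)
  | n'.+1 => lebesgue_step (lebesgue_row R n')
  end.

Lemma lebesgue_row_box (R : realType) (n : nat) (A : 'I_n -> set R) :
  (forall i, measurable (A i)) ->
  lebesgue_row R n [set v | forall i, A i (v ord0 i)] =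
  (\prod_(i < n) lebesgue_measure (A i))%E.
Proof.
elim: n A => [|n IHn] A mA.
  by rewrite big_ord0 /= diracE mem_set//= => -[].
have mbox : measurable [set v : 'rV[R]_n | forall i, A (lift ord0 i) (v ord0 i)].
  rewrite (_ : [set _ | _] = \big[setI/setT]_(i < n)
    (setT `&` (fun v : 'rV[R]_n => v ord0 i) @^-1` A (lift ord0 i))).
    by apply: bigsetI_measurable => i _; exact: measurable_coord.
  rewrite -bigcap_seq; apply/seteqP; split => v /= Av i.
    by move=> _; split.
  by have [] := Av i (mem_index_enum i).
rewrite big_ord_recl -IHn//= /lebesgue_step /pushforward.
have mA0 := mA ord0.
rewrite -product_measure1E//; congr ((_ \x _)%E _).
apply/seteqP; split => -[x v] /= Axv.
  split=> [|i]; first by have := Axv ord0; rewrite mxE unlift_none.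
  by have := Axv (lift ord0 i); rewrite mxE liftK.
move=> i; rewrite mxE; case: unliftP => [j ->|->] /=; first exact: Axv.2.
exact: Axv.1.
Qed.

Section euclidean.
Context {R : realType} {N : nat}.
Implicit Types u v w z : 'rV[R]_N.

Definition dotp u v : R := \sum_i u ord0 i * v ord0 i.

(* The library norm on 'rV[R]_N is the sup norm. *)
Definition enorm v : R := Num.sqrt (dotp v v).

Definition hat v : 'rV[R]_N := (enorm v)^-1 *: v.

Definition unit_ball : set 'rV[R]_N := [set w | enorm w <= 1].

Definition unit_sphere : set 'rV[R]_N := [set w | enorm w = 1].

Lemma enorm_ge0 v : 0 <= enorm v.
Proof. exact: sqrtr_ge0. Qed.

Lemma measurable_enorm : measurable_fun [set: 'rV[R]_N] enorm.
Proof.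
apply: (measurableT_comp (continuous_measurable_fun (@sqrt_continuous R))).
apply: measurable_sum => i.
by apply: measurable_funM; exact: measurable_coord.
Qed.

Lemma measurable_unit_ball : measurable unit_ball.
Proof.
rewrite (_ : unit_ball = setT `&` enorm @^-1` `]-oo, 1]%classic).
  exact: measurable_enorm.
by rewrite setTI; apply/seteqP; split => x /=; rewrite in_itv.
Qed.

Lemma measurable_hat : measurable_fun [set: 'rV[R]_N] hat.
Proof.
apply: measurable_fun_row => i.
under eq_fun do rewrite mxE.
apply: measurable_funM; last exact: measurable_coord.
apply: (measurableT_comp (f := GRing.inv : R -> R)); last exact: measurable_enorm.
rewrite -(setUv [set (0 : R)]) measurable_funU//; last exact: measurableC.
split.
  apply: (eq_measurable_fun (cst (0 : R))); last exact: measurable_cst.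
  by move=> x; rewrite inE /= => ->; rewrite invr0.
apply: open_continuous_measurable_fun.
  rewrite openC; apply: accessible_closed_set1.
  exact/hausdorff_accessible/Rhausdorff.
by move=> x; rewrite inE/= => /eqP x0; exact: inv_continuous.
Qed.

(* Surface measure on the unit sphere, as a measure on R^N carried by the
   sphere: sigma(A) = N * |{r w : 0 < r <= 1, w in A}|. *)
Definition sphere_measure (A : set 'rV[R]_N) : \bar R :=
  ((N%:R)%:E * lebesgue_row R N (unit_ball `&` hat @^-1` A))%E.

Let measurable_cone A : measurable A -> measurable (unit_ball `&` hat @^-1` A).
Proof.
move=> mA; apply: measurableI; first exact: measurable_unit_ball.
by rewrite -[X in measurable X]setTI; exact: measurable_hat.
Qed.

Let sphere_measure0 : sphere_measure set0 = 0%E.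
Proof. by rewrite /sphere_measure preimage_set0 setI0 measure0 mule0. Qed.

Let sphere_measure_ge0 A : (0 <= sphere_measure A)%E.
Proof. by rewrite mule_ge0// lee_fin. Qed.

Let sphere_measure_sigma_additive : semi_sigma_additive sphere_measure.
Proof.
move=> F mF tF mUF; rewrite /sphere_measure preimage_bigcup setI_bigcupr.
have -> : (fun n => \sum_(0 <= i < n) (N%:R)%:E *
    lebesgue_row R N (unit_ball `&` hat @^-1` F i))%E =
  (fun n => (N%:R)%:E * \sum_(0 <= i < n)
    lebesgue_row R N (unit_ball `&` hat @^-1` F i))%E.
  by apply/funext => n; rewrite ge0_sume_distrr.
apply: cvgeZl => //; apply: measure_semi_sigma_additive.
- by move=> n; exact: measurable_cone.
- apply/trivIsetP => /= i j _ _ ij; rewrite setIACA -preimage_setI.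
  by move/trivIsetP : tF => /(_ _ _ _ _ ij) ->//; rewrite preimage_set0 setI0.
- by rewrite -setI_bigcupr -preimage_bigcup; exact: measurable_cone.
Qed.

HB.instance Definition _ := isMeasure.Build _ _ _ sphere_measure
  sphere_measure0 sphere_measure_ge0 sphere_measure_sigma_additive.

End euclidean.

Section function_spaces.
Context {R : realType} {N : nat}.
Notation V := 'rV[R]_N.
Implicit Types (f : V -> R) (q : nat).

(* The restriction of phi to D has compact support contained in A. *)
Definition compact_support_in (T : topologicalType) (A : set T) (D : set T)
    (phi : T -> R) : Prop :=
  exists K : set T, [/\ compact K, K `<=` A &
    forall x, D x -> phi x != 0 -> K x].

Definition Cc (phi : V -> R) : Prop :=
  continuous phi /\ compact_support_in setT setT phi.

Definition C1 (W : normedModType R) (phi : W -> R) : Prop :=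
  (forall x, differentiable phi x) /\
  forall h, continuous (fun x => 'D_h phi x).

Definition partial (i : 'I_N) f : V -> R := fun v => 'D_(delta_mx ord0 i) f v.

Definition smooth f : Prop :=
  forall (s : seq 'I_N) v, differentiable (foldr partial f s) v.

(* Test functions of D'(R^N). *)
Definition test_function (phi : V -> R) : Prop :=
  smooth phi /\ compact_support_in setT setT phi.

(* Weighted norms take values in \bar R, with value +oo outside the space. *)
Definition L1norm q f : \bar R :=
  (\int[lebesgue_row R N]_v (`|f v| * (1 + enorm v ^+ q))%:E)%E.

Definition L1 q f : Prop :=
  measurable_fun [set: V] f /\ (L1norm q f < +oo)%E.

Definition W11norm q f : \bar R :=
  (L1norm q f + \sum_(i < N) L1norm q (partial i f))%E.

Definition BV q f : Prop :=
  exists (F : nat -> V -> R) (M : R),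
    [/\ forall n, smooth (F n),
        forall n, (W11norm q (F n) <= M%:E)%E &
        forall phi, test_function phi ->
          (fun n => \int[lebesgue_row R N]_v (F n v * phi v)) @ \oo -->
          \int[lebesgue_row R N]_v (f v * phi v)].

(* The finite signed measure nu, with Hahn decomposition (P, M), is the
   distributional derivative of f in the direction i. *)
Definition dist_partial (i : 'I_N) f (nu : {charge set V -> \bar R})
    (P M : set V) (nuPM : hahn_decomposition nu P M) : Prop :=
  forall phi, test_function phi ->
    \int[lebesgue_row R N]_v (f v * partial i phi v) =
    - (\int[jordan_pos nuPM]_v phi v - \int[jordan_neg nuPM]_v phi v).

(* The integral of 1 + |v|^q against the total variation of the i-th
   derivative of f. The set below has at most one element, a signed measure
   being determined by its action on test functions; the infimum is +oo when
   this derivative is not a finite measure. *)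
Definition variation_partial q (i : 'I_N) f : \bar R :=
  ereal_inf [set x | exists (nu : {charge set V -> \bar R}) (P M : set V)
    (nuPM : hahn_decomposition nu P M), dist_partial i f nuPM /\
    x = (\int[charge_variation nuPM]_v (1 + enorm v ^+ q)%:E)%E].

Definition BVnorm q f : \bar R :=
  (L1norm q f + \sum_(i < N) variation_partial q i f)%E.

Definition mass f : R := \int[lebesgue_row R N]_v f v.

Definition momentum f (i : 'I_N) : R :=
  \int[lebesgue_row R N]_v (f v * v ord0 i).

Definition energy f : R := \int[lebesgue_row R N]_v (f v * enorm v ^+ 2).

Definition nonneg_ae f : Prop := {ae lebesgue_row R N, forall v, 0 <= f v}.

End function_spaces.

Section collision.
Context {R : realType} {N : nat}.
Notation V := 'rV[R]_N.

Definition post (v vs z : V) : V :=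
  2^-1 *: (v + vs) + (enorm (vs - v) / 2) *: z.

Definition post_star (v vs z : V) : V :=
  2^-1 *: (v + vs) - (enorm (vs - v) / 2) *: z.

Definition angular_measure (alpha : R -> {nonneg R})
    (beta : R -> V -> probability V R) (E : R) (u : V) :
    {measure set V -> \bar R} :=
  mscale (alpha E) (beta E u).

Definition collision_rate (alpha : R -> {nonneg R})
    (beta : R -> V -> probability V R) (E : R) (u : V) :
    {measure set V -> \bar R} :=
  mscale (NngNum (enorm_ge0 u)) (angular_measure alpha beta E u).

(* The duality bracket <Q(f,f), phi>. *)
Definition Qweak (B : R -> V -> {measure set V -> \bar R})
    (f phi : V -> R) : R :=
  2^-1 * \int[(lebesgue_row R N \x lebesgue_row R N)%E]_p
    (f p.2 * f p.1 * \int[B (energy f) (p.1 - p.2)]_(z in unit_ball)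
      (phi (post_star p.1 p.2 z) + phi (post p.1 p.2 z) - phi p.1 - phi p.2)).

(* beta is only constrained for positive energies. *)
Definition carried_by_ball (beta : R -> V -> probability V R) : Prop :=
  forall E u, 0 < E -> beta E u unit_ball = 1%E.

Definition symmetric_rate (beta : R -> V -> probability V R) : Prop :=
  forall E u (A : set V), 0 < E -> measurable A ->
    beta E u A = beta E (- u) (-%R @` A).

Definition continuous_rate (alpha : R -> {nonneg R})
    (beta : R -> V -> probability V R) : Prop :=
  (forall phi : V -> R, Cc phi ->
    {within [set p : V * V * R | 0 < p.2], continuous (fun p : V * V * R =>
      \int[beta p.2 (p.1.1 - p.1.2)]_(z in unit_ball)
        phi (post p.1.1 p.1.2 z))}) /\
  {within [set E : R | 0 < E], continuous (fun E => (alpha E)%:num)}.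

Definition compact_pos (K : set R) : Prop :=
  compact K /\ K `<=` [set E | 0 < E].

Definition angular_spreading (beta : R -> V -> probability V R) : Prop :=
  exists j : R -> R -> R,
    [/\ forall E eps, 0 < E -> 0 < eps -> 0 <= j E eps,
        forall (E eps : R) (u : V), 0 < E -> 0 < eps -> u != 0 ->
          (beta E u (unit_ball `&`
             [set z : V | (1 - eps < `|dotp (hat u) z|)%R]) <=
           (j E eps)%:E)%E &
        forall K, compact_pos K -> forall eta, 0 < eta ->
          \forall eps \near 0^'+, forall E, K E -> j E eps < eta].

(* The domain (0,oo) x [0,oo) x [-1,1] of the angular density. *)
Definition density_domain : set (R * R * R) :=
  [set p | [/\ 0 < p.1.1, 0 <= p.1.2 & -1 <= p.2 <= 1]].

Definition bounded_density (bt : R -> R -> R -> R) : Prop :=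
  [/\ measurable_fun density_domain (fun p => bt p.1.1 p.1.2 p.2),
      forall p, density_domain p -> 0 <= bt p.1.1 p.1.2 p.2 &
      exists M, forall p, density_domain p -> bt p.1.1 p.1.2 p.2 <= M].

Definition inelastic_direction (r : R) (u s : V) : V :=
  ((1 - r) / 2) *: hat u + ((1 + r) / 2) *: s.

Definition inelastic_form (alpha : R -> {nonneg R})
    (beta : R -> V -> probability V R) (bt : R -> R -> R -> R) (e : R -> R) :
    Prop :=
  forall E (u : V) (Phi : V -> \bar R), 0 < E -> u != 0 ->
    measurable_fun [set: V] Phi -> (forall z, 0 <= Phi z)%E ->
    (\int[angular_measure alpha beta E u]_(z in unit_ball) Phi z =
     \int[@sphere_measure R N]_(s in unit_sphere)
       (Phi (inelastic_direction (e E) u s) *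
        (bt E (enorm u) (dotp (hat u) s))%:E))%E.

Definition restitution (e : R -> R) : Prop :=
  (forall E, 0 < E -> 0 <= e E <= 1) /\
  {within [set E : R | 0 < E], continuous e}.

(* The L^1(S^{N-1}) distance of the angular densities at energies E', E. *)
Definition density_distance (bt : R -> R -> R -> R) (E' E : R) (u : V) :
    \bar R :=
  (\int[@sphere_measure R N]_(s in unit_sphere)
     `|bt E' (enorm u) (dotp (hat u) s) -
       bt E (enorm u) (dotp (hat u) s)|%:E)%E.

Definition lipschitz_in_energy (bt : R -> R -> R -> R) (e : R -> R) : Prop :=
  forall K, compact_pos K -> exists2 L : R, 0 < L &
    forall E E', K E -> K E' ->
      (ereal_sup [set density_distance bt E' E u | u in [set u | u != 0%R]] <=
       (L * `|E' - E|)%:E)%E /\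
      `|e E' - e E| <= L * `|E' - E|.

Definition C0_L1 (q : nat) (T : R) (f : R -> V -> R) : Prop :=
  (forall t, 0 <= t <= T -> L1 q (f t)) /\
  forall t0, 0 <= t0 <= T ->
    L1norm q (f t \- f t0) @[t --> within [set t | 0 <= t <= T] (nbhs t0)]
      --> 0%E.

Definition Linfty_L1 (q : nat) (T : R) (f : R -> V -> R) : Prop :=
  exists M : R, {ae lebesgue_measure, forall t : R,
    0 < t < T -> (L1norm q (f t) <= M%:E)%E}.

Definition initial_datum (f0 : V -> R) : Prop :=
  [/\ L1 2 f0, nonneg_ae f0, mass f0 = 1 & forall i, momentum f0 i = 0].

(* The restrictions to t >= 0 of these functions are the elements of
   C^1_c([0,T) x R^N); their values for t < 0 are irrelevant. *)
Definition time_test (T : R) (phi : R * V -> R) : Prop :=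
  C1 phi /\ compact_support_in [set p : R * V | 0 <= p.1 < T]
              [set p : R * V | 0 <= p.1] phi.

Definition boltzmann_solution (B : R -> V -> {measure set V -> \bar R})
    (T : R) (f0 : V -> R) (f : R -> V -> R) : Prop :=
  [/\ initial_datum f0, C0_L1 2 T f,
      forall t, 0 <= t <= T -> nonneg_ae (f t) &
      forall phi, time_test T phi ->
        \int[lebesgue_measure]_(t in `[0, T])
          (\int[lebesgue_row R N]_v (f t v * 'D_((1, 0) : R * V) phi (t, v)) +
           Qweak B (f t) (fun v => phi (t, v))) =
        - \int[lebesgue_row R N]_v (f0 v * phi (0, v))].

End collision.

(* Main.v *)
Require Import Defs.
From HB Require Import structures.
From mathcomp Require Import all_boot all_order all_algebra.
From mathcomp Require Import all_classical all_reals all_analysis.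
From mathcomp Require Import measurable_realfun ring lra.

Set Implicit Arguments.
Unset Strict Implicit.
Unset Printing Implicit Defensive.

Import Order.TTheory GRing.Theory Num.Theory.
Import numFieldNormedType.Exports.

Local Open Scope classical_set_scope.
Local Open Scope ring_scope.


(* Writing the weak formulation of Q(f,f) - Q(g,g) as
   [Q_E(f,f) - Q_E(g,g)] + [Q_E(g,g) - Q_E'(g,g)] with E = E(f), E' = E(g),
   the first bracket is bilinear in f - g. Tested against psi with
   |psi| <= m := 1 + |v|^2, it is at most C ||f - g||_{L^1_2} up to the defect
   int (|f - g| m - (f - g) psi) (1 + |v|) >= 0: by the energy inequality the gain
   term is controlled by the loss term as soon as psi is close to sign (f - g) m.
   In the second bracket only the restitution coefficient and the density change
   with the energy. Changing the restitution coefficient moves v' = vs + W(u, s)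
   by at most |e - e'| |u| / 2; the change of variables (v, vs) -> (u, vs)
   followed by a translation in vs puts this shift on g(v) g(vs), where the BV bound
   (applied to mollifications of g) pays for it, so this bracket is at most
   C |E - E'| <= C ||f - g||_{L^1_2}.
   With psi chosen for time t, the difference quotients of n(t) = ||f - g||_{L^1_2}
   to the left of t are thus at most C n(t), and Gronwall's lemma applies. *)

(** * Translations and shears of Lebesgue measure *)

(** No time derivative of |f - g| is ever taken. For a fixed [psi] with |psi| <= m, put P(s) = int
    (f - g)(s) psi. The weak formulation makes P differentiable, P(s) <= n(s) at every s, and P(t)
    >= n(t) - defect at the one time t for which [psi] was built. Hence n(t) - n(s) <= P(t) - P(s) +
    defect, which for s < t bounds the left difference quotient from above. The obstacle is the
    factor |v - vs| of the collision rate: it raises the weight of the defect to third order, while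
    n has a weight of second order. Third-order distances are not bounded by n, but the fourth
    moments make them small between nearby times by interpolation, and so a [psi] built at t still
    serves just before t. In the BV step only derivatives of the product g(v) g(vs) along a common
    shift occur. Each term pairs one mollified derivative measure with one mollified density, and is
    bounded by weighted norms uniformly in the mollification. *)

Lemma ge0_integral_measure_map d1 d2 (X : measurableType d1)
    (Y : measurableType d2) (R : realType) (mu : {measure set X -> \bar R})
    (nu : {measure set Y -> \bar R}) (phi : X -> Y) (F : Y -> \bar R) :
  measurable_fun setT phi ->
  (forall A, measurable A -> nu A = mu (phi @^-1` A)) ->
  measurable_fun setT F -> (forall y, 0 <= F y)%E ->
  (\int[nu]_y F y = \int[mu]_x F (phi x))%E.
Proof.
move=> mphi nuE mF F0.
pose p : {mfun X >-> Y} := HB.pack phi (isMeasurableFun.Build _ _ _ _ _ mphi).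
transitivity (\int[pushforward mu p]_y F y)%E.
  by apply: eq_measure_integral => A mA _; exact: nuE.
by rewrite ge0_integral_pushforward// preimage_setT.
Qed.

Lemma integral_measure_map d1 d2 (X : measurableType d1)
    (Y : measurableType d2) (R : realType) (mu : {measure set X -> \bar R})
    (nu : {measure set Y -> \bar R}) (phi : X -> Y) (F : Y -> \bar R) :
  measurable_fun setT phi ->
  (forall A, measurable A -> nu A = mu (phi @^-1` A)) ->
  measurable_fun setT F ->
  (\int[nu]_y F y = \int[mu]_x F (phi x))%E.
Proof.
move=> mphi nuE mF; rewrite integralE [RHS]integralE.
congr (_ - _)%E.
- rewrite (ge0_integral_measure_map mphi nuE (measurable_funepos mF))//.
  by apply: eq_integral => x _; rewrite unlock.
- rewrite (ge0_integral_measure_map mphi nuE (measurable_funeneg mF))//.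
  by apply: eq_integral => x _; rewrite unlock.
Qed.

Lemma integrable_measure_map d1 d2 (X : measurableType d1)
    (Y : measurableType d2) (R : realType) (mu : {measure set X -> \bar R})
    (nu : {measure set Y -> \bar R}) (phi : X -> Y) (F : Y -> \bar R) :
  measurable_fun setT phi ->
  (forall A, measurable A -> nu A = mu (phi @^-1` A)) ->
  nu.-integrable setT F -> mu.-integrable setT (F \o phi).
Proof.
move=> mphi nuE /integrableP[mF Foo]; apply/integrableP; split.
  exact: measurableT_comp.
rewrite -(ge0_integral_measure_map (F := fun y => `|F y|%E) mphi nuE)//.
exact: measurableT_comp.
Qed.

(** Invariance is easier to prove for nonnegative integrals, by Tonelli. Testing on an indicator
    brings it back to sets, from where [integral_measure_map] extends it to signed functions. *)
Lemma measure_map_of_integral d1 d2 (X : measurableType d1)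
    (Y : measurableType d2) (R : realType) (mu : {measure set X -> \bar R})
    (nu : {measure set Y -> \bar R}) (phi : X -> Y) (A : set Y) :
  measurable A -> measurable (phi @^-1` A) ->
  (forall F : Y -> \bar R, measurable_fun setT F -> (forall y, 0 <= F y)%E ->
    (\int[nu]_y F y = \int[mu]_x F (phi x))%E) ->
  nu A = mu (phi @^-1` A).
Proof.
move=> mA mA' H.
rewrite -[A in LHS]setIT -[X in mu X]setIT -!integral_indic//.
rewrite (H (EFin \o \1_A))//; first exact/measurable_EFinP/measurable_indic.
by move=> y; rewrite lee_fin.
Qed.

Section shift.
Context {R : realType}.
Local Notation leb := (@lebesgue_measure R).

Lemma lebesgue_measure_shift (a : R) (A : set R) : measurable A ->
  leb ((fun x => x + a) @^-1` A) = leb A.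
Proof.
move=> mA.
have ms : @measurable_fun _ _ (measurableTypeR R) (measurableTypeR R) setT
    (fun x : R => x + a) by exact: measurable_funD.
pose p : {mfun measurableTypeR R >-> measurableTypeR R} :=
  HB.pack (fun x : R => x + a) (isMeasurableFun.Build _ _ _ _ _ ms).
rewrite -[LHS]/(pushforward leb p A); apply/esym.
(* A measure that agrees with Lebesgue measure on half-open intervals is Lebesgue measure. *)
apply: lebesgue_measure_unique => // X.
move=> /ocitvP[->|[[x y] /= xy ->]].
  by rewrite !measure0.
rewrite /pushforward.
rewrite [RHS](_ : _ = leb `](x - a), (y - a)]%classic).
  rewrite !lebesgue_measure_itv/= !lte_fin ltrD2r; case: ifP => // _.
  by rewrite -!EFinB; congr (_%:E); ring.
by congr leb; apply/seteqP; split => z /=; rewrite !in_itv/= ltrBlDr lerBrDr.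
Qed.

Lemma ge0_integral_shift (a : R) (F : R -> \bar R) : measurable_fun setT F ->
  (forall x, 0 <= F x)%E ->
  (\int[leb]_x F ((x : R) + a)%R = \int[leb]_x F x)%E.
Proof.
move=> mF F0; apply/esym/ge0_integral_measure_map => //.
- exact: measurable_funD.
- by move=> A mA; exact/esym/lebesgue_measure_shift.
Qed.

End shift.

Section row_shift.
Context {R : realType}.

Lemma measurable_row_add n (a : 'rV[R]_n) :
  measurable_fun setT (fun v : 'rV[R]_n => v + a).
Proof.
apply: measurable_fun_row => i; under eq_fun do rewrite mxE.
by apply: measurable_funD => //; exact: measurable_coord.
Qed.

Lemma ge0_integral_lebesgue_step n (F : 'rV[R]_n.+1 -> \bar R) :
  measurable_fun setT F -> (forall x, 0 <= F x)%E ->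
  (\int[lebesgue_row R n.+1]_x F x =
   \int[lebesgue_measure]_x \int[lebesgue_row R n]_v F (row_cons ((x : R), v)))%E.
Proof.
move=> mF F0.
rewrite (@ge0_integral_measure_map _ _ _ _ _
  ((@lebesgue_measure R) \x (lebesgue_row R n))%E _ row_cons)//; last first.
  exact: measurable_row_cons.
rewrite fubini_tonelli1//.
by apply: measurableT_comp mF _; exact: measurable_row_cons.
Qed.

(** Induction on the dimension: the first coordinate of [a] shifts the outer integral, the remaining
    ones shift the inner integral. *)
Lemma ge0_integral_row_shift n (a : 'rV[R]_n) (F : 'rV[R]_n -> \bar R) :
  measurable_fun setT F -> (forall x, 0 <= F x)%E ->
  (\int[lebesgue_row R n]_v F ((v : 'rV[R]_n) + a)%R = \int[lebesgue_row R n]_v F v)%E.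
Proof.
elim: n a F => [|n IH] a F mF F0.
  by apply: eq_integral => v _; congr F; apply/rowP => -[].
have mFa : measurable_fun setT (fun v : 'rV[R]_n.+1 => F (v + a)).
  by apply: measurableT_comp mF _; exact: measurable_row_add.
pose G (x : R) := (\int[lebesgue_row R n]_v F (row_cons (x, v)))%E.
have mG : measurable_fun setT G.
  apply: (@measurable_fun_fubini_tonelli_F _ _ (measurableTypeR R) _ _
    (lebesgue_row R n) (F \o row_cons)).
    by apply: measurableT_comp mF _; exact: measurable_row_cons.
  by move=> p; exact: F0.
rewrite (ge0_integral_lebesgue_step mFa (fun v => F0 (v + a))).
rewrite (ge0_integral_lebesgue_step mF F0).
transitivity (\int[lebesgue_measure]_x G ((x : R) + a ord0 ord0)%R)%E; last first.
  by apply: ge0_integral_shift => // x; apply: integral_ge0.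
apply: eq_integral => x _; rewrite /G.
rewrite -[RHS](IH (row_uncons a).2); last 2 first.
- apply: measurableT_comp mF _.
  by apply: measurableT_comp (@measurable_row_cons _ _) _; exact: pair1_measurable.
- by move=> v; exact: F0.
apply: eq_integral => v _; congr F; apply/rowP => i; rewrite !mxE.
by case: unliftP => [j ->|->] //=; rewrite !mxE.
Qed.

Lemma lebesgue_row_shift n (a : 'rV[R]_n) (A : set 'rV[R]_n) : measurable A ->
  lebesgue_row R n A = lebesgue_row R n ((fun v => v + a) @^-1` A).
Proof.
move=> mA.
have ma := measurable_row_add a.
have mA' : measurable ((fun v : 'rV[R]_n => v + a) @^-1` A).
  by rewrite -[X in measurable X]setTI; exact: ma.
apply: measure_map_of_integral => // F mF F0.
exact/esym/ge0_integral_row_shift.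
Qed.

(** Maps (v - vs, vs) to (v, vs), so that the relative velocity becomes a free variable. *)
Definition shear n (p : 'rV[R]_n * 'rV[R]_n) := (p.1 + p.2, p.2).

Lemma measurable_row_addf d (X : measurableType d) n (f g : X -> 'rV[R]_n) :
  measurable_fun setT f -> measurable_fun setT g ->
  measurable_fun setT (fun x => f x + g x).
Proof.
move=> mf mg; apply: measurable_fun_row => i; under eq_fun do rewrite mxE.
by apply: measurable_funD; exact: measurableT_comp (measurable_coord i) _.
Qed.

Lemma measurable_shear n : measurable_fun setT (@shear n).
Proof.
apply/measurable_fun_pairP; split; first exact: measurable_row_addf.
exact: measurable_snd.
Qed.

(** For a fixed second component the map translates the first, so Tonelli reduces the claim to
    [ge0_integral_row_shift]. *)
Lemma ge0_integral_shear n (F : 'rV[R]_n * 'rV[R]_n -> \bar R) :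
  measurable_fun setT F -> (forall x, 0 <= F x)%E ->
  (\int[(lebesgue_row R n \x lebesgue_row R n)%E]_p F p =
   \int[(lebesgue_row R n \x lebesgue_row R n)%E]_p F (shear p))%E.
Proof.
move=> mF F0.
have mFs : measurable_fun setT (F \o @shear n).
  exact: measurableT_comp mF (@measurable_shear _).
have Fs0 p : (0 <= F (shear p))%E by [].
rewrite (fubini_tonelli1 _ mF F0) (fubini_tonelli1 _ mFs Fs0).
rewrite (fubini_tonelli _ mF F0) (fubini_tonelli _ mFs Fs0).
apply: eq_integral => y _.
rewrite -(ge0_integral_row_shift y)//.
exact: measurableT_comp mF (pair2_measurable _).
Qed.

Lemma lebesgue_row_shear n (A : set ('rV[R]_n * 'rV[R]_n)) : measurable A ->
  (lebesgue_row R n \x lebesgue_row R n)%E A =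
  (lebesgue_row R n \x lebesgue_row R n)%E (@shear n @^-1` A).
Proof.
move=> mA.
have mA' : measurable (@shear n @^-1` A).
  by rewrite -[X in measurable X]setTI; exact: measurable_shear.
apply: measure_map_of_integral => // F mF F0.
exact: ge0_integral_shear.
Qed.

End row_shift.

(** * Smooth functions *)

Section flat_function.
Context {R : realType}.
Implicit Types (p : {poly R}) (x : R).

(* The functions p(1/x) exp(-1/x) extended by 0 to x <= 0 form a class closed
   under differentiation. *)
Definition flat p x : R := if 0 < x then p.[x^-1] * expR (- x^-1) else 0.

(** The exponential dominates the single term y^n / n! of its series. The bound is uniform in y,
    which makes every [flat p] bounded. *)
Lemma expR_mulX_le n (y : R) : 0 <= y -> y ^+ n * expR (- y) <= n`!%:R.
Proof.
move=> y0; rewrite expRN ler_pdivrMr ?expR_gt0//.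
case: n => [|n]; first by rewrite expr0 fact0 mul1r -expR0 ler_expR.
have := expR_ge1Dxn n y0.
have f0 : 0 < n.+1`!%:R :> R by rewrite ltr0n fact_gt0.
rewrite -(ler_pM2l f0) mulrDr mulrCA divff ?gt_eqF// !mulr1.
by apply: le_trans; rewrite lerDr ltW.
Qed.

Lemma flat_bound p : exists2 M : R, 0 <= M & forall x, `|flat p x| <= M.
Proof.
pose M := \sum_(i < size p) `|p`_i| * (i`!)%:R.
have M0 : 0 <= M by apply: sumr_ge0 => i _; rewrite mulr_ge0.
exists M => // x.
rewrite /flat; case: ifPn => [/ltW x0|_]; last by rewrite normr0.
rewrite horner_coef mulr_suml (le_trans (ler_norm_sum _ _ _))//.
apply: ler_sum => i _; rewrite -mulrA normrM ler_wpM2l//.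
rewrite ger0_norm; first by apply: expR_mulX_le; rewrite invr_ge0.
by rewrite mulr_ge0 ?expR_ge0// exprn_ge0// invr_ge0.
Qed.

(** Trades a power of x against a power of 1/x in the polynomial. With [flat_bound] it shows that
    every [flat p] vanishes to infinite order at 0. *)
Lemma flat_mulX p x : flat p x = flat ('X * p) x * x.
Proof.
rewrite /flat; case: ifP => [x0|]; last by rewrite mul0r.
by rewrite hornerM hornerX mulrAC [x^-1 * _]mulrC mulfVK ?gt_eqF.
Qed.

Lemma is_derive_flat p x :
  is_derive x 1 (flat p) (flat ('X ^+ 2 * (p - p^`())) x).
Proof.
have [x0|x0|->] := ltgtP x 0.
- have -> : flat ('X ^+ 2 * (p - p^`())) x = 0 by rewrite /flat ltNge ltW.
  apply: (@near_eq_is_derive _ _ _ (cst 0)).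
  near=> y; rewrite /flat ltNge ltW//.
  by near: y; exact: lt_nbhsl.
- have -> : flat ('X ^+ 2 * (p - p^`())) x =
     p.[x^-1] * (expR (- x^-1) * (- - x ^- 2)) +
     expR (- x^-1) * (p^`().[x^-1] * - x ^- 2).
    rewrite /flat x0 hornerM hornerXn hornerD hornerN exprVn; ring.
  apply: (@near_eq_is_derive R R^o R^o (fun y => p.[y^-1] * expR (- y^-1))).
    near=> y; rewrite /flat ifT//.
    by near: y; exact: lt_nbhsr.
  have dV : is_derive x 1 (fun y => y^-1) (- x ^- 2).
    have := @is_deriveV _ (@id R) x 1 1; rewrite /GRing.scale/= mulr1 => H.
    by apply: H; rewrite gt_eqF.
  have dp : is_derive x 1 (fun y => p.[y^-1]) (p^`().[x^-1] * - x ^- 2).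
    exact: (@is_derive1_comp _ (horner p) (fun y => y^-1)).
  have dN : is_derive x 1 (fun y => - y^-1) (- - x ^- 2) by exact: is_deriveN.
  have de : is_derive x 1 (fun y => expR (- y^-1)) (expR (- x^-1) * (- - x ^- 2)).
    exact: (@is_derive1_comp _ expR (fun y => - y^-1)).
  exact: (is_deriveM dp de).
(* At 0, two applications of [flat_mulX] write flat p h as a bounded factor times h^2, so the
   difference quotient is O(h). *)
- have [M M0 HM] := flat_bound ('X * ('X * p)).
  have L : (fun h : R => h^-1 *: (flat p (h *: 1 + 0) - flat p 0)) @ 0^' --> 0.
    apply/cvgr0Pnorm_le => e e0.
    near=> h.
    have h0 : h != 0 by near: h; exact: nbhs_dnbhs_neq.
    have -> : flat p 0 = 0 by rewrite /flat ltxx.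
    rewrite subr0 addr0 {2}/GRing.scale/= mulr1 flat_mulX flat_mulX.
    rewrite [X in `|X|](_ : _ = flat ('X * ('X * p)) h * h); last first.
      by rewrite /GRing.scale/= mulrCA mulVf// mulr1.
    rewrite normrM.
    rewrite (le_trans (ler_wpM2r _ (HM h)))//.
    have : `|h| <= e / (M + 1).
      near: h; apply: dnbhs0_le; rewrite divr_gt0// ltr_wpDl//.
    rewrite ler_pdivlMr ?ltr_wpDl// mulrC; apply: le_trans.
    by rewrite ler_wpM2r// lerDl.
  have -> : flat ('X ^+ 2 * (p - p^`())) 0 = 0 by rewrite /flat ltxx.
  apply: DeriveDef; first by apply/cvg_ex; exists 0; exact: L.
  by apply/cvg_lim => //; exact: L.
Unshelve. all: by end_near. Qed.


Lemma derivable_flat p x : derivable (flat p) x 1.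
Proof. by have [] := is_derive_flat p x. Qed.

Lemma flat_gt0 x : 0 < x -> 0 < flat 1 x.
Proof. by move=> x0; rewrite /flat x0 hornerC mul1r expR_gt0. Qed.

Lemma flat_le0 p x : x <= 0 -> flat p x = 0.
Proof. by rewrite /flat leNgt; case: ltP. Qed.

Lemma flat_ge0 x : 0 <= flat 1 x.
Proof. by have [/flat_gt0/ltW//|/flat_le0->] := ltP 0 x. Qed.

Lemma flat_le1 x : flat 1 x <= 1.
Proof.
rewrite /flat; case: ifP => // x0.
by rewrite hornerC mul1r -expR0 ler_expR oppr_le0 invr_ge0 ltW.
Qed.

Lemma measurable_flat p : measurable_fun setT (flat p).
Proof.
apply: continuous_measurable_fun => x.
exact/differentiable_continuous/derivable1_diffP/derivable_flat.
Qed.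

End flat_function.

Section smooth.
Context {R : realType} {N : nat}.
Notation V := 'rV[R]_N.
Implicit Types f g : V -> R.

(** The order is a recursion parameter so that closure under sums and products goes by induction
    through the Leibniz rule. Measurability is carried along with each derivative, because the
    sigma-algebra on rows is generated by the coordinates and not by the open sets. *)
Fixpoint measurable_smooth_upto k f : Prop :=
  [/\ forall v, differentiable f v, measurable_fun setT f &
    if k is k'.+1 then forall i, measurable_smooth_upto k' (partial i f)
    else True].

Definition measurable_smooth f := forall k, measurable_smooth_upto k f.

Local Notation msu := measurable_smooth_upto.

Lemma measurable_smooth_uptoW k f : msu k.+1 f -> msu k f.
Proof.
elim: k f => [|k IH] f /=; first by case.
by case=> df mf H; split => // i; exact: IH (H i).
Qed.

(** [foldr] applies the last index of the list first, hence the induction from the end of [s]. *)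
Lemma measurable_smoothE f : measurable_smooth f -> smooth f.
Proof.
move=> Hf s v; have := Hf (size s); elim/last_ind: s f {Hf} => [|s i IH] f /=.
  by case=> df _ _; exact: df.
rewrite size_rcons foldr_rcons => -[_ _ H]; exact: IH (H i).
Qed.

Lemma measurable_smooth_diff f v : measurable_smooth f -> differentiable f v.
Proof. by move=> /(_ 0%N)[]. Qed.

Lemma measurable_smooth_fun f : measurable_smooth f -> measurable_fun setT f.
Proof. by move=> /(_ 0%N)[]. Qed.

Lemma measurable_smooth_partial i f :
  measurable_smooth f -> measurable_smooth (partial i f).
Proof. by move=> Hf k; have [_ _] := Hf k.+1; exact. Qed.

Lemma measurable_smooth_continuous f : measurable_smooth f -> continuous f.
Proof.
by move=> Hf v; exact/differentiable_continuous/measurable_smooth_diff.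
Qed.

Lemma measurable_smooth_cst c : measurable_smooth (fun=> c).
Proof.
move=> k; elim: k c => [|k IH] c /=; split => //.
move=> i; rewrite (_ : partial _ _ = cst 0); first exact: IH.
by apply/funext => v; exact: derive_cst.
Qed.

Lemma partialD i f g v : differentiable f v -> differentiable g v ->
  partial i (fun v => f v + g v) v = partial i f v + partial i g v.
Proof. by move=> df dg; apply: deriveD; exact: diff_derivable. Qed.

Lemma partialM i f g v : differentiable f v -> differentiable g v ->
  partial i (fun v => f v * g v) v = f v * partial i g v + g v * partial i f v.
Proof. by move=> df dg; apply: deriveM; exact: diff_derivable. Qed.

Lemma measurable_smoothD f g : measurable_smooth f -> measurable_smooth g ->
  measurable_smooth (fun v => f v + g v).
Proof.
move=> Hf Hg k; move: (Hf k) (Hg k) => {Hf Hg}.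
elim: k f g => [|k IH] f g /= [df mf Hf] [dg mg Hg]; split => //.
- by move=> v; exact: differentiableD.
- exact: measurable_funD.
- by move=> v; exact: differentiableD.
- exact: measurable_funD.
- move=> i; rewrite (_ : partial _ _ = fun v => partial i f v + partial i g v).
    exact: IH.
  by apply/funext => v; exact: partialD.
Qed.

Lemma measurable_smooth_uptoD k f g : msu k f -> msu k g ->
  msu k (fun v => f v + g v).
Proof.
elim: k f g => [|k IH] f g /= [df mf Hf] [dg mg Hg]; split => //.
- by move=> v; exact: differentiableD.
- exact: measurable_funD.
- by move=> v; exact: differentiableD.
- exact: measurable_funD.
- move=> i; rewrite (_ : partial _ _ = fun v => partial i f v + partial i g v).
    exact: IH.
  by apply/funext => v; exact: partialD.
Qed.

Lemma measurable_smooth_uptoM k f g : msu k f -> msu k g ->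
  msu k (fun v => f v * g v).
Proof.
elim: k f g => [|k IH] f g /= Hf Hg.
  have [[df mf _] [dg mg _]] := (Hf, Hg); split => //.
  - by move=> v; exact: differentiableM.
  - exact: measurable_funM.
have [df mf pf] := Hf; have [dg mg pg] := Hg; split => //.
- by move=> v; exact: differentiableM.
- exact: measurable_funM.
- move=> i; rewrite (_ : partial _ _ =
    fun v => f v * partial i g v + g v * partial i f v).
    apply: measurable_smooth_uptoD; apply: IH => //;
      exact: measurable_smooth_uptoW.
  by apply/funext => v; exact: partialM.
Qed.

Lemma measurable_smoothM f g : measurable_smooth f -> measurable_smooth g ->
  measurable_smooth (fun v => f v * g v).
Proof. by move=> Hf Hg k; exact: measurable_smooth_uptoM. Qed.

Lemma measurable_smooth_prod (I : Type) (s : seq I) (F : I -> V -> R) :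
  (forall i, measurable_smooth (F i)) ->
  measurable_smooth (fun v => \prod_(i <- s) F i v).
Proof.
move=> HF; elim: s => [|i s IH].
  by under eq_fun do rewrite big_nil; exact: measurable_smooth_cst.
under eq_fun do rewrite big_cons.
exact: measurable_smoothM.
Qed.

Lemma measurable_smooth_sum (I : Type) (s : seq I) (F : I -> V -> R) :
  (forall i, measurable_smooth (F i)) ->
  measurable_smooth (fun v => \sum_(i <- s) F i v).
Proof.
move=> HF; elim: s => [|i s IH].
  by under eq_fun do rewrite big_nil; exact: measurable_smooth_cst.
under eq_fun do rewrite big_cons.
exact: measurable_smoothD.
Qed.

Lemma diff_coord (j : 'I_N) (v h : V) :
  'd (fun v : V => v ord0 j) v h = h ord0 j.
Proof.
have lin : linear (fun v : V => (v ord0 j : R^o)) by move=> a x y; rewrite !mxE.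
pose L : {linear V -> R^o} := HB.pack (fun v : V => (v ord0 j : R^o)) (GRing.isLinear.Build _ _ _ _ _ lin).
by rewrite (@diff_lin _ _ _ L) //; exact: coord_continuous.
Qed.

Lemma partial_coord i j :
  partial i (fun v : V => v ord0 j) = cst (i == j)%:R.
Proof.
apply/funext => v; rewrite /partial deriveE; last exact: differentiable_coord.
by rewrite diff_coord mxE eqxx eq_sym.
Qed.

Lemma measurable_smooth_coord j : measurable_smooth (fun v : V => v ord0 j).
Proof.
case=> [|k] /=; split => //.
- by move=> v; exact: differentiable_coord.
- exact: measurable_coord.
- by move=> v; exact: differentiable_coord.
- exact: measurable_coord.
- by move=> i; rewrite partial_coord; exact: measurable_smooth_cst.
Qed.

(** Each partial derivative is a constant times a function of the same form with another polynomial,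
    hence the induction on the order with [p] generalized. *)
Lemma measurable_smooth_flat (p : {poly R}) a b j :
  measurable_smooth (fun v : V => flat p (a * v ord0 j + b)).
Proof.
have ma : measurable_smooth (fun v : V => a * v ord0 j + b).
  apply: measurable_smoothD; last exact: measurable_smooth_cst.
  by apply: measurable_smoothM; [exact: measurable_smooth_cst|exact: measurable_smooth_coord].
have dp q v : differentiable (fun v : V => flat q (a * v ord0 j + b)) v.
  apply: (@differentiable_comp _ _ _ _ (fun v : V => a * v ord0 j + b) (flat q)).
    exact: measurable_smooth_diff ma.
  exact/derivable1_diffP/derivable_flat.
have mp q : measurable_fun setT (fun v : V => flat q (a * v ord0 j + b)).
  apply: measurableT_comp; first exact: measurable_flat.
  exact: measurable_smooth_fun ma.
move=> k; elim: k p => [|k IH] p /=; split => // i.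
rewrite (_ : partial _ _ = fun v => ((a * (i == j)%:R) *
   flat ('X ^+ 2 * (p - p^`())) (a * v ord0 j + b))).
  apply: measurable_smooth_uptoM; first exact: measurable_smooth_cst.
  exact: IH.
apply/funext => v; rewrite /partial deriveE; last exact: dp.
rewrite (@diff_comp _ _ _ _ (fun v : V => a * v ord0 j + b) (flat p)); last 2 first.
  exact: measurable_smooth_diff ma.
  exact/derivable1_diffP/derivable_flat.
rewrite /= deriv1E; last exact: derivable_flat.
have -> : (flat p)^`()%classic (a * v ord0 j + b) = flat ('X ^+ 2 * (p - p^`())) (a * v ord0 j + b).
  by rewrite derive1E; have [_] := is_derive_flat p (a * v ord0 j + b).
rewrite /GRing.scale/=; congr (_ * _).
rewrite -deriveE; last exact: measurable_smooth_diff ma.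
rewrite -/(partial i (fun v : V => a * v ord0 j + b) v) partialD; last 2 first.
- apply: differentiableM; first exact: differentiable_cst.
  exact: differentiable_coord.
- exact: differentiable_cst.
rewrite partialM; last 2 first.
- exact: differentiable_cst.
- exact: differentiable_coord.
rewrite partial_coord [partial i (fun=> a) v]derive_cst.
by rewrite [partial i (fun=> b) v]derive_cst mulr0 !addr0.
Qed.

Lemma derive_partial (f : V -> R) (v h : V) : differentiable f v ->
  'D_h f v = \sum_i h ord0 i * partial i f v.
Proof.
move=> df; rewrite deriveE// [h in LHS]row_sum_delta linear_sum.
apply: eq_bigr => i _; rewrite linearZ/= /partial deriveE//.
Qed.

Lemma measurable_smooth_C1 f : measurable_smooth f -> C1 f.
Proof.
move=> sf; split=> [v|h]; first exact: measurable_smooth_diff.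
rewrite (_ : (fun v => 'D_h f v) = fun v => \sum_i h ord0 i * partial i f v).
  apply: measurable_smooth_continuous; apply: measurable_smooth_sum => i.
  apply: measurable_smoothM; first exact: measurable_smooth_cst.
  exact: measurable_smooth_partial.
by apply/funext => v; apply: derive_partial; exact: measurable_smooth_diff.
Qed.

End smooth.

(** * Density of smooth functions *)

Lemma le_integral_EFin d (T : measurableType d) (R : realType)
    (mu : {measure set T -> \bar R}) (f g : T -> R) :
  measurable_fun setT f -> measurable_fun setT g ->
  (forall v, 0 <= f v) -> (forall v, f v <= g v) ->
  (\int[mu]_v (f v)%:E <= \int[mu]_v (g v)%:E)%E.
Proof.
move=> mf mg f0 fg; apply: ge0_le_integral => //.
- by move=> v _; rewrite lee_fin.
- exact/measurable_EFinP.
- exact/measurable_EFinP.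
- by move=> v _; rewrite lee_fin.
Qed.

Lemma dominated_L1_small d (T : measurableType d) (R : realType)
    (mu : {measure set T -> \bar R}) (s : nat -> T -> R) (t g : T -> R)
    (eps : R) :
  (forall n, measurable_fun setT (s n)) -> measurable_fun setT t ->
  (forall n v, `|s n v| <= g v) ->
  mu.-integrable setT (EFin \o g) ->
  (forall v, s ^~ v @ \oo --> t v) -> 0 < eps ->
  \forall n \near \oo, (\int[mu]_v `|s n v - t v|%:E <= eps%:E)%E.
Proof.
move=> ms mt sg ig st e0.
have [_ H _] : [/\ mu.-integrable setT (EFin \o t),
  [sequence \int[mu]_x `|(s n x)%:E - (t x)%:E|]_n @ \oo --> 0 &
  [sequence \int[mu]_x (s n x)%:E]_n @ \oo --> \int[mu]_x (t x)%:E]%E.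
  apply: (@dominated_convergence _ _ _ mu setT measurableT
    (fun n v => (s n v)%:E) (fun v => (t v)%:E) (fun v => (g v)%:E)) => //.
  - by move=> n; exact/measurable_EFinP.
  - exact/measurable_EFinP.
  - apply: aeW => v _; apply: cvg_EFin; first exact: nearW.
    exact: st.
  - by apply: aeW => v n _; rewrite lee_fin.
have e0' : (0 < eps%:E)%E by rewrite lte_fin.
have /fine_cvgP[_ /cvgrPdist_le /(_ _ e0)] := H.
near_simpl => H2.
have /fine_cvgP[H1 _] := H.
near=> n.
have : `|0 - fine (\int[mu]_x `|(s n x)%:E - (t x)%:E|)| <= eps by near: n.
rewrite sub0r normrN ger0_norm ?fine_ge0 ?integral_ge0// -lee_fin fineK; last by near: n.
by apply: le_trans; apply: ge0_le_integral => //; do ?[by move=> v _; rewrite lee_fin];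
  apply/measurable_EFinP; apply: measurableT_comp => //; exact: measurable_funB.
Unshelve. all: by end_near. Qed.

Section approximation.
Context {R : realType} {N : nat}.
Notation V := 'rV[R]_N.
Variables (mu : {measure set V -> \bar R}) (w : V -> R).
Hypothesis mw : measurable_fun setT w.
Hypothesis w0 : forall v, 0 <= w v.

Lemma weighted_limit (s : nat -> V -> R) (t g : V -> R) (eps : R) :
  (forall n, measurable_fun setT (s n)) -> measurable_fun setT t ->
  (forall n v, `|s n v| <= g v) ->
  mu.-integrable setT (fun v => (g v * w v)%:E) ->
  (forall v, s ^~ v @ \oo --> t v) -> 0 < eps ->
  exists n, (\int[mu]_v (`|s n v - t v| * w v)%:E <= eps%:E)%E.
Proof.
move=> ms mt sg ig st e0.
have := @dominated_L1_small _ _ _ mu (fun n v => s n v * w v)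
  (fun v => t v * w v) (fun v => g v * w v) eps.
move=> /(_ _ _ _ ig _ e0) [||||n _ /(_ n (leqnn n)) Hn].
- by move=> n; exact: measurable_funM.
- exact: measurable_funM.
- by move=> n v; rewrite normrM (ger0_norm (w0 v)) ler_wpM2r.
- by move=> v; apply: cvgMr_tmp; exact: st.
exists n; move: Hn; under eq_integral => v _ do
  rewrite -mulrBl normrM (ger0_norm (w0 v)).
exact.
Qed.

Hypothesis iw : mu.-integrable setT (EFin \o w).

(** The range [0, 1] is imposed on [chi] so that the class is stable under complements and products:
    the error of one factor is multiplied by the other, which is at most 1. *)
Definition approximable (s : V -> R) :=
  measurable_fun setT s /\ forall eps, 0 < eps -> exists2 chi : V -> R,
    measurable_smooth chi /\ (forall v, 0 <= chi v <= 1) &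
    (\int[mu]_v (`|s v - chi v| * w v)%:E <= eps%:E)%E.

Lemma L1w_triangle (f g h : V -> R) : measurable_fun setT f ->
  measurable_fun setT g -> measurable_fun setT h ->
  (\int[mu]_v (`|f v - h v| * w v)%:E <= \int[mu]_v (`|f v - g v| * w v)%:E
    + \int[mu]_v (`|g v - h v| * w v)%:E)%E.
Proof.
move=> mf mg mh.
have mB (f1 f2 : V -> R) : measurable_fun setT f1 -> measurable_fun setT f2 ->
    measurable_fun setT (fun v => (`|f1 v - f2 v| * w v)%:E).
  move=> m1 m2; apply/measurable_EFinP; apply: measurable_funM => //.
  by apply: measurableT_comp => //; exact: measurable_funB.
have p0 (f1 f2 : V -> R) v : (0 <= (`|f1 v - f2 v| * w v)%:E)%E.
  by rewrite lee_fin mulr_ge0.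
rewrite -ge0_integralD//; try exact: mB.
apply: ge0_le_integral => //; first exact: mB.
  by apply: emeasurable_funD; exact: mB.
by move=> v _; rewrite -EFinD lee_fin -mulrDl ler_wpM2r// ler_distD.
Qed.

(** The constant 1 is a dominating function because [w] is integrable, so pointwise limits are
    limits in the weighted norm. *)
Lemma approximable_cvg (s : nat -> V -> R) (t : V -> R) :
  (forall n, approximable (s n)) -> (forall n v, 0 <= s n v <= 1) ->
  (forall v, s ^~ v @ \oo --> t v) -> approximable t.
Proof.
move=> As s01 st.
have mt : measurable_fun setT t.
  apply/measurable_EFinP; apply: (@emeasurable_fun_cvg _ _ _ setT (fun n v => (s n v)%:E)).
    by move=> n; apply/measurable_EFinP; exact: (As n).1.
  by move=> v _; apply: cvg_EFin; [exact: nearW|exact: st].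
split => // eps e0; have e2 : 0 < eps / 2 by rewrite divr_gt0.
have [|||n Hn] := @weighted_limit s t (fun=> 1) _ _ mt _ _ st e2.
- by move=> n; exact: (As n).1.
- by move=> n v; have /andP[? ?] := s01 n v; rewrite ger0_norm.
- by under eq_fun do rewrite mul1r.
have [chi [schi chi01] Hchi] := (As n).2 _ e2.
exists chi => //.
apply: (le_trans (@L1w_triangle _ (s n) _ mt (As n).1 (measurable_smooth_fun schi))).
rewrite [eps]splitr EFinD leeD//.
by under eq_integral do rewrite distrC.
Qed.

Lemma approximable_smooth (s : V -> R) : measurable_smooth s ->
  (forall v, 0 <= s v <= 1) -> approximable s.
Proof.
move=> ss s01; split; first exact: measurable_smooth_fun.
move=> eps e0; exists s => //.
under eq_integral do rewrite subrr normr0 mul0r.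
by rewrite integral0 lee_fin ltW.
Qed.

Lemma approximable_compl (s : V -> R) : approximable s ->
  approximable (fun v => 1 - s v).
Proof.
move=> [ms As]; split; first exact: measurable_funB.
move=> eps /As[chi [schi chi01] H].
exists (fun v => 1 + (-1) * chi v).
  split.
    apply: measurable_smoothD; first exact: measurable_smooth_cst.
    by apply: measurable_smoothM => //; exact: measurable_smooth_cst.
  by move=> v; have := chi01 v; lra.
rewrite (eq_integral (fun v => (`|s v - chi v| * w v)%:E))// => v _.
by congr ((_ * _)%:E); rewrite -normrN; congr `|_|; ring.
Qed.

Lemma approximable_mul (s t : V -> R) :
  (forall v, 0 <= s v <= 1) -> (forall v, 0 <= t v <= 1) ->
  approximable s -> approximable t -> approximable (fun v => s v * t v).
Proof.
move=> s01 t01 [ms As] [mt At]; split; first exact: measurable_funM.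
move=> eps e0; have e2 : 0 < eps / 2 by rewrite divr_gt0.
have [c1 [sc1 c101] H1] := As _ e2; have [c2 [sc2 c201] H2] := At _ e2.
exists (fun v => c1 v * c2 v).
  split; first exact: measurable_smoothM.
  move=> v; have /andP[? ?] := c101 v; have /andP[? ?] := c201 v.
  by rewrite mulr_ge0//= mulr_ile1.
have mc1 := measurable_smooth_fun sc1; have mc2 := measurable_smooth_fun sc2.
apply: (le_trans (@L1w_triangle _ (fun v => c1 v * t v) _ _ _ _)).
- exact: measurable_funM.
- exact: measurable_funM.
- exact: measurable_funM.
have mB (f1 f2 : V -> R) : measurable_fun setT f1 -> measurable_fun setT f2 ->
    measurable_fun setT (fun v => (`|f1 v - f2 v| * w v)%:E).
  move=> m1 m2; apply/measurable_EFinP; apply: measurable_funM => //.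
  by apply: measurableT_comp => //; exact: measurable_funB.
rewrite [eps]splitr EFinD leeD//.
- apply: le_trans H1; apply: ge0_le_integral => //.
  + by move=> v _; rewrite lee_fin mulr_ge0.
  + by apply: mB; exact: measurable_funM.
  + exact: mB.
  + move=> v _; rewrite lee_fin ler_wpM2r// -mulrBl normrM.
    by have /andP[t0 t1] := t01 v; rewrite (ger0_norm t0) ler_piMr.
- apply: le_trans H2; apply: ge0_le_integral => //.
  + by move=> v _; rewrite lee_fin mulr_ge0.
  + by apply: mB; exact: measurable_funM.
  + exact: mB.
  + move=> v _; rewrite lee_fin ler_wpM2r// -mulrBr normrM.
    by have /andP[t0 t1] := c101 v; rewrite (ger0_norm t0) ler_piMl.
Qed.

Lemma indic01 (A : set V) v : 0 <= (\1_A v : R) <= 1.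
Proof. by rewrite indicE; case: (_ \in _); rewrite ?lexx ?ler01. Qed.

Lemma approximable_setC (A : set V) :
  approximable \1_A -> approximable \1_(~` A).
Proof.
move=> /approximable_compl; congr approximable; apply/funext => v.
by rewrite !indicE in_setC; case: (_ \in _); rewrite ?subrr ?subr0.
Qed.

Lemma approximable_setI (A B : set V) :
  approximable \1_A -> approximable \1_B -> approximable \1_(A `&` B).
Proof.
by move=> HA HB; rewrite indicI; apply: approximable_mul => // v; exact: indic01.
Qed.

Lemma approximable_setU (A B : set V) :
  approximable \1_A -> approximable \1_B -> approximable \1_(A `|` B).
Proof.
move=> HA HB; rewrite -[_ `|` _]setCK setCU.
by apply/approximable_setC/approximable_setI; exact: approximable_setC.
Qed.

Lemma approximable_set0 : approximable (\1_(set0 : set V)).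
Proof.
rewrite indic0; apply: approximable_smooth; first exact: measurable_smooth_cst.
by move=> v; rewrite lexx ler01.
Qed.

Lemma approximable_bigcup (F : nat -> set V) :
  (forall n, approximable \1_(F n)) -> approximable \1_(\bigcup_n F n).
Proof.
move=> HF; apply: (@approximable_cvg (fun n => \1_(\big[setU/set0]_(k < n) F k))).
- move=> n; elim: n => [|n IH]; first by rewrite big_ord0; exact: approximable_set0.
  by rewrite big_ord_recr; exact: approximable_setU.
- by move=> n v; exact: indic01.
- move=> v; have [[k _ Fk]|nF] := pselect ((\bigcup_n F n) v).
    apply: cvg_near_cst; near=> n; rewrite !indicE !mem_set//; first by exists k.
    rewrite -bigcup_mkord; exists k => //=; near: n; exact: nbhs_infty_gt.
  apply: cvg_near_cst; apply: nearW => n; rewrite !indicE !memNset//.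
  by rewrite -bigcup_mkord => -[k _ Fk]; apply: nF; exists k.
Unshelve. all: by end_near. Qed.

(** Rescaling the flat function gives smooth approximations of the indicator of an open ray, the
    sets from which [approximable_indic] starts. *)
Lemma flat_cvg (x : R) :
  (fun n : nat => flat 1 (n.+1%:R * x)) @ \oo --> (\1_(`]0, +oo[%classic) x : R).
Proof.
have [x0|x0] := ltP 0 x; last first.
  apply: cvg_near_cst; apply: nearW => n.
  rewrite flat_le0 ?indicE ?memNset//=; first by rewrite in_itv/= andbT ltNge x0.
  by rewrite mulr_ge0_le0.
rewrite indicE mem_set/=; last by rewrite in_itv/= x0.
rewrite (_ : (fun n => _) = fun n => expR (- (n.+1%:R * x)^-1)); last first.
  by apply/funext => n; rewrite /flat mulr_gt0// hornerC mul1r.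
rewrite -[X in _ --> X]expR0.
apply: continuous_cvg; first exact: continuous_expR.
rewrite -[X in _ --> X]oppr0; apply: cvgN.
under eq_fun do rewrite invfM.
have H := cvgMr_tmp (b := x^-1) (@cvg_harmonic R); rewrite mul0r in H.
exact: H.
Qed.

(** The sets with approximable indicator form a sigma-algebra. The generators reduce first to sets
    depending on one coordinate, then to open rays in that coordinate. *)
Lemma approximable_indic (A : set V) : measurable A -> approximable \1_A.
Proof.
suff : @measurable _ V `<=` [set B | approximable \1_B] by apply.
apply: smallest_sub.
  split=> [|B /= HB|F /= HF].
  - exact: approximable_set0.
  - by rewrite setTD; exact: approximable_setC.
  - exact: approximable_bigcup.
move=> B /=; rewrite -bigcup_seq/= => -[i _ [C mC <-]].
rewrite setTI.
suff : (@ocitv R).-sigma.-measurable `<=`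
   [set C : set R | approximable \1_((fun v : V => v ord0 i) @^-1` C)].
  by move=> /(_ C mC).
rewrite RGenOInfty.measurableE.
apply: smallest_sub.
  split=> [|D /= HD|F /= HF].
  - by rewrite /= preimage_set0; exact: approximable_set0.
  - by rewrite setTD preimage_setC; exact: approximable_setC.
  - by rewrite preimage_bigcup; exact: approximable_bigcup.
move=> D [x ->] /=.
apply: (@approximable_cvg (fun n v => flat 1 (n.+1%:R * v ord0 i + n.+1%:R * - x))).
- move=> n; apply: approximable_smooth; first exact: measurable_smooth_flat.
  by move=> v; rewrite flat_ge0 flat_le1.
- by move=> n v; rewrite flat_ge0 flat_le1.
- move=> v; under eq_fun do rewrite -mulrDr.
  have := @flat_cvg (v ord0 i - x); congr (_ --> _).
  by rewrite !indicE; congr (nat_of_bool _)%:R; apply/idP/idP; rewrite !inE/= !in_itv/= !andbT subr_gt0.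
Qed.

End approximation.

(** * Smooth cutoffs with bounded support *)

Section boxes.
Context {R : realType} {N : nat}.
Notation V := 'rV[R]_N.

Lemma flat_mono (x y : R) : x <= y -> flat 1 x <= flat 1 y.
Proof.
move=> xy; have [x0|x0] := leP x 0; first by rewrite flat_le0// flat_ge0.
have y0 := lt_le_trans x0 xy.
by rewrite /flat x0 y0 !hornerC !mul1r ler_expR lerN2 lef_pV2.
Qed.

Definition bounded_support (f : V -> R) :=
  exists r : R, forall v, f v != 0 -> forall j, `|v ord0 j| <= r.

(** For a > 0 it is positive exactly on the open cube |v_j| < b / a. *)
Definition box_bump (a b : R) (v : V) : R :=
  \prod_(j <- enum 'I_N) (flat 1 (a * v ord0 j + b) * flat 1 (- a * v ord0 j + b)).

Lemma box_bump_smooth a b : measurable_smooth (box_bump a b).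
Proof.
apply: measurable_smooth_prod => j.
by apply: measurable_smoothM; exact: measurable_smooth_flat.
Qed.

Lemma box_bump01 a b v : 0 <= box_bump a b v <= 1.
Proof.
rewrite /box_bump; elim: (enum _) => [|j s IH].
  by rewrite big_nil ler01 lexx.
rewrite big_cons; set p := \prod_(_ <- _) _ in IH *.
move: IH => /andP[p0 p1].
by rewrite !mulr_ge0 ?flat_ge0//= !mulr_ile1 ?mulr_ge0 ?flat_ge0 ?flat_le1.
Qed.

Lemma box_bump_support a b v : 0 < a -> box_bump a b v != 0 ->
  forall j, `|v ord0 j| <= b / a.
Proof.
move=> a0 H j; move: H; apply: contraNT; rewrite -ltNge => H.
rewrite /box_bump (bigD1_seq j) ?mem_enum ?enum_uniq//= mulf_eq0; apply/orP; left.
move: H; rewrite lter_normr mulf_eq0 => /orP[] H; apply/orP.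
- right; rewrite flat_le0// mulNr addrC subr_le0.
  by rewrite ltr_pdivrMr// mulrC in H; exact: ltW.
- left; rewrite flat_le0// -lerBrDr sub0r.
  by rewrite ltr_pdivrMr// mulNr mulrC ltrNr in H; exact: ltW.
Qed.

Lemma bounded_support_box a b : 0 < a -> bounded_support (box_bump a b).
Proof. by move=> a0; exists (b / a) => v; exact: box_bump_support. Qed.

(** The cube has radius k + 1. The slope k + 1 makes the arguments of [flat] equal to (k + 1) (k + 1
    +/- v_j), which monotonicity compares with [flat_cvg] at x = 1. *)
Definition cutoff (k : nat) : V -> R := box_bump k.+1%:R (k.+1%:R ^+ 2).

Lemma cutoff01 k v : 0 <= cutoff k v <= 1.
Proof. exact: box_bump01. Qed.

Lemma cutoff_smooth k : measurable_smooth (cutoff k).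
Proof. exact: box_bump_smooth. Qed.

Lemma bounded_support_cutoff k : bounded_support (cutoff k).
Proof. exact: bounded_support_box. Qed.

Lemma flat_cvg1 (y : R) :
  (fun k : nat => flat 1 (k.+1%:R * (y + k.+1%:R))) @ \oo --> (1 : R).
Proof.
have := @flat_cvg R 1; rewrite indicE mem_set/=; last by rewrite in_itv/= ltr01.
move=> H.
apply: (@squeeze_cvgr _ _ _ _ (fun n : nat => flat 1 (n.+1%:R * 1)) (fun=> 1)) => //.
- near=> n; rewrite flat_le1 andbT; apply: flat_mono; rewrite ler_wpM2l//.
  suff : 1 - y <= n%:R by rewrite -(natr1 n); lra.
  by near: n; exact: nbhs_infty_ger.
- exact: cvg_cst.
Unshelve. all: by end_near. Qed.

Lemma cutoff_cvg v : cutoff ^~ v @ \oo --> (1 : R).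
Proof.
rewrite /cutoff /box_bump; elim: (enum _) => [|j s IH].
  by under eq_fun do rewrite big_nil; exact: cvg_cst.
under eq_fun do rewrite big_cons.
have H1 : (fun k : nat => flat 1 (k.+1%:R * v ord0 j + k.+1%:R ^+ 2)) @ \oo --> (1 : R).
  by under eq_fun do rewrite expr2 -mulrDr; exact: flat_cvg1.
have H2 : (fun k : nat => flat 1 (- k.+1%:R * v ord0 j + k.+1%:R ^+ 2)) @ \oo --> (1 : R).
  by under eq_fun do rewrite expr2 mulNr -mulrN -mulrDr; exact: flat_cvg1.
have H := cvgM (cvgM H1 H2) IH; rewrite !mulr1 in H.
exact: H.
Qed.

Lemma bounded_supportM (f g : V -> R) : bounded_support g ->
  bounded_support (fun v => f v * g v).
Proof.
move=> [r Hr]; exists r => v fg; apply: Hr.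
by apply: contraNneq fg => ->; rewrite mulr0.
Qed.

Lemma compact_support_bounded (f : V -> R) : bounded_support f ->
  compact_support_in setT setT f.
Proof.
move=> [r Hr]; exists [set v : V | forall j, `[- r, r]%classic (v ord0 j)]; split => //.
  apply: (@rV_compact _ _ (fun=> `[- r, r]%classic)) => _.
  exact: segment_compact.
by move=> v _ /Hr H j /=; rewrite in_itv/= -ler_norml.
Qed.

Lemma test_function_bounded_support (f : V -> R) : measurable_smooth f ->
  bounded_support f -> test_function f.
Proof.
by move=> sf bf; split; [exact: measurable_smoothE|exact: compact_support_bounded].
Qed.

Lemma bounded_support_bounded (f : V -> R) : measurable_smooth f ->
  bounded_support f -> exists2 M : R, 0 <= M & forall v, `|f v| <= M.
Proof.
move=> sf [r Hr].
have cf : {within [set v : V | forall j, `[- r, r]%classic (v ord0 j)],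
    continuous (fun v => `|f v|)}.
  apply: continuous_subspaceT => v; apply: continuous_comp.
    exact: measurable_smooth_continuous.
  exact: norm_continuous.
have K : compact [set v : V | forall j, `[- r, r]%classic (v ord0 j)].
  apply: (@rV_compact _ _ (fun=> `[- r, r]%classic)) => _.
  exact: segment_compact.
(* For r < 0 a point with f v != 0 can exist only when N = 0, and then it is the single point 0. *)
have [r0|r0] := leP 0 r; last first.
  exists `|f 0| => // v; have [->|/Hr H] := eqVneq (f v) 0; first by rewrite normr0.
  suff -> : v = 0 by [].
  by apply/rowP => j; have := le_trans (normr_ge0 _) (H j); rewrite leNgt r0.
have [|c _ Hc] := EVT_max_rV _ K cf.
  by exists 0 => j /=; rewrite mxE in_itv/= oppr_le0 r0.
exists `|f c| => // v.
have [->|/Hr H] := eqVneq (f v) 0; first by rewrite normr0.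
by apply: Hc; rewrite inE => j /=; rewrite in_itv/= -ler_norml.
Qed.

End boxes.

Import HBNNSimple.

(** * Approximation of signs and of integrable functions *)

Section density.
Context {R : realType} {N : nat}.
Notation V := 'rV[R]_N.
Variables (mu : {measure set V -> \bar R}).

(** [psi] is 2 chi - 1 cut off at infinity, where [chi] approximates the indicator of h >= 0. Errors
    are measured with the weight |h| w, against which bounded functions are integrable even if they
    are not against [w]. *)
Lemma sign_density (h w : V -> R) (eps : R) :
  measurable_fun setT h -> measurable_fun setT w -> (forall v, 0 <= w v) ->
  mu.-integrable setT (fun v => (`|h v| * w v)%:E) -> 0 < eps ->
  exists psi : V -> R, [/\ measurable_smooth psi, bounded_support psi,
    forall v, `|psi v| <= 1 &
    (\int[mu]_v ((`|h v| - h v * psi v) * w v)%:E <= eps%:E)%E].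
Proof.
move=> mh mw w0 ih e0.
pose om v := `|h v| * w v.
have mom : measurable_fun setT om.
  by apply: measurable_funM => //; exact: measurableT_comp.
have om0 v : 0 <= om v by rewrite mulr_ge0.
pose A := [set v | 0 <= h v].
have mA : measurable A.
  rewrite (_ : A = setT `&` h @^-1` `[0, +oo[%classic); first exact: mh.
  by apply/seteqP; split => v; rewrite /A /= in_itv/= andbT => // -[].
(* The error of [chi] is doubled in 2 chi - 1, hence the quarter. *)
have e4 : 0 < eps / 4 by rewrite divr_gt0.
have e2 : 0 < eps / 2 by rewrite divr_gt0.
have [_ /(_ _ e4)[chi [schi chi01] Hchi]] := approximable_indic mom om0 ih mA.
have [||||||n Hn] := @weighted_limit _ _ mu om mom om0 cutoff (fun=> 1) (fun=> 1) (eps / 2).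
- by move=> n; apply: measurable_smooth_fun; exact: cutoff_smooth.
- exact: measurable_cst.
- by move=> n v; have /andP[? ?] := cutoff01 n v; rewrite ger0_norm.
- by under eq_fun do rewrite mul1r.
- by move=> v; exact: cutoff_cvg.
- exact: e2.
exists (fun v => (2 * chi v + (-1)) * cutoff n v).
have sp : measurable_smooth (fun v => (2 * chi v + (-1)) * cutoff n v).
  apply: measurable_smoothM; last exact: cutoff_smooth.
  apply: measurable_smoothD; last exact: measurable_smooth_cst.
  by apply: measurable_smoothM => //; exact: measurable_smooth_cst.
split => //.
- exact/bounded_supportM/bounded_support_cutoff.
- move=> v; rewrite normrM mulr_ile1//.
    by rewrite ler_norml; have := chi01 v; lra.
  by have /andP[? ?] := cutoff01 n v; rewrite ger0_norm.
have mc := measurable_smooth_fun schi.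
have mn := measurable_smooth_fun (@cutoff_smooth R N n).
have mi : measurable_fun setT (\1_A : V -> R) by exact: measurable_indic.
(* Pointwise, |h| - h psi is at most |h| (1 - cutoff) + 2 |h| |1_A - chi|, by cases on the sign of
   h. *)
apply: (@le_trans _ _ (\int[mu]_v ((`|cutoff n v - 1| * om v) + 2 * (`|\1_A v - chi v| * om v))%:E)%E).
  apply: le_integral_EFin.
  - apply: measurable_funM => //; apply: measurable_funB; first exact: measurableT_comp.
    by apply: measurable_funM => //; exact: measurable_smooth_fun sp.
  - apply: measurable_funD; [|apply: measurable_funM => //]; apply: measurable_funM => //;
      apply: measurableT_comp => //; exact: measurable_funB.
  - move=> v; rewrite mulr_ge0// subr_ge0 (le_trans (ler_norm _))// normrM ler_piMr//.
    rewrite normrM mulr_ile1//; first by rewrite ler_norml; have := chi01 v; lra.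
    by have /andP[? ?] := cutoff01 n v; rewrite ger0_norm.
  - move=> v; rewrite /om !mulrA -mulrDl ler_wpM2r//.
    have /andP[k0 k1] := cutoff01 n v; have /andP[c0 c1] := chi01 v.
    rewrite distrC (ger0_norm (_ : 0 <= 1 - cutoff n v)) ?subr_ge0//.
    rewrite indicE; have [hv|hv] := leP 0 (h v).
      rewrite mem_set// (ger0_norm hv) (ger0_norm (_ : 0 <= 1%:R - chi v)) ?subr_ge0//.
      have : 0 <= h v * (1 - chi v) * (1 - cutoff n v).
        by rewrite !mulr_ge0// subr_ge0.
      by rewrite /=; lra.
    rewrite memNset; last by rewrite /A/= leNgt hv.
    rewrite (ltr0_norm hv) /= sub0r normrN (ger0_norm c0).
    have : 0 <= - h v * chi v * (1 - cutoff n v).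
      by rewrite !mulr_ge0// ?subr_ge0// oppr_ge0 ltW.
    by lra.
under eq_integral do rewrite EFinD.
rewrite ge0_integralD//; last 4 first.
- by move=> v _; rewrite lee_fin mulr_ge0.
- apply/measurable_EFinP; apply: measurable_funM => //.
  by apply: measurableT_comp => //; exact: measurable_funB.
- by move=> v _; rewrite lee_fin !mulr_ge0.
- apply/measurable_EFinP; apply: measurable_funM => //; apply: measurable_funM => //.
  by apply: measurableT_comp => //; exact: measurable_funB.
under [X in (_ + X)%E]eq_integral do rewrite EFinM.
rewrite ge0_integralZl//; last 2 first.
- apply/measurable_EFinP; apply: measurable_funM => //.
  by apply: measurableT_comp => //; exact: measurable_funB.
- by move=> v _; rewrite lee_fin !mulr_ge0.
rewrite [eps](_ : _ = eps / 2 + 2 * (eps / 4)); last by field.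
have -> : (eps / 2 + 2 * (eps / 4))%:E = ((eps / 2)%:E + 2%:E * (eps / 4)%:E)%E by [].
by rewrite leeD// lee_pmul2l.
Qed.

(** Unlike in [approximable], the bound on [chi] is arbitrary, which makes the class linear and lets
    it reach simple functions. *)
Definition smooth_dense (w s : V -> R) :=
  measurable_fun setT s /\ forall eps, 0 < eps -> exists chi : V -> R,
  [/\ measurable_smooth chi, exists M : R, forall v, `|chi v| <= M &
    (\int[mu]_v (`|s v - chi v| * w v)%:E <= eps%:E)%E].

Lemma smooth_dense_indic (w : V -> R) A : measurable_fun setT w ->
  (forall v, 0 <= w v) -> mu.-integrable setT (EFin \o w) -> measurable A ->
  smooth_dense w \1_A.
Proof.
move=> mw w0 iw mA; have [mi H] := approximable_indic mw w0 iw mA.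
split => // eps /H[chi [schi c01] Hc]; exists chi; split => //.
by exists 1 => v; have /andP[? ?] := c01 v; rewrite ger0_norm.
Qed.

Lemma smooth_denseZ (w : V -> R) c s : measurable_fun setT w -> (forall v, 0 <= w v) ->
  smooth_dense w s -> smooth_dense w (fun v => c * s v).
Proof.
move=> mw w0 [ms H]; split; first exact: measurable_funM.
move=> eps e0; have e1 : 0 < eps / (`|c| + 1) by rewrite divr_gt0// ltr_wpDl.
have [chi [schi [M HM] Hc]] := H _ e1.
have mc := measurable_smooth_fun schi.
exists (fun v => c * chi v); split.
- by apply: measurable_smoothM => //; exact: measurable_smooth_cst.
- by exists (`|c| * M) => v; rewrite normrM ler_wpM2l.
under eq_integral do rewrite -mulrBr normrM -mulrA EFinM.
rewrite ge0_integralZl//; last 2 first.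
- apply/measurable_EFinP; apply: measurable_funM => //.
  by apply: measurableT_comp => //; exact: measurable_funB.
- by move=> v _; rewrite lee_fin !mulr_ge0.
apply: (@le_trans _ _ (`|c|%:E * (eps / (`|c| + 1))%:E)%E).
  by rewrite lee_wpmul2l// lee_fin.
rewrite -EFinM lee_fin mulrCA ler_piMr ?ltW//.
by rewrite ltr_pdivrMr ?ltr_wpDl// mul1r ltrDl.
Qed.

Lemma smooth_denseD (w : V -> R) s t : measurable_fun setT w -> (forall v, 0 <= w v) ->
  smooth_dense w s -> smooth_dense w t -> smooth_dense w (fun v => s v + t v).
Proof.
move=> mw w0 [ms Hs] [mt Ht]; split; first exact: measurable_funD.
move=> eps e0; have e2 : 0 < eps / 2 by rewrite divr_gt0.
have [c1 [sc1 [M1 HM1] Hc1]] := Hs _ e2.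
have [c2 [sc2 [M2 HM2] Hc2]] := Ht _ e2.
have mc1 := measurable_smooth_fun sc1.
have mc2 := measurable_smooth_fun sc2.
exists (fun v => c1 v + c2 v); split.
- exact: measurable_smoothD.
- by exists (M1 + M2) => v; rewrite (le_trans (ler_normD _ _))// lerD.
have mB (f1 f2 : V -> R) : measurable_fun setT f1 -> measurable_fun setT f2 ->
    measurable_fun setT (fun v => (`|f1 v - f2 v| * w v)).
  move=> m1 m2; apply: measurable_funM => //.
  by apply: measurableT_comp => //; exact: measurable_funB.
apply: (@le_trans _ _ (\int[mu]_v ((`|s v - c1 v| * w v) + (`|t v - c2 v| * w v))%:E)%E).
  apply: le_integral_EFin.
  - by apply: mB; exact: measurable_funD.
  - by apply: measurable_funD; exact: mB.
  - by move=> v; rewrite mulr_ge0.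
  - move=> v; rewrite -mulrDl ler_wpM2r// (le_trans _ (ler_normD _ _))//.
    by rewrite opprD addrACA.
under eq_integral do rewrite EFinD.
rewrite ge0_integralD//; try by [move=> v _; rewrite lee_fin mulr_ge0|apply/measurable_EFinP; exact: mB].
by rewrite [eps]splitr EFinD leeD.
Qed.

(** Indicators need not be integrable against [w], so a cutoff comes first: simple functions are
    then approximated with the finite weight cutoff * w. *)
Lemma L1_density (g w : V -> R) (eps : R) :
  measurable_fun setT g -> (forall v, 0 <= g v) ->
  measurable_fun setT w -> (forall v, 0 <= w v) ->
  mu.-integrable setT (fun v => (g v * w v)%:E) ->
  (forall k, mu.-integrable setT (fun v => (cutoff k v * w v)%:E)) -> 0 < eps ->
  exists phi : V -> R, [/\ measurable_smooth phi, bounded_support phi &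
    (\int[mu]_v (`|g v - phi v| * w v)%:E <= eps%:E)%E].
Proof.
move=> mg g0 mw w0 ig ik e0.
have e2 : 0 < eps / 2 by rewrite divr_gt0.
have e4 : 0 < eps / 2 / 2 by rewrite divr_gt0.
have [||||||||n Hn] := @weighted_limit _ _ mu (fun v => g v * w v) _ _ cutoff (fun=> 1) (fun=> 1) (eps / 2).
- exact: measurable_funM.
- by move=> v; rewrite mulr_ge0.
- by move=> n; apply: measurable_smooth_fun; exact: cutoff_smooth.
- exact: measurable_cst.
- by move=> n v; have /andP[? ?] := cutoff01 n v; rewrite ger0_norm.
- by under eq_fun do rewrite mul1r.
- by move=> v; exact: cutoff_cvg.
- exact: e2.
have mk := measurable_smooth_fun (@cutoff_smooth R N n).
pose om v := cutoff n v * w v.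
have mom : measurable_fun setT om by exact: measurable_funM.
have om0 v : 0 <= om v by rewrite mulr_ge0//; have /andP[] := cutoff01 n v.
have mgE : measurable_fun setT (EFin \o g) by exact/measurable_EFinP.
pose h := nnsfun_approx measurableT mgE.
have mh i : measurable_fun setT (h i) by exact: measurable_funP.
have cvgh v : EFin \o h ^~ v @ \oo --> (g v)%:E.
  by apply: cvg_nnsfun_approx => // x _; rewrite lee_fin.
have hg i v : 0 <= h i v <= g v.
  rewrite -!lee_fin; apply/andP; split; first by rewrite lee_fin.
  rewrite /h nnsfun_approxE; apply: (@le_approx _ _ _ setT (EFin \o g)) => //.
  by move=> y _; rewrite lee_fin.
(* A simple function is a finite combination of indicators, and [om] is integrable by the hypothesis
   on the cutoffs. *)
have hs i : smooth_dense om (h i).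
  rewrite (funext (fimfunEord (h i))).
  elim: (index_enum _) => [|j s IH].
    under eq_fun do rewrite big_nil.
    split; first exact: measurable_cst.
    move=> e e0'; exists (fun=> 0); split; first exact: measurable_smooth_cst.
      by exists 0 => v; rewrite normr0.
    under eq_integral do rewrite subrr normr0 mul0r.
    by rewrite integral0 lee_fin ltW.
  under eq_fun do rewrite big_cons.
  apply: smooth_denseD => //; apply: smooth_denseZ => //.
  by apply: smooth_dense_indic => //; exact: ik.
have [||||i Hi] := @weighted_limit _ _ mu om mom om0 h g g (eps / 2 / 2) mh mg.
- by move=> i v; have /andP[? ?] := hg i v; rewrite ger0_norm.
- apply: (le_integrable _ _ _ ig) => //.
    by apply/measurable_EFinP; exact: measurable_funM.
  move=> v _; have /andP[k0 k1] := cutoff01 n v.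
  rewrite lee_fin !ger0_norm ?mulr_ge0//.
  by rewrite /om ler_wpM2l// ler_piMl.
- by move=> v; apply: (fine_cvg (cvgh v)).
- exact: e4.
have [_ /(_ _ e4)[chi [schi [M HM] Hchi]]] := hs i.
exists (fun v => chi v * cutoff n v); split.
- by apply: measurable_smoothM => //; exact: cutoff_smooth.
- exact/bounded_supportM/bounded_support_cutoff.
have mc := measurable_smooth_fun schi.
have mB (f1 f2 : V -> R) : measurable_fun setT f1 -> measurable_fun setT f2 ->
    measurable_fun setT (fun v => `|f1 v - f2 v|).
  by move=> m1 m2; apply: measurableT_comp => //; exact: measurable_funB.
have mB' (f1 f2 w' : V -> R) : measurable_fun setT f1 -> measurable_fun setT f2 ->
   measurable_fun setT w' -> measurable_fun setT (fun v => (`|f1 v - f2 v| * w' v)).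
  by move=> m1 m2 m3; apply: measurable_funM => //; exact: mB.
apply: (@le_trans _ _ (\int[mu]_v ((`|cutoff n v - 1| * (g v * w v)) +
   ((`|h i v - g v| * om v) + (`|h i v - chi v| * om v)))%:E)%E).
  apply: le_integral_EFin.
  - by apply: mB' => //; exact: measurable_funM.
  - apply: measurable_funD; last by apply: measurable_funD; exact: mB'.
    by apply: mB' => //; exact: measurable_funM.
  - by move=> v; rewrite mulr_ge0.
  - move=> v; rewrite -mulrDl /om !mulrA -mulrDl ler_wpM2r//.
    have /andP[k0 k1] := cutoff01 n v.
    (* Three errors: the truncation of g, the simple function against g, and [chi] against the
       simple function. *)
    rewrite (_ : g v - _ = (1 - cutoff n v) * g v + cutoff n v * ((h i v - chi v) - (h i v - g v))); last by ring.
    rewrite (le_trans (ler_normD _ _))// !normrM (ger0_norm (g0 v)) distrC (ger0_norm k0).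
    by rewrite lerD// mulrC ler_wpM2r// (le_trans (ler_normB _ _))// addrC.
under eq_integral do rewrite EFinD.
rewrite ge0_integralD//; last 4 first.
- by move=> v _; rewrite lee_fin !mulr_ge0.
- by apply/measurable_EFinP; apply: mB' => //; exact: measurable_funM.
- by move=> v _; rewrite lee_fin; apply: addr_ge0; apply: mulr_ge0.
- by apply/measurable_EFinP; apply: measurable_funD; exact: mB'.
under [X in (_ + X)%E]eq_integral do rewrite EFinD.
rewrite ge0_integralD//; last 4 first.
- by move=> v _; rewrite lee_fin mulr_ge0.
- by apply/measurable_EFinP; exact: mB'.
- by move=> v _; rewrite lee_fin mulr_ge0.
- by apply/measurable_EFinP; exact: mB'.
rewrite [eps]splitr EFinD leeD//.
by rewrite [eps / 2]splitr EFinD leeD.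
Qed.

End density.

(** * The collision operator *)

Section euclidean_geometry.
Context {R : realType} {N : nat}.
Notation V := 'rV[R]_N.
Implicit Types u v w : V.

Lemma dotpC u v : dotp u v = dotp v u.
Proof. by apply: eq_bigr => i _; rewrite mulrC. Qed.

Lemma dotpDl u v w : dotp (u + v) w = dotp u w + dotp v w.
Proof. by rewrite -big_split; apply: eq_bigr => i _; rewrite mxE mulrDl. Qed.

Lemma dotpZl a u w : dotp (a *: u) w = a * dotp u w.
Proof. by rewrite mulr_sumr; apply: eq_bigr => i _; rewrite mxE mulrA. Qed.

Lemma dotpDr u v w : dotp w (u + v) = dotp w u + dotp w v.
Proof. by rewrite dotpC dotpDl !(dotpC w). Qed.

Lemma dotpZr a u w : dotp w (a *: u) = a * dotp w u.
Proof. by rewrite dotpC dotpZl dotpC. Qed.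

Lemma dotpNl u w : dotp (- u) w = - dotp u w.
Proof. by rewrite -scaleN1r dotpZl mulN1r. Qed.

Lemma dotpNr u w : dotp w (- u) = - dotp w u.
Proof. by rewrite dotpC dotpNl dotpC. Qed.

Lemma dotp_ge0 v : 0 <= dotp v v.
Proof. by apply: sumr_ge0 => i _; rewrite -expr2 sqr_ge0. Qed.

Lemma enorm_sqr v : enorm v ^+ 2 = dotp v v.
Proof. by rewrite sqr_sqrtr// dotp_ge0. Qed.

Lemma enorm_eq0 v : (enorm v == 0) = (v == 0).
Proof.
apply/idP/eqP => [|->]; last first.
  rewrite /enorm /dotp big1 ?sqrtr0// => i _; by rewrite mxE mul0r.
rewrite -sqrf_eq0 enorm_sqr psumr_eq0; last by move=> i _; rewrite -expr2 sqr_ge0.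
move=> /allP H; apply/rowP => i; rewrite mxE.
have /implyP/(_ isT) := H i (mem_index_enum i).
by rewrite -expr2 sqrf_eq0 => /eqP.
Qed.

Lemma enorm0 : enorm (0 : V) = 0.
Proof. by apply/eqP; rewrite enorm_eq0. Qed.

Lemma enormZ a v : enorm (a *: v) = `|a| * enorm v.
Proof.
rewrite /enorm dotpZl dotpZr mulrA -expr2 sqrtrM ?sqr_ge0//.
by rewrite sqrtr_sqr.
Qed.

Lemma enormN v : enorm (- v) = enorm v.
Proof. by rewrite -scaleN1r enormZ normrN normr1 mul1r. Qed.

Lemma enormC u v : enorm (u - v) = enorm (v - u).
Proof. by rewrite -enormN opprB. Qed.

Lemma ler_dotp u v : dotp u v <= enorm u * enorm v.
Proof.
have [->|u0] := eqVneq u 0.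
  by rewrite enorm0 mul0r -(scale0r 0) dotpZl mul0r.
have [->|v0] := eqVneq v 0.
  by rewrite enorm0 mulr0 -(scale0r 0) dotpZr mul0r.
have pu : 0 < enorm u by rewrite lt_def enorm_eq0 u0 enorm_ge0.
have pv : 0 < enorm v by rewrite lt_def enorm_eq0 v0 enorm_ge0.
have := dotp_ge0 (enorm v *: u - enorm u *: v).
rewrite dotpDl !dotpDr !dotpNl !dotpNr !dotpZl !dotpZr -!enorm_sqr (dotpC v u).
move=> H.
rewrite -(ler_pM2l (_ : 0 < 2 * (enorm u * enorm v))) ?mulr_gt0//.
by lra.
Qed.

Lemma normr_dotp u v : `|dotp u v| <= enorm u * enorm v.
Proof.
rewrite ler_norml ler_dotp andbT lerNl -dotpNl -(enormN u).
exact: ler_dotp.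
Qed.

Lemma ler_enormD u v : enorm (u + v) <= enorm u + enorm v.
Proof.
rewrite -(@ler_pXn2r _ 2%N)// ?nnegrE ?addr_ge0 ?enorm_ge0//.
rewrite enorm_sqr dotpDl !dotpDr sqrrD !enorm_sqr (dotpC v u).
have := ler_dotp u v; lra.
Qed.

Lemma ler_enormB u v : enorm (u - v) <= enorm u + enorm v.
Proof. by rewrite -(enormN v); exact: ler_enormD. Qed.

Lemma normr_coord_le v i : `|v ord0 i| <= enorm v.
Proof.
rewrite -(@ler_pXn2r _ 2%N)// ?nnegrE ?enorm_ge0// enorm_sqr real_normK ?num_real//.
rewrite /dotp (bigD1 i)//= -expr2 lerDl.
by apply: sumr_ge0 => j _; rewrite -expr2 sqr_ge0.
Qed.

Lemma enorm_le_sum v : enorm v <= \sum_i `|v ord0 i|.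
Proof.
rewrite {1}[v]row_sum_delta.
apply: (big_ind2 (fun (x : V) y => enorm x <= y)) => [|x1 x2 y1 y2 H1 H2|i _].
- by rewrite enorm0.
- by rewrite (le_trans (ler_enormD _ _))// lerD.
- rewrite enormZ ler_piMr//.
  rewrite -(@ler_pXn2r _ 2%N)// ?nnegrE ?enorm_ge0// enorm_sqr expr1n.
  rewrite /dotp (bigD1 i)//= !mxE !eqxx mulr1 big1 ?addr0// => j /negbTE ji.
  by rewrite mxE ji andbF mul0r.
Qed.

Lemma enorm_hat u : u != 0 -> enorm (hat u) = 1.
Proof.
move=> u0; have pu : 0 < enorm u by rewrite lt_def enorm_eq0 u0 enorm_ge0.
by rewrite /hat enormZ ger0_norm ?invr_ge0 ?enorm_ge0// mulVf// gt_eqF.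
Qed.

Lemma enorm_hat_le1 u : enorm (hat u) <= 1.
Proof.
have [->|/enorm_hat->//] := eqVneq u 0.
by rewrite /hat scaler0 enorm0.
Qed.

Lemma enorm_inelastic_direction r u s : 0 <= r <= 1 -> enorm s = 1 ->
  enorm (inelastic_direction r u s) <= 1.
Proof.
move=> /andP[r0 r1] s1; apply: (le_trans (ler_enormD _ _)).
have r2 : 0 <= (1 - r) / 2 by lra.
have r3 : 0 <= (1 + r) / 2 by lra.
rewrite (enormZ _ (hat u)) (enormZ _ s) s1 mulr1 !ger0_norm//.
have : (1 - r) / 2 * enorm (hat u) <= (1 - r) / 2.
  by rewrite ler_piMr ?enorm_hat_le1.
lra.
Qed.

(** By the parallelogram law the left side is |v + vs|^2 / 2 + |z|^2 |v - vs|^2 / 2, which equals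
    the right side when |z| = 1. *)
Lemma enorm_post_post_star v vs z : enorm z <= 1 ->
  enorm (post v vs z) ^+ 2 + enorm (post_star v vs z) ^+ 2 <=
  enorm v ^+ 2 + enorm vs ^+ 2.
Proof.
move=> z1.
rewrite /post /post_star; set r := enorm (vs - v) / 2.
have rE : r ^+ 2 = 4^-1 * (dotp vs vs - 2 * dotp v vs + dotp v v).
  rewrite exprMn enorm_sqr dotpDl !dotpDr !dotpNl !dotpNr (dotpC vs v) exprVn.
  by field.
have zz : r ^+ 2 * dotp z z <= r ^+ 2.
  by rewrite ler_piMr ?sqr_ge0// -enorm_sqr expr_le1 ?enorm_ge0.
rewrite !enorm_sqr !(dotpDl, dotpDr, dotpNl, dotpNr, dotpZl, dotpZr).
rewrite (dotpC vs v) (dotpC z v) (dotpC z vs).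
move: zz; rewrite {2}rE; lra.
Qed.

Definition energy_weight v : R := 1 + enorm v ^+ 2.

Lemma energy_weight_ge1 v : 1 <= energy_weight v.
Proof. by rewrite lerDl exprn_ge0// enorm_ge0. Qed.

Lemma energy_weight_ge0 v : 0 <= energy_weight v.
Proof. exact: le_trans (energy_weight_ge1 v). Qed.

Lemma energy_weight_post v vs z : enorm z <= 1 ->
  energy_weight (post_star v vs z) + energy_weight (post v vs z) <=
  energy_weight v + energy_weight vs.
Proof.
move=> /(enorm_post_post_star v vs) H; rewrite /energy_weight; lra.
Qed.

Lemma measurable_smooth_energy_weight : measurable_smooth energy_weight.
Proof.
rewrite (_ : energy_weight = fun v => 1 + \sum_i v ord0 i * v ord0 i); last first.
  by apply/funext => v; rewrite /energy_weight enorm_sqr.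
apply: measurable_smoothD; first exact: measurable_smooth_cst.
apply: measurable_smooth_sum => i.
by apply: measurable_smoothM; exact: measurable_smooth_coord.
Qed.

Lemma measurable_dotp d (X : measurableType d) (f g : X -> V) :
  measurable_fun setT f -> measurable_fun setT g ->
  measurable_fun setT (fun x => dotp (f x) (g x)).
Proof.
move=> mf mg; apply: measurable_sum => i.
apply: measurable_funM; exact: measurableT_comp (measurable_coord i) _.
Qed.

Lemma measurable_rowZ d (X : measurableType d) (f : X -> R) (g : X -> V) :
  measurable_fun setT f -> measurable_fun setT g ->
  measurable_fun setT (fun x => f x *: g x).
Proof.
move=> mf mg; apply: measurable_fun_row => i; under eq_fun do rewrite mxE.
by apply: measurable_funM => //; exact: measurableT_comp (measurable_coord i) _.
Qed.

Lemma measurable_rowN d (X : measurableType d) (g : X -> V) :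
  measurable_fun setT g -> measurable_fun setT (fun x => - g x).
Proof.
move=> mg; under eq_fun do rewrite -scaleN1r.
by apply: measurable_rowZ.
Qed.

Lemma measurable_rowB d (X : measurableType d) (f g : X -> V) :
  measurable_fun setT f -> measurable_fun setT g ->
  measurable_fun setT (fun x => f x - g x).
Proof.
by move=> mf mg; apply: measurable_row_addf => //; exact: measurable_rowN.
Qed.

Lemma measurable_post d (X : measurableType d) (f g h : X -> V) :
  measurable_fun setT f -> measurable_fun setT g -> measurable_fun setT h ->
  measurable_fun setT (fun x => post (f x) (g x) (h x)).
Proof.
move=> mf mg mh; apply: measurable_row_addf.
  by apply: measurable_rowZ => //; exact: measurable_row_addf.
apply: measurable_rowZ => //; apply: measurable_funM => //.
by apply: measurableT_comp (@measurable_enorm _ _) _; exact: measurable_rowB.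
Qed.

Lemma measurable_post_star d (X : measurableType d) (f g h : X -> V) :
  measurable_fun setT f -> measurable_fun setT g -> measurable_fun setT h ->
  measurable_fun setT (fun x => post_star (f x) (g x) (h x)).
Proof.
move=> mf mg mh; apply: measurable_rowB.
  by apply: measurable_rowZ => //; exact: measurable_row_addf.
apply: measurable_rowZ => //; apply: measurable_funM => //.
by apply: measurableT_comp (@measurable_enorm _ _) _; exact: measurable_rowB.
Qed.

Lemma measurable_inelastic_direction d (X : measurableType d) r (f g : X -> V) :
  measurable_fun setT f -> measurable_fun setT g ->
  measurable_fun setT (fun x => inelastic_direction r (f x) (g x)).
Proof.
move=> mf mg; apply: measurable_row_addf; apply: measurable_rowZ => //.
exact: measurableT_comp (@measurable_hat _ _) _.
Qed.

Lemma measurable_unit_sphere : measurable (@unit_sphere R N).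
Proof.
rewrite (_ : unit_sphere = setT `&` enorm @^-1` [set 1]).
  exact: measurable_enorm.
by rewrite setTI; apply/seteqP; split.
Qed.

Lemma lebesgue_row_cube_fin (r : R) :
  (lebesgue_row R N [set v : V | forall i, `[(- r)%R, r]%classic (v ord0 i)] < +oo)%E.
Proof.
rewrite [X in (X < _)%E](@lebesgue_row_box R N (fun=> `[(- r)%R, r]%classic)); last first.
  by move=> i; exact: measurable_itv.
rewrite (eq_bigr (fun=> (Num.max (r - - r) 0)%:E)).
  by rewrite prodEFin ltry.
move=> i _; rewrite lebesgue_measure_itv/= lte_fin.
case: ifPn => [h|]; first by rewrite -EFinB; congr (_%:E); rewrite max_l// subr_ge0 ltW.
by rewrite -leNgt => h; rewrite max_r// subr_le0.
Qed.

(** The cone over any set stays in the unit ball, hence in the cube [-1, 1]^N, which has finite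
    volume. *)
Lemma sphere_measure_fin : fin_num_fun (@sphere_measure R N).
Proof.
move=> A mA; rewrite ge0_fin_numE//.
apply: (@le_lt_trans _ _ ((N%:R)%:E * lebesgue_row R N
   [set v : V | forall i, `[(- 1)%R, 1%R]%classic (v ord0 i)])%E).
  rewrite /sphere_measure lee_pmul//; apply: le_measure; rewrite ?inE.
  - apply: measurableI; first exact: measurable_unit_ball.
    by rewrite -[X in measurable X]setTI; exact: measurable_hat.
  - rewrite (_ : [set _ | _] = \bigcap_(i in [set` index_enum 'I_N])
        (setT `&` (fun v : V => v ord0 i) @^-1` `[(- 1)%R, 1%R]%classic)).
      rewrite bigcap_seq; apply: bigsetI_measurable => i _.
      by apply: measurable_coord => //; exact: measurable_itv.
    apply/seteqP; split => v /= H i; first by move=> _; split => //; exact: H.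
    by have [] := H i (mem_index_enum i).
  - move=> v [/= v1 _] i; rewrite in_itv/= -ler_norml.
    exact: le_trans (normr_coord_le _ _) v1.
rewrite lte_mul_pinfty//; exact: lebesgue_row_cube_fin.
Qed.

HB.instance Definition _ := Measure_isFinite.Build _ _ _ (@sphere_measure R N)
  sphere_measure_fin.

End euclidean_geometry.

(** * The collision rate as a kernel on the sphere *)

Section collision_kernel.
Context {R : realType} {N : nat}.
Notation V := 'rV[R]_N.
Notation S := (@sphere_measure R N).
Variables (alpha : R -> {nonneg R}) (beta : R -> V -> probability V R).
Variables (bt : R -> R -> R -> R) (e : R -> R).

(** The factor |u| of the collision rate and the restriction to the sphere are absorbed here, so
    that angular integrals run over the whole space and the arguments of [bt] count only inside
    [density_domain]. *)
Definition kernel (E : R) (u s : V) : R :=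
  \1_unit_sphere s * (enorm u * bt E (enorm u) (dotp (hat u) s)).

Hypothesis Hbt : bounded_density bt.
Hypothesis He : restitution e.
Hypothesis Hform : inelastic_form alpha beta bt e.

Lemma density_domain_sphere E (u s : V) : 0 < E -> enorm s = 1 ->
  density_domain (E, enorm u, dotp (hat u) s).
Proof.
move=> E0 s1; split => //=; first exact: enorm_ge0.
rewrite -ler_norml (le_trans (normr_dotp _ _))// s1 mulr1.
exact: enorm_hat_le1.
Qed.

Lemma kernel_ge0 E u s : 0 < E -> 0 <= kernel E u s.
Proof.
move=> E0; rewrite /kernel indicE; case: (boolP (s \in _)) => /=; last by rewrite mul0r.
rewrite inE => s1; rewrite mul1r mulr_ge0 ?enorm_ge0//.
have [_ H _] := Hbt; exact: (H _ (density_domain_sphere u E0 s1)).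
Qed.

Lemma kernel_bound : exists2 M : R, 0 <= M &
  forall (E : R) u s, 0 < E -> kernel E u s <= M * enorm u.
Proof.
have [_ _ [M HM]] := Hbt; exists `|M| => // E u s E0.
rewrite /kernel indicE; case: (boolP (s \in _)) => /=; last by rewrite mul0r mulr_ge0 ?enorm_ge0.
rewrite inE => s1; rewrite mul1r mulrC ler_wpM2r ?enorm_ge0//.
exact: le_trans (HM _ (density_domain_sphere u E0 s1)) (ler_norm _).
Qed.

Lemma measurable_density_domain : measurable (@density_domain R).
Proof.
rewrite (_ : density_domain = (fun p : R * R * R => p.1.1) @^-1` `]0, +oo[%classic `&`
  ((fun p : R * R * R => p.1.2) @^-1` `[0, +oo[%classic `&`
   (fun p : R * R * R => p.2) @^-1` `[(-1), 1]%classic)); last first.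
  apply/seteqP; split => -[[x y] z]; rewrite /density_domain /= !in_itv/= !andbT.
    by move=> [].
  by move=> [? []].
apply: measurableI; last apply: measurableI.
- rewrite -[X in measurable X]setTI.
  by apply: (measurableT_comp measurable_fst measurable_fst) => //.
- rewrite -[X in measurable X]setTI.
  by apply: (measurableT_comp measurable_snd measurable_fst) => //.
- by rewrite -[X in measurable X]setTI; apply: measurable_snd.
Qed.

Lemma measurable_kernel E : 0 < E ->
  measurable_fun setT (fun p : V * V => kernel E p.1 p.2).
Proof.
move=> E0; have [mb _ _] := Hbt.
(* [bt] is measurable only on [density_domain]; extending it by 0 changes nothing under the
   indicator of the sphere. *)
pose g := (fun q : R * R * R => bt q.1.1 q.1.2 q.2) \_ density_domain.
have mg : measurable_fun setT g.
  exact: (measurable_restrictT _ measurable_density_domain).1.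
rewrite (_ : (fun p => _) = fun p : V * V => \1_unit_sphere p.2 *
   (enorm p.1 * g (E, enorm p.1, dotp (hat p.1) p.2))); last first.
  apply/funext => -[u s] /=; rewrite /kernel indicE; case: (boolP (s \in _)); rewrite ?mul0r//.
  rewrite inE => s1; rewrite /g /patch mem_set//.
  exact: density_domain_sphere.
have me : measurable_fun setT (fun p : V * V => enorm p.1).
  exact: measurableT_comp (@measurable_enorm _ _) measurable_fst.
apply: measurable_funM.
  apply: (measurableT_comp (f := \1_unit_sphere : V -> R)) => //.
  exact: measurable_indic measurable_unit_sphere.
apply: measurable_funM => //.
apply: (measurableT_comp mg).
apply/measurable_fun_pairP; split; last first.
  apply: measurable_dotp; last exact: measurable_snd.
  exact: measurableT_comp (@measurable_hat _ _) measurable_fst.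
apply/measurable_fun_pairP; split; first exact: measurable_cst.
exact: me.
Qed.

Lemma measurable_kernel2 d (X : measurableType d) E (f g : X -> V) : 0 < E ->
  measurable_fun setT f -> measurable_fun setT g ->
  measurable_fun setT (fun x => kernel E (f x) (g x)).
Proof.
move=> E0 mf mg.
apply: (measurableT_comp (measurable_kernel E0) (g := fun x => (f x, g x))).
exact/measurable_fun_pairP.
Qed.

Lemma ge0_integral_collision_rate E (u : V) (Phi : V -> \bar R) : 0 < E ->
  measurable_fun setT Phi -> (forall z, 0 <= Phi z)%E ->
  (\int[collision_rate alpha beta E u]_(z in unit_ball) Phi z =
   \int[S]_s (Phi (inelastic_direction (e E) u s) * (kernel E u s)%:E))%E.
Proof.
move=> E0 mPhi Phi0.
have mB := @measurable_unit_ball R N.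
have mS := @measurable_unit_sphere R N.
have mPhiB : measurable_fun unit_ball Phi by exact: measurable_funS mPhi.
rewrite /collision_rate ge0_integral_mscale//=.
(* [Hform] excludes u = 0, where the factor |u| makes both sides vanish. *)
have [->|u0] := eqVneq u 0.
  rewrite enorm0 mul0e; apply/esym/integral0_eq => s _.
  by rewrite /kernel enorm0 mul0r mulr0 mule0.
rewrite (Hform E0 u0 mPhi Phi0).
have md : measurable_fun setT (fun s : V => Phi (inelastic_direction (e E) u s)).
  by apply: (measurableT_comp mPhi); exact: measurable_inelastic_direction.
have mk : measurable_fun setT (fun s : V => kernel E u s) by exact: measurable_kernel2.
have pu : 0 < enorm u by rewrite lt_def enorm_eq0 u0 enorm_ge0.
transitivity ((enorm u)%:E * \int[S]_s (Phi (inelastic_direction (e E) u s) * ((enorm u)^-1 * kernel E u s)%:E))%E.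
  congr (_ * _)%E; rewrite integral_mkcond; apply: eq_integral => s _.
  rewrite /patch /kernel indicE; case: (boolP (s \in _)) => _; last by rewrite mul0r mulr0 mule0.
  by rewrite mul1r mulKf// gt_eqF.
rewrite -ge0_integralZl//; last 3 first.
- apply: emeasurable_funM => //; apply/measurable_EFinP.
  by apply: measurable_funM.
- move=> s _; rewrite mule_ge0// lee_fin mulr_ge0 ?invr_ge0 ?enorm_ge0//.
  exact: kernel_ge0.
- by rewrite lee_fin enorm_ge0.
apply: eq_integral => s _; rewrite muleCA -EFinM mulVKf//.
by rewrite gt_eqF.
Qed.

(** No integrability is asked for: positive and negative parts are transported separately, and
    multiplication by the nonnegative kernel commutes with taking them. *)
Lemma Rintegral_collision_rate E (u : V) (F : V -> R) : 0 < E ->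
  measurable_fun setT F ->
  \int[collision_rate alpha beta E u]_(z in unit_ball) F z =
  \int[S]_s (F (inelastic_direction (e E) u s) * kernel E u s).
Proof.
move=> E0 mF; rewrite /Rintegral; congr fine.
rewrite integralE [RHS]integralE.
have mFE : measurable_fun setT (EFin \o F) by exact/measurable_EFinP.
have H s : (0 <= (kernel E u s)%:E)%E by rewrite lee_fin kernel_ge0.
congr (_ - _)%E.
- rewrite (ge0_integral_collision_rate u E0 (measurable_funepos mFE))//.
  by apply: eq_integral => s _; rewrite !unlock /= -!EFin_max -EFinM maxr_pMl ?kernel_ge0// mul0r.
- rewrite (ge0_integral_collision_rate u E0 (measurable_funeneg mFE))//.
  by apply: eq_integral => s _; rewrite !unlock /= -!EFin_max -EFinM maxr_pMl ?kernel_ge0// mulNr mul0r.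
Qed.

Definition gain (E : R) (phi : V -> R) (p : V * V) (s : V) : R :=
  phi (post_star p.1 p.2 (inelastic_direction (e E) (p.1 - p.2) s)) +
  phi (post p.1 p.2 (inelastic_direction (e E) (p.1 - p.2) s)).

Definition collision_average (E : R) (phi : V -> R) (p : V * V) : R :=
  \int[S]_s ((gain E phi p s - phi p.1 - phi p.2) * kernel E (p.1 - p.2) s).

Lemma Qweak_collision_average (f phi : V -> R) : 0 < energy f ->
  measurable_fun setT phi ->
  Qweak (collision_rate alpha beta) f phi =
  2^-1 * \int[(lebesgue_row R N \x lebesgue_row R N)%E]_p
    (f p.2 * f p.1 * collision_average (energy f) phi p).
Proof.
move=> E0 mphi; rewrite /Qweak; congr (_ * _).
apply: eq_Rintegral => p _; congr (_ * _).
rewrite Rintegral_collision_rate//.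
apply: measurable_funB => //; apply: measurable_funB => //.
by apply: measurable_funD; apply: (measurableT_comp mphi);
  [exact: measurable_post_star|exact: measurable_post].
Qed.

End collision_kernel.

Section integrability.
Context d (T : measurableType d) (R : realType) (mu : {measure set T -> \bar R}).

Lemma le_integrable_EFin (f g : T -> R) : measurable_fun setT f ->
  (forall x, `|f x| <= g x) -> mu.-integrable setT (EFin \o g) ->
  mu.-integrable setT (EFin \o f).
Proof.
move=> mf fg ig; apply: (le_integrable _ _ _ ig) => //; first exact/measurable_EFinP.
move=> x _; rewrite lee_fin (le_trans (fg x))//; exact: ler_norm.
Qed.

Lemma integrableEFin_fun (f : T -> R) : mu.-integrable setT (EFin \o f) ->
  measurable_fun setT f.
Proof. by move=> /measurable_int/measurable_EFinP. Qed.

Lemma integrable_EFinD (f g : T -> R) : mu.-integrable setT (EFin \o f) ->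
  mu.-integrable setT (EFin \o g) -> mu.-integrable setT (EFin \o (fun x => f x + g x)).
Proof. exact: integrableD. Qed.

Lemma integrable_EFinB (f g : T -> R) : mu.-integrable setT (EFin \o f) ->
  mu.-integrable setT (EFin \o g) -> mu.-integrable setT (EFin \o (fun x => f x - g x)).
Proof. exact: integrableB. Qed.

Lemma integrable_EFinZ c (f : T -> R) : mu.-integrable setT (EFin \o f) ->
  mu.-integrable setT (EFin \o (fun x => c * f x)).
Proof. exact: integrableZl. Qed.

Lemma integrable_EFin_norm (f : T -> R) : mu.-integrable setT (EFin \o f) ->
  mu.-integrable setT (EFin \o (fun x => `|f x|)).
Proof. by move=> fi; apply: (integrable_abse fi). Qed.

Lemma integrable_EFin_sum (I : Type) (s : seq I) (f : I -> T -> R) :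
  (forall i, mu.-integrable setT (EFin \o f i)) ->
  mu.-integrable setT (EFin \o (fun x => \sum_(i <- s) f i x)).
Proof.
move=> fi; elim: s => [|i s IH].
  by under eq_fun do rewrite big_nil; exact: integrable0.
by under eq_fun do rewrite big_cons; exact: integrable_EFinD.
Qed.

Lemma Rintegral_EFin (f : T -> R) : mu.-integrable setT (EFin \o f) ->
  (\int[mu]_x (f x)%:E = (\int[mu]_x f x)%:E)%E.
Proof. by move=> fi; rewrite /Rintegral fineK// integrable_fin_num. Qed.

Lemma integrable_EFin_fin (f : T -> R) (c : R) : measurable_fun setT f ->
  (forall x, 0 <= f x) -> (\int[mu]_x (f x)%:E <= c%:E)%E ->
  mu.-integrable setT (EFin \o f) /\ \int[mu]_x f x <= c.
Proof.
move=> mf f0 fc.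
have fi : mu.-integrable setT (EFin \o f).
  apply/integrableP; split; first exact/measurable_EFinP.
  apply: le_lt_trans (ltry c); apply: le_trans fc.
  by under eq_integral => x _ do rewrite /= ger0_norm//.
by split=> //; rewrite -lee_fin -Rintegral_EFin.
Qed.

Lemma normr_Rintegral_le (f g : T -> R) : measurable_fun setT f ->
  (forall x, `|f x| <= g x) -> mu.-integrable setT (EFin \o g) ->
  `|\int[mu]_x f x| <= \int[mu]_x g x.
Proof.
move=> mf fg ig.
have fi := le_integrable_EFin mf fg ig.
rewrite (le_trans (le_normr_Rintegral _ fi))//.
by apply: le_Rintegral => //; exact: integrable_EFin_norm.
Qed.

End integrability.

Lemma measurable_Rintegral_param d1 d2 (X : measurableType d1)
    (Y : measurableType d2) (R : realType)
    (m : {sigma_finite_measure set Y -> \bar R}) (G : X * Y -> R) :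
  measurable_fun setT G -> measurable_fun setT (fun x => \int[m]_y G (x, y)).
Proof.
move=> mG; have mGE : measurable_fun setT (EFin \o G) by exact/measurable_EFinP.
apply: (measurableT_comp (fine_measurable measurableT)).
rewrite (_ : (fun x => _) = fun x => ((\int[m]_y (EFin \o G)^\+ (x, y)) -
    (\int[m]_y (EFin \o G)^\- (x, y)))%E); last first.
  apply/funext => x; rewrite integralE.
  by congr (_ - _)%E; apply: eq_integral => y _; rewrite !unlock.
apply: emeasurable_funB.
- apply: (@measurable_fun_fubini_tonelli_F _ _ _ _ _ m ((EFin \o G)^\+)%E).
    exact: measurable_funepos.
  by [].
- apply: (@measurable_fun_fubini_tonelli_F _ _ _ _ _ m ((EFin \o G)^\-)%E).
    exact: measurable_funeneg.
  by [].
Qed.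

Section product.
Context d1 d2 (X : measurableType d1) (Y : measurableType d2) (R : realType).
Variables (m1 : {sigma_finite_measure set X -> \bar R})
  (m2 : {sigma_finite_measure set Y -> \bar R}).

Lemma ge0_integral_prod (a : X -> R) (b : Y -> R) :
  measurable_fun setT a -> measurable_fun setT b ->
  (forall x, 0 <= a x) -> (forall y, 0 <= b y) ->
  (\int[(m1 \x m2)%E]_p (a p.1 * b p.2)%:E =
   (\int[m1]_x (a x)%:E) * (\int[m2]_y (b y)%:E))%E.
Proof.
move=> ma mb a0 b0.
have mab : measurable_fun setT (fun p : X * Y => (a p.1 * b p.2)%:E).
  apply/measurable_EFinP; apply: measurable_funM.
    exact: measurableT_comp ma measurable_fst.
  exact: measurableT_comp mb measurable_snd.
rewrite (fubini_tonelli1 _ mab); last by move=> p; rewrite lee_fin mulr_ge0.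
rewrite -ge0_integralZr//; last 3 first.
- exact/measurable_EFinP.
- by move=> x _; rewrite lee_fin.
- by apply: integral_ge0 => y _; rewrite lee_fin.
apply: eq_integral => x _; rewrite /fubini_F/=.
under eq_integral do rewrite EFinM.
rewrite ge0_integralZl//; last 2 first.
- by move=> y _; rewrite lee_fin.
- by rewrite lee_fin.
exact/measurable_EFinP.
Qed.

Lemma integrable_prod (a : X -> R) (b : Y -> R) :
  (forall x, 0 <= a x) -> (forall y, 0 <= b y) ->
  m1.-integrable setT (EFin \o a) -> m2.-integrable setT (EFin \o b) ->
  (m1 \x m2)%E.-integrable setT (EFin \o (fun p => a p.1 * b p.2)) /\
  \int[(m1 \x m2)%E]_p (a p.1 * b p.2) = (\int[m1]_x a x) * (\int[m2]_y b y).
Proof.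
move=> a0 b0 ia ib.
have ma := integrableEFin_fun ia; have mb := integrableEFin_fun ib.
have H := ge0_integral_prod ma mb a0 b0.
rewrite (Rintegral_EFin ia) (Rintegral_EFin ib) -EFinM in H.
split; last by rewrite /Rintegral H.
apply/integrableP; split.
  apply/measurable_EFinP; apply: measurable_funM.
    exact: measurableT_comp ma measurable_fst.
  exact: measurableT_comp mb measurable_snd.
under eq_integral => p _ do rewrite /= ger0_norm ?mulr_ge0//.
by rewrite H ltry.
Qed.

End product.

(** * Moment weights, gain and loss terms *)

Section bilinear.
Context {R : realType} {N : nat}.
Notation V := 'rV[R]_N.
Notation S := (@sphere_measure R N).
Notation lam := (lebesgue_row R N).
Notation lam2 := (lebesgue_row R N \x lebesgue_row R N)%E.
Variables (bt : R -> R -> R -> R) (e : R -> R).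
Hypothesis Hbt : bounded_density bt.
Hypothesis He : restitution e.

Local Notation m := (@energy_weight R N).

Definition moment_weight (q : nat) (v : V) : R := 1 + enorm v ^+ q.

Lemma moment_weight_ge0 q v : 0 <= moment_weight q v.
Proof. by rewrite addr_ge0// exprn_ge0// enorm_ge0. Qed.

Lemma measurable_moment_weight q : measurable_fun setT (moment_weight q).
Proof.
apply: measurable_funD => //; apply: measurable_funX.
exact: measurable_enorm.
Qed.

Lemma measurable_energy_weight : measurable_fun setT m.
Proof. exact: measurable_moment_weight. Qed.

Lemma measurable_cst_enorm : measurable_fun setT (fun v : V => 1 + enorm v).
Proof. by apply: measurable_funD => //; exact: measurable_enorm. Qed.

Lemma weight1_le v : 1 + enorm v <= 2 * moment_weight 4 v.
Proof.
rewrite /moment_weight; have r0 := enorm_ge0 v; set r := enorm v in r0 *.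
have H : 0 <= (r ^+ 2 - 1) ^+ 2 by exact: sqr_ge0.
have H2 : 0 <= (r - 1) ^+ 2 by exact: sqr_ge0.
have -> : r ^+ 4 = (r ^+ 2) ^+ 2 by rewrite -exprM.
by nra.
Qed.

(** The factor |v - vs| together with [m] produces a third-order weight. The fourth moments dominate
    it, and the margin between the two orders is used in [cubic_distance_interpolation]. *)
Lemma weight3_le v : (1 + enorm v) * m v <= 4 * moment_weight 4 v.
Proof.
rewrite /moment_weight /energy_weight; have r0 := enorm_ge0 v; set r := enorm v in r0 *.
have H : 0 <= (r ^+ 2 - 1) ^+ 2 by exact: sqr_ge0.
have H2 : 0 <= (r - 1) ^+ 2 by exact: sqr_ge0.
have H3 : 0 <= (r ^+ 2 - r) ^+ 2 by exact: sqr_ge0.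
have H4 : r ^+ 3 = r * r ^+ 2 by rewrite exprS.
have -> : r ^+ 4 = (r ^+ 2) ^+ 2 by rewrite -exprM.
by nra.
Qed.

Lemma weight1_le2 v : 1 + enorm v <= 2 * m v.
Proof.
rewrite /energy_weight; have r0 := enorm_ge0 v; set r := enorm v in r0 *.
have H2 : 0 <= (r - 1) ^+ 2 by exact: sqr_ge0.
by nra.
Qed.

(** Bounding the sum of the two speeds by a product separates the variables, so that double
    integrals factor. *)
Lemma relative_speed_le (v vs : V) : enorm (v - vs) <= (1 + enorm v) * (1 + enorm vs).
Proof.
apply: (le_trans (ler_enormB _ _)).
have := mulr_ge0 (enorm_ge0 v) (enorm_ge0 vs); lra.
Qed.

Definition total_kernel E (u : V) : R := \int[S]_s kernel bt E u s.

Lemma integrable_kernel E u : 0 < E -> S.-integrable setT (EFin \o kernel bt E u).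
Proof.
move=> E0; have [M M0 HM] := @kernel_bound R N bt Hbt.
apply: (@le_integrable_EFin _ _ _ _ _ (fun=> M * enorm u)).
- exact: measurable_kernel2.
- by move=> s; rewrite ger0_norm ?kernel_ge0// HM.
- exact: finite_measure_integrable_cst.
Qed.

Lemma total_kernel_ge0 E u : 0 < E -> 0 <= total_kernel E u.
Proof. by move=> E0; apply: Rintegral_ge0 => s _; exact: kernel_ge0. Qed.

Lemma total_kernel_le : exists2 c0 : R, 0 <= c0 &
  forall (E : R) u, 0 < E -> total_kernel E u <= c0 * enorm u.
Proof.
have [M M0 HM] := @kernel_bound R N bt Hbt.
exists (M * fine (S setT)) => [|E u E0]; first by rewrite mulr_ge0// fine_ge0.
rewrite mulrAC -Rintegral_cst//; apply: le_Rintegral => //.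
- exact: integrable_kernel.
- exact: finite_measure_integrable_cst.
- by move=> s _; exact: HM.
Qed.

Lemma measurable_total_kernel d (X : measurableType d) E (f : X -> V) : 0 < E ->
  measurable_fun setT f -> measurable_fun setT (fun x => total_kernel E (f x)).
Proof.
move=> E0 mf; apply: (measurableT_comp (f := fun u => total_kernel E u)) mf.
exact: (@measurable_Rintegral_param _ _ _ _ _ S _ (measurable_kernel Hbt E0)).
Qed.

Section test.
Variables (E : R) (phi : V -> R).
Hypotheses (E0 : 0 < E) (mphi : measurable_fun setT phi)
  (phim : forall v, `|phi v| <= m v).

Lemma measurable_gain d (X : measurableType d) (f : X -> V * V) (g : X -> V) :
  measurable_fun setT f -> measurable_fun setT g ->
  measurable_fun setT (fun x => gain e E phi (f x) (g x)).
Proof.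
move=> /measurable_fun_pairP[mf1 mf2] mg.
have md : measurable_fun setT (fun x => inelastic_direction (e E) ((f x).1 - (f x).2) (g x)).
  by apply: measurable_inelastic_direction => //; exact: measurable_rowB.
by apply: measurable_funD; apply: (measurableT_comp mphi);
  [exact: measurable_post_star|exact: measurable_post].
Qed.

(** On the sphere the direction lies in the unit ball, and the energy inequality bounds v' and v'_*
    together. Off the sphere both sides vanish with the kernel. *)
Lemma gain_kernel_le (p : V * V) (u s : V) :
  `|gain e E phi p s * kernel bt E u s| <= (m p.1 + m p.2) * kernel bt E u s.
Proof.
rewrite normrM (ger0_norm (kernel_ge0 Hbt _ _ E0)).
have [s1|s1] := boolP (s \in @unit_sphere R N); last first.
  by rewrite /kernel indicE (negbTE s1)/= !mul0r !mulr0.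
rewrite ler_wpM2r ?kernel_ge0// /gain (le_trans (ler_normD _ _))//.
apply: le_trans (lerD (phim _) (phim _)) _.
apply: energy_weight_post; apply: enorm_inelastic_direction; first exact: He.1.
by rewrite inE in s1.
Qed.

Definition gain_average (p : V * V) : R :=
  \int[S]_s (gain e E phi p s * kernel bt E (p.1 - p.2) s).

Lemma integrable_gain (p : V * V) (u : V) : S.-integrable setT
  (EFin \o (fun s => gain e E phi p s * kernel bt E u s)).
Proof.
apply: (le_integrable_EFin _ (gain_kernel_le p u)).
  apply: measurable_funM; last exact: measurable_kernel2.
  by apply: measurable_gain => //; exact: measurable_cst.
by apply: integrable_EFinZ; exact: integrable_kernel.
Qed.

Lemma collision_averageE p : collision_average bt e E phi p =
  gain_average p - (phi p.1 + phi p.2) * total_kernel E (p.1 - p.2).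
Proof.
rewrite /collision_average.
under eq_Rintegral => s _ do rewrite -addrA -opprD mulrBl.
rewrite RintegralB//; last 2 first.
- exact: integrable_gain.
- by apply: integrable_EFinZ; exact: integrable_kernel.
by rewrite RintegralZl//; exact: integrable_kernel.
Qed.

Lemma gain_average_le p :
  `|gain_average p| <= (m p.1 + m p.2) * total_kernel E (p.1 - p.2).
Proof.
rewrite /total_kernel -RintegralZl//; last exact: integrable_kernel.
apply: normr_Rintegral_le; last by apply: integrable_EFinZ; exact: integrable_kernel.
- apply: measurable_funM; last exact: measurable_kernel2.
  by apply: measurable_gain => //; exact: measurable_cst.
- by move=> s; exact: gain_kernel_le.
Qed.

Lemma measurable_gain_average : measurable_fun setT gain_average.
Proof.
apply: (@measurable_Rintegral_param _ _ _ _ _ S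
  (fun q => gain e E phi q.1 q.2 * kernel bt E (q.1.1 - q.1.2) q.2)).
apply: measurable_funM.
  by apply: measurable_gain; [exact: measurable_fst|exact: measurable_snd].
apply: measurable_kernel2 => //.
by apply: measurable_rowB; [exact: measurableT_comp measurable_fst measurable_fst|
  exact: measurableT_comp measurable_snd measurable_fst].
Qed.

Lemma measurable_collision_average : measurable_fun setT (collision_average bt e E phi).
Proof.
rewrite (_ : collision_average _ _ _ _ = fun p => gain_average p -
    (phi p.1 + phi p.2) * total_kernel E (p.1 - p.2)); last first.
  by apply/funext => p; exact: collision_averageE.
apply: measurable_funB; first exact: measurable_gain_average.
apply: measurable_funM.
  by apply: measurable_funD; [exact: measurableT_comp measurable_fst|
    exact: measurableT_comp measurable_snd].
by apply: measurable_total_kernel => //; exact: measurable_rowB.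
Qed.

Lemma collision_average_le p : `|collision_average bt e E phi p| <=
  2 * (m p.1 + m p.2) * total_kernel E (p.1 - p.2).
Proof.
rewrite collision_averageE (le_trans (ler_normB _ _))//.
rewrite -mulrA mulr_natl mulr2n lerD ?gain_average_le// normrM.
rewrite (ger0_norm (total_kernel_ge0 _ E0)) ler_wpM2r ?total_kernel_ge0//.
by rewrite (le_trans (ler_normD _ _))// lerD.
Qed.

End test.
End bilinear.

(** * The bilinear estimate at a common energy *)

Section bilinear_estimate.
Context {R : realType} {N : nat}.
Notation V := 'rV[R]_N.
Notation lam := (lebesgue_row R N).
Notation lam2 := (lebesgue_row R N \x lebesgue_row R N)%E.
Notation m := (@energy_weight R N).
Notation w4 := (@moment_weight R N 4).

Lemma integrable_moment_le (f w : V -> R) (k C : R) : measurable_fun setT f ->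
  (forall v, 0 <= f v) -> measurable_fun setT w -> (forall v, 0 <= w v <= k * w4 v) ->
  lam.-integrable setT (EFin \o (fun v => f v * w4 v)) ->
  \int[lam]_v (f v * w4 v) <= C -> 0 <= k ->
  lam.-integrable setT (EFin \o (fun v => f v * w v)) /\
  \int[lam]_v (f v * w v) <= k * C.
Proof.
move=> mf f0 mw wk iw fC k0.
have H v : f v * w v <= k * (f v * w4 v).
  by rewrite mulrCA ler_wpM2l//; have /andP[] := wk v.
have i1 := integrable_EFinZ k iw.
have i2 : lam.-integrable setT (EFin \o (fun v => f v * w v)).
  apply: (le_integrable_EFin _ _ i1); first exact: measurable_funM.
  by move=> v; rewrite ger0_norm// mulr_ge0//; have /andP[] := wk v.
split=> //; apply: le_trans (_ : k * \int[lam]_v (f v * w4 v) <= _); last by rewrite ler_wpM2l.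
by rewrite -RintegralZl//; apply: le_Rintegral.
Qed.

Variables (bt : R -> R -> R -> R) (e : R -> R).
Hypothesis Hbt : bounded_density bt.
Hypothesis He : restitution e.

Lemma integrable_collision (E : R) (phi f : V -> R) : 0 < E ->
  measurable_fun setT phi -> (forall v, `|phi v| <= m v) ->
  measurable_fun setT f -> (forall v, 0 <= f v) ->
  lam.-integrable setT (EFin \o (fun v => f v * w4 v)) ->
  lam2.-integrable setT (EFin \o (fun p => f p.2 * f p.1 * collision_average bt e E phi p)).
Proof.
move=> E0 mphi phim mf f0 iw.
have [c0 c00 Hc0] := @total_kernel_le R N bt Hbt.
have mw1 := @measurable_cst_enorm R N.
have mm := @measurable_energy_weight R N.
have [ia _] := @integrable_moment_le f (fun v => 1 + enorm v) 2 _ mf f0 mw1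
  (fun v => introT andP (conj (addr_ge0 ler01 (enorm_ge0 v)) (weight1_le v))) iw (lexx _) (ler0n _ _).
have [ib _] := @integrable_moment_le f (fun v => (1 + enorm v) * m v) 4 _ mf f0 (measurable_funM mw1 mm)
  (fun v => introT andP (conj (mulr_ge0 (addr_ge0 ler01 (enorm_ge0 v)) (energy_weight_ge0 v)) (weight3_le v))) iw (lexx _) (ler0n _ _).
have w1p (v : V) : 0 <= 1 + enorm v by rewrite addr_ge0// enorm_ge0.
have ap v : 0 <= f v * (1 + enorm v) by rewrite mulr_ge0.
have bp v : 0 <= f v * ((1 + enorm v) * m v) by rewrite mulr_ge0// mulr_ge0// energy_weight_ge0.
have [iab _] := integrable_prod ap bp ia ib.
have [iba _] := integrable_prod bp ap ib ia.
apply: (le_integrable_EFin _ _ (integrable_EFinZ (2 * c0) (integrable_EFinD iab iba))).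
  apply: measurable_funM; last exact: measurable_collision_average.
  by apply: measurable_funM; [exact: measurableT_comp measurable_snd|
    exact: measurableT_comp measurable_fst].
move=> -[v vs] /=; rewrite normrM (ger0_norm (mulr_ge0 (f0 _) (f0 _))).
apply: (le_trans (ler_wpM2l (mulr_ge0 (f0 _) (f0 _)) (collision_average_le Hbt He E0 mphi phim _))) => /=.
have Hk : total_kernel bt E (v - vs) <= c0 * ((1 + enorm v) * (1 + enorm vs)).
  by apply: (le_trans (Hc0 _ _ E0)); rewrite ler_wpM2l// relative_speed_le.
have P : 0 <= f vs * f v * (2 * (m v + m vs)).
  by rewrite !mulr_ge0// addr_ge0// energy_weight_ge0.
rewrite [leLHS]mulrA; apply: (le_trans (ler_wpM2l P Hk)).
by rewrite le_eqVlt; apply/orP; left; apply/eqP; ring.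
Qed.

(** The constant C enters linearly because each term of f f_* - g g_* = f_* (f - g) + g (f - g)_*
    has exactly one factor that is not a difference, and C bounds its moments. *)
Lemma bilinear_estimate : exists2 c1 : R, 0 <= c1 &
  forall (E C : R) (phi f g : V -> R), 0 < E ->
  measurable_fun setT phi -> (forall v, `|phi v| <= m v) ->
  measurable_fun setT f -> (forall v, 0 <= f v) ->
  measurable_fun setT g -> (forall v, 0 <= g v) ->
  lam.-integrable setT (EFin \o (fun v => f v * w4 v)) ->
  \int[lam]_v (f v * w4 v) <= C ->
  lam.-integrable setT (EFin \o (fun v => g v * w4 v)) ->
  \int[lam]_v (g v * w4 v) <= C ->
  2^-1 * \int[lam2]_p (f p.2 * f p.1 * collision_average bt e E phi p) -
  2^-1 * \int[lam2]_p (g p.2 * g p.1 * collision_average bt e E phi p) <=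
  c1 * C * (\int[lam]_v (`|f v - g v| * m v) +
    \int[lam]_v ((`|f v - g v| * m v - (f v - g v) * phi v) * (1 + enorm v))).
Proof.
have [c0 c00 Hc0] := @total_kernel_le R N bt Hbt.
(* The coefficient of C n is 1/2 (from [Qweak]) times 2 (symmetric terms) times 2 (cross terms)
   times 2 (int d <= 2 n) times 4 (int b <= 4 C). The one of C int r is smaller. *)
exists (16 * c0); first by rewrite mulr_ge0.
move=> E C phi f g E0 mphi phim mf f0 mg g0 if4 fC ig4 gC.
have mw1 := @measurable_cst_enorm R N.
have mm := @measurable_energy_weight R N.
have m0 := @energy_weight_ge0 R N.
have w1p (v : V) : 0 <= 1 + enorm v by rewrite addr_ge0// enorm_ge0.
have C0 : 0 <= C.
  by apply: le_trans fC; apply: Rintegral_ge0 => v _; rewrite mulr_ge0// moment_weight_ge0.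
have H1 v := introT andP (conj (w1p v) (weight1_le v)).
have H2 v := introT andP (conj (mulr_ge0 (w1p v) (m0 v)) (weight3_le v)).
have [iaf haf] := integrable_moment_le mf f0 mw1 H1 if4 fC (ler0n _ _).
have [iag hag] := integrable_moment_le mg g0 mw1 H1 ig4 gC (ler0n _ _).
have [ibf hbf] := integrable_moment_le mf f0 (measurable_funM mw1 mm) H2 if4 fC (ler0n _ _).
have [ibg hbg] := integrable_moment_le mg g0 (measurable_funM mw1 mm) H2 ig4 gC (ler0n _ _).
pose D v := f v - g v.
have mD : measurable_fun setT D by exact: measurable_funB.
have mnD : measurable_fun setT (fun v => `|D v|) by exact: measurableT_comp.
have Dfg v : `|D v| <= f v + g v.
  by rewrite (le_trans (ler_normB _ _))// !ger0_norm.
have iDb : lam.-integrable setT (EFin \o (fun v => `|D v| * ((1 + enorm v) * m v))).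
  apply: (le_integrable_EFin _ _ (integrable_EFinD ibf ibg)).
    by apply: measurable_funM => //; exact: measurable_funM.
  by move=> v; rewrite ger0_norm ?mulr_ge0// -mulrDl ler_wpM2r// mulr_ge0.
have iDm : lam.-integrable setT (EFin \o (fun v => `|D v| * m v)).
  apply: (le_integrable_EFin _ _ iDb); first exact: measurable_funM.
  move=> v; rewrite ger0_norm ?mulr_ge0// mulrCA ler_peMl// ?mulr_ge0//.
  by rewrite lerDl enorm_ge0.
pose d v := `|D v| * (1 + enorm v).
have d0 v : 0 <= d v by rewrite mulr_ge0.
have id : lam.-integrable setT (EFin \o d).
  apply: (le_integrable_EFin _ _ iDb); first exact: measurable_funM.
  move=> v; rewrite ger0_norm// /d mulrA ler_peMr ?energy_weight_ge1//; exact: d0.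
have hd : \int[lam]_v d v <= 2 * \int[lam]_v (`|D v| * m v).
  rewrite -RintegralZl//; apply: le_Rintegral => //; first exact: integrable_EFinZ.
  by move=> v _; rewrite /d mulrCA ler_wpM2l// weight1_le2.
pose r v := (`|D v| * m v - D v * phi v) * (1 + enorm v).
have Dphi v : `|D v * phi v| <= `|D v| * m v by rewrite normrM ler_wpM2l.
have r0 v : 0 <= r v.
  rewrite mulr_ge0// subr_ge0 (le_trans _ (Dphi v))//; exact: ler_norm.
have ir : lam.-integrable setT (EFin \o r).
  apply: (le_integrable_EFin _ _ (integrable_EFinZ 2 iDb)).
    by apply: measurable_funM => //; apply: measurable_funB; exact: measurable_funM.
  move=> v; rewrite ger0_norm// /r [leRHS](_ : _ = (`|D v| * m v + `|D v| * m v) * (1 + enorm v)); last by ring.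
  rewrite ler_wpM2r// lerD// (le_trans _ (Dphi v))// -normrN; exact: ler_norm.
pose af v := f v * (1 + enorm v).
pose ag v := g v * (1 + enorm v).
pose bf v := f v * ((1 + enorm v) * m v).
pose bg v := g v * ((1 + enorm v) * m v).
have af0 v : 0 <= af v by rewrite mulr_ge0.
have ag0 v : 0 <= ag v by rewrite mulr_ge0.
have bf0 v : 0 <= bf v by rewrite mulr_ge0// mulr_ge0.
have bg0 v : 0 <= bg v by rewrite mulr_ge0// mulr_ge0.
have [i1 e1] := integrable_prod r0 af0 ir iaf.
have [i2 e2] := integrable_prod d0 bf0 id ibf.
have [i3 e3] := integrable_prod ag0 r0 iag ir.
have [i4 e4] := integrable_prod bg0 d0 ibg id.
have iX1 := integrable_EFinD i1 (integrable_EFinZ 2 i2).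
have iX2 := integrable_EFinD i3 (integrable_EFinZ 2 i4).
have iX := integrable_EFinZ c0 (integrable_EFinD iX1 iX2).
have icf := integrable_collision E0 mphi phim mf f0 if4.
have icg := integrable_collision E0 mphi phim mg g0 ig4.
rewrite -mulrBr -RintegralB//.
apply: (@le_trans _ _ (2^-1 * \int[lam2]_p (c0 *
  ((r p.1 * af p.2 + 2 * (d p.1 * bf p.2)) + (ag p.1 * r p.2 + 2 * (bg p.1 * d p.2)))))).
  rewrite ler_wpM2l ?invr_ge0//; apply: le_Rintegral => //; first exact: integrable_EFinB.
  move=> [v vs] _ /=.
  rewrite (_ : _ - _ = f vs * (D v * collision_average bt e E phi (v, vs)) +
     g v * (D vs * collision_average bt e E phi (v, vs))); last by rewrite /D; ring.
  rewrite collision_averageE//=.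
  set a := total_kernel bt E (v - vs); set G := gain_average bt e E phi (v, vs).
  have aE : 0 <= a by exact: total_kernel_ge0.
  have Hk : a <= c0 * ((1 + enorm v) * (1 + enorm vs)).
    by apply: (le_trans (Hc0 _ _ E0)); rewrite ler_wpM2l// relative_speed_le.
  have HG : `|G| <= (m v + m vs) * a by exact: gain_average_le.
  have DG x : D x * G <= `|D x| * ((m v + m vs) * a).
    by rewrite (le_trans (ler_norm _))// normrM ler_wpM2l.
  have Dp x y : - (D x * phi y) * a <= `|D x| * m y * a.
    rewrite ler_wpM2r// (le_trans (ler_norm _))// normrN normrM ler_wpM2l//.
  (* The gain costs |D| m a + |D| m_* a. The loss in phi(v) is kept with its sign and turns |D| m
     into the defect; the loss in phi(vs) is merely bounded, which doubles |D| m_*. *)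
  have T1 : D v * (G - (phi v + phi vs) * a) <=
      ((`|D v| * m v - D v * phi v) + 2 * (`|D v| * m vs)) * a.
    move: (DG v) (Dp v vs); clear; move: (D v * G) (D v) => x y; lra.
  have T2 : D vs * (G - (phi v + phi vs) * a) <=
      ((`|D vs| * m vs - D vs * phi vs) + 2 * (`|D vs| * m v)) * a.
    move: (DG vs) (Dp vs v); clear; move: (D vs * G) (D vs) => x y; lra.
  have Q x y : 0 <= (`|D x| * m x - D x * phi x) + 2 * (`|D x| * m y).
    rewrite addr_ge0 ?mulr_ge0// subr_ge0 (le_trans _ (Dphi x))//; exact: ler_norm.
  have T1' := le_trans T1 (ler_wpM2l (Q v vs) Hk).
  have T2' := le_trans T2 (ler_wpM2l (Q vs v) Hk).
  apply: (le_trans (lerD (ler_wpM2l (f0 vs) T1') (ler_wpM2l (g0 v) T2'))).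
  rewrite le_eqVlt; apply/orP; left; apply/eqP.
  by rewrite /r /af /d /bf /ag /bg; ring.
rewrite RintegralZl//; last exact: integrable_EFinD.
rewrite RintegralD// RintegralD//; last exact: integrable_EFinZ.
rewrite RintegralD//; last exact: integrable_EFinZ.
rewrite RintegralZl// RintegralZl// e1 e2 e3 e4.
have Ir0 : 0 <= \int[lam]_v r v by exact: Rintegral_ge0.
have Id0 : 0 <= \int[lam]_v d v by exact: Rintegral_ge0.
rewrite -[X in _ <= _ * (_ + X)]/(\int[lam]_v r v).
rewrite -[X in _ <= _ * (X + _)]/(\int[lam]_v (`|D v| * m v)).
set n := \int[lam]_v (`|D v| * m v) in hd *.
have Q1 := ler_wpM2l Ir0 haf; have Q2 := ler_wpM2l Id0 hbf.
have Q3 := ler_wpM2r Ir0 hag; have Q4 := ler_wpM2r Id0 hbg.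
have Q5 := ler_wpM2l C0 hd.
have Q6 := mulr_ge0 C0 Ir0.
rewrite -/af -/bf -/ag -/bg in Q1 Q2 Q3 Q4.
rewrite [leRHS](_ : _ = c0 * (16 * (C * n) + 16 * (C * \int[lam]_v r v))); last by ring.
rewrite mulrCA ler_wpM2l//.
move: Q1 Q2 Q3 Q4 Q5 Q6; clear.
move: (\int[lam]_v r v) (\int[lam]_v d v) (\int[lam]_v af v) (\int[lam]_v bf v).
move: (\int[lam]_v ag v) (\int[lam]_v bg v) n => a1 a2 a3 a4 a5 a6 a7.
lra.
Qed.

End bilinear_estimate.

(** * Mollification and BV densities *)

Section mollifier.
Context {R : realType} {N : nat}.
Notation V := 'rV[R]_N.
Notation lam := (lebesgue_row R N).
Notation w4 := (@moment_weight R N 4).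

(** Evenness makes rho (y - x) a probability density in x as well as in y. *)
Definition mollifier (delta : R) (rho : V -> R) :=
  [/\ measurable_smooth rho, forall v, 0 <= rho v,
      (\int[lam]_v (rho v)%:E = 1)%E, forall v, rho (- v) = rho v &
      forall v, rho v != 0 -> forall j, `|v ord0 j| <= delta].

Lemma measurable_cube (r : R) :
  measurable [set v : V | forall i, `[(- r)%R, r]%classic (v ord0 i)].
Proof.
rewrite (_ : [set _ | _] = \bigcap_(i in [set` index_enum 'I_N])
    (setT `&` (fun v : V => v ord0 i) @^-1` `[(- r)%R, r]%classic)).
  rewrite bigcap_seq; apply: bigsetI_measurable => i _.
  by apply: measurable_coord => //; exact: measurable_itv.
apply/seteqP; split => v /= H i; first by move=> _; split => //; exact: H.
by have [] := H i (mem_index_enum i).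
Qed.

Lemma integrable_bounded_support (f : V -> R) (M : R) : measurable_fun setT f ->
  (forall v, `|f v| <= M) -> bounded_support f ->
  lam.-integrable setT (EFin \o f).
Proof.
move=> mf fM [r Hr].
pose Q := [set v : V | forall i, `[(- r)%R, r]%classic (v ord0 i)].
have mQ : measurable Q by exact: measurable_cube.
have M0 : 0 <= M := le_trans (normr_ge0 _) (fM 0).
have ig : lam.-integrable setT (EFin \o (fun v => M * \1_Q v)).
  apply: integrable_EFinZ; apply/integrableP; split.
    by apply/measurable_EFinP; exact: measurable_indic.
  under eq_integral => v _ do rewrite /= ger0_norm//.
  by rewrite integral_indic// setIT lebesgue_row_cube_fin.
apply: (le_integrable_EFin mf _ ig) => v.
have [->|/Hr H] := eqVneq (f v) 0; first by rewrite normr0 mulr_ge0.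
by rewrite indicE mem_set ?mulr1// => j /=; rewrite in_itv/= -ler_norml.
Qed.

Lemma box_bumpN a b (v : V) : box_bump a b (- v) = box_bump a b v.
Proof.
by apply: eq_bigr => j _; rewrite mxE [LHS]mulrC mulrNN mulrN -mulNr.
Qed.

Lemma integral_box_bump_gt0 (a b : R) : 0 < a -> 0 < b ->
  (0 < \int[lam]_v (box_bump a b v)%:E)%E.
Proof.
move=> a0 b0.
(* On the cube of radius b / (2 a) all arguments of [flat] are at least b / 2. *)
pose r := b / (2 * a).
have r0 : 0 < r by rewrite divr_gt0// mulr_gt0.
pose Q := [set v : V | forall i, `[(- r)%R, r]%classic (v ord0 i)].
have mQ : measurable Q by exact: measurable_cube.
pose c := \prod_(j <- enum 'I_N) (flat 1 (b / 2) * flat 1 (b / 2)).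
have c0 : 0 < c.
  by apply: prodr_gt0 => j _; rewrite mulr_gt0// flat_gt0// divr_gt0.
apply: (@lt_le_trans _ _ (\int[lam]_v (c * \1_Q v)%:E)%E); last first.
  apply: le_integral_EFin.
  - by apply: measurable_funM => //; exact: measurable_indic.
  - by apply: measurable_smooth_fun; exact: box_bump_smooth.
  - by move=> v; rewrite mulr_ge0// ltW.
  - move=> v; rewrite indicE; case: (boolP (v \in Q)) => [|_]; last first.
      by rewrite mulr0; have /andP[] := box_bump01 a b v.
    rewrite inE => Qv; rewrite mulr1; apply: ler_prod => j _.
    rewrite !mulr_ge0 ?flat_ge0//=; have := Qv j; rewrite /= in_itv/= => /andP[h1 h2].
    have ra : r * a = b / 2 by rewrite /r; field; rewrite gt_eqF.
    have h3 := ler_wpM2l (ltW a0) h1; have h4 := ler_wpM2l (ltW a0) h2.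
    apply: ler_pM; rewrite ?flat_ge0//; apply: flat_mono; lra.
under eq_integral do rewrite EFinM.
rewrite ge0_integralZl//; last 2 first.
- by apply/measurable_EFinP; exact: measurable_indic.
- by rewrite lee_fin ltW.
rewrite integral_indic// setIT mule_gt0 ?lte_fin//.
rewrite [X in (_ < X)%E](@lebesgue_row_box R N (fun=> `[(- r)%R, r]%classic)); last first.
  by move=> i; exact: measurable_itv.
rewrite (eq_bigr (fun=> (r - - r)%:E)).
  by rewrite prodEFin lte_fin prodr_gt0// => _ _; lra.
move=> i _; rewrite lebesgue_measure_itv/= lte_fin ifT ?EFinB//; lra.
Qed.

Lemma mollifier_exists (delta : R) : 0 < delta -> exists rho, mollifier delta rho.
Proof.
move=> d0; have a0 : 0 < delta^-1 by rewrite invr_gt0.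
have Z0 := integral_box_bump_gt0 a0 (@ltr01 R).
have sb := @box_bump_smooth R N delta^-1 1.
have ib : lam.-integrable setT (EFin \o box_bump delta^-1 1).
  apply: (@integrable_bounded_support _ 1).
  - exact: measurable_smooth_fun.
  - by move=> v; have /andP[? ?] := box_bump01 delta^-1 1 v; rewrite ger0_norm.
  - exact: bounded_support_box.
rewrite (Rintegral_EFin ib) lte_fin in Z0.
set Z := \int[lam]_v box_bump delta^-1 1 v in Z0.
exists (fun v => Z^-1 * box_bump delta^-1 1 v); split.
- by apply: measurable_smoothM => //; exact: measurable_smooth_cst.
- move=> v; rewrite mulr_ge0//; first by rewrite invr_ge0 ltW.
  by have /andP[] := box_bump01 delta^-1 1 v.
- rewrite (Rintegral_EFin (integrable_EFinZ _ ib)) RintegralZl// -/Z mulVf//.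
  by rewrite gt_eqF.
- by move=> v; rewrite box_bumpN.
- move=> v; rewrite mulf_eq0 negb_or => /andP[_ H] j.
  by have := box_bump_support a0 H j; rewrite div1r invrK.
Qed.

(** Points at coordinate distance at most 1 satisfy |x| <= |y| + N, and (b + n)^4 <= 8 (b^4 +
    n^4). *)
Definition mollify_const : R := 8 + 8 * N%:R ^+ 4.

Lemma mollify_const_ge0 : 0 <= mollify_const.
Proof. by rewrite addr_ge0// mulr_ge0// exprn_ge0. Qed.

Lemma moment_weight_shift (x y : V) : (forall j, `|(y - x) ord0 j| <= 1) ->
  w4 x <= mollify_const * w4 y.
Proof.
move=> H; rewrite /moment_weight /mollify_const.
have : enorm x <= enorm y + N%:R.
  rewrite -[x in leLHS](subKr y) (le_trans (ler_enormB _ _))// lerD2l.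
  rewrite (le_trans (enorm_le_sum _))//.
  apply: (@le_trans _ _ (\sum_(i < N) (1 : R))); first by apply: ler_sum => j _; exact: H.
  by rewrite sumr_const card_ord.
have := enorm_ge0 x; have := enorm_ge0 y.
have : 0 <= N%:R :> R by [].
move: (enorm x) (enorm y) (N%:R) => a b n n0 b0 a0 ab.
have a4 : a ^+ 4 <= (b + n) ^+ 4 by rewrite lerXn2r ?nnegrE// addr_ge0.
have q : (b + n) ^+ 4 <= 8 * (b ^+ 4 + n ^+ 4).
  have E4 (z : R) : z ^+ 4 = (z ^+ 2) ^+ 2 by rewrite -exprM.
  have h1 : (b + n) ^+ 2 <= 2 * (b ^+ 2 + n ^+ 2).
    have := sqr_ge0 (b - n); rewrite sqrrB sqrrD; lra.
  have h2 : ((b + n) ^+ 2) ^+ 2 <= (2 * (b ^+ 2 + n ^+ 2)) ^+ 2.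
    by rewrite lerXn2r ?nnegrE ?sqr_ge0// mulr_ge0// addr_ge0// sqr_ge0.
  have := sqr_ge0 (b ^+ 2 - n ^+ 2); rewrite !E4; move: h2.
  move: (b ^+ 2) (n ^+ 2) ((b + n) ^+ 2) => x1 y1 z1.
  rewrite exprMn sqrrB sqrrD; lra.
have b4 : 0 <= b ^+ 4 by rewrite exprn_ge0.
have n4 : 0 <= n ^+ 4 by rewrite exprn_ge0.
have := mulr_ge0 b4 n4; lra.
Qed.

Variables (rho : V -> R) (delta : R).
Hypothesis Hrho : mollifier delta rho.
Hypothesis delta1 : delta <= 1.


Lemma integral_mollifier_shift (y : V) : (\int[lam]_x (rho (y - x)%R)%:E = 1)%E.
Proof.
have [sr r0 r1 rN _] := Hrho.
rewrite -r1 -(@ge0_integral_row_shift _ _ (- y) (EFin \o rho)).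
- by apply: eq_integral => x _ /=; rewrite -rN opprB.
- by apply/measurable_EFinP; exact: measurable_smooth_fun.
- by move=> x; rewrite lee_fin.
Qed.

Lemma measurable_rho_diff : measurable_fun setT (fun p : V * V => rho (p.2 - p.1)).
Proof.
have [sr _ _ _ _] := Hrho.
apply: (measurableT_comp (measurable_smooth_fun sr)).
exact: measurable_rowB.
Qed.

(** By Tonelli the weight at x is replaced by the weight at y, as rho (y - x) != 0 forces x and y to
    be close; then rho integrates to 1 in x. The measure [mu] is general so that the density and its
    derivative measures are treated alike. *)
Lemma integral_weight_mollified (mu : {sigma_finite_measure set V -> \bar R})
    (F : V -> \bar R) : measurable_fun setT F -> (forall y, 0 <= F y)%E ->
  (\int[lam]_x ((w4 x)%:E * \int[mu]_y (F y * (rho (y - x)%R)%:E)) <=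
   mollify_const%:E * \int[mu]_y (F y * (w4 y)%:E))%E.
Proof.
have [sr r0 r1 rN rs] := Hrho.
move=> mF F0.
have mr := measurable_rho_diff.
have mw4 := @measurable_moment_weight R N 4.
have w40 x := @moment_weight_ge0 R N 4 x.
pose G (p : V * V) := ((w4 p.1)%:E * (F p.2 * (rho (p.2 - p.1)%R)%:E))%E.
have mG : measurable_fun setT G.
  apply: emeasurable_funM.
    by apply/measurable_EFinP; exact: measurableT_comp mw4 measurable_fst.
  apply: emeasurable_funM; first exact: measurableT_comp mF measurable_snd.
  exact/measurable_EFinP.
have G0 p : (0 <= G p)%E by rewrite !mule_ge0// lee_fin.
have mFr x : measurable_fun setT (fun y => (F y * (rho (y - x)%R)%:E)%E).
  apply: emeasurable_funM => //; apply/measurable_EFinP.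
  by apply: (measurableT_comp (measurable_smooth_fun sr)); exact: measurable_row_add.
have -> : (\int[lam]_x ((w4 x)%:E * \int[mu]_y (F y * (rho (y - x)%R)%:E)) =
    \int[lam]_x \int[mu]_y G (x, y))%E.
  apply: eq_integral => x _; rewrite -ge0_integralZl//.
  - by move=> y _; rewrite mule_ge0// lee_fin.
  - by rewrite lee_fin.
rewrite (fubini_tonelli _ mG G0).
rewrite -ge0_integralZl//; last 3 first.
- by apply: emeasurable_funM => //; exact/measurable_EFinP.
- by move=> y _; rewrite mule_ge0// lee_fin.
- by rewrite lee_fin mollify_const_ge0.
apply: ge0_le_integral => //.
- by move=> y _; exact: integral_ge0.
- exact: (measurable_fun_fubini_tonelli_G _ mG G0).
- apply: measurable_funeM; apply: emeasurable_funM => //; exact/measurable_EFinP.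
move=> y _; rewrite /G /=.
have mry : measurable_fun setT (fun x : V => rho (y - x)).
  by apply: (measurableT_comp (measurable_smooth_fun sr)); apply: measurable_rowB.
under eq_integral do rewrite muleCA -EFinM.
rewrite ge0_integralZl//; last 2 first.
- by apply/measurable_EFinP; exact: measurable_funM.
- by move=> x _; rewrite lee_fin mulr_ge0.
rewrite muleCA lee_wpmul2l//.
apply: (@le_trans _ _ (\int[lam]_x ((mollify_const * w4 y) * rho (y - x))%:E)%E).
  apply: le_integral_EFin.
  - exact: measurable_funM.
  - exact: measurable_funM.
  - by move=> x; rewrite mulr_ge0.
  - move=> x; have [->|/rs H] := eqVneq (rho (y - x)) 0; first by rewrite !mulr0.
    rewrite ler_wpM2r//; apply: moment_weight_shift => j.
    exact: le_trans (H j) delta1.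
under eq_integral do rewrite EFinM.
rewrite ge0_integralZl//; last 3 first.
- exact/measurable_EFinP.
- by move=> x _; rewrite lee_fin.
- by rewrite lee_fin mulr_ge0 ?mollify_const_ge0.
by rewrite integral_mollifier_shift mule1 EFinM.
Qed.


Lemma mollifier_bounded : exists2 M : R, 0 <= M & forall v, `|rho v| <= M.
Proof.
have [sr _ _ _ rs] := Hrho; apply: bounded_support_bounded => //.
by exists delta.
Qed.

Lemma measurable_rho_shift (x : V) : measurable_fun setT (fun y : V => rho (y - x)).
Proof.
have [sr _ _ _ _] := Hrho.
by apply: (measurableT_comp (measurable_smooth_fun sr)); exact: measurable_row_add.
Qed.

Lemma integrable_mollifier (mu : {measure set V -> \bar R}) (F : V -> R) (x : V) :
  mu.-integrable setT (EFin \o F) ->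
  mu.-integrable setT (EFin \o (fun y => F y * rho (y - x))).
Proof.
move=> iF; have mF := integrableEFin_fun iF.
have [M M0 HM] := mollifier_bounded.
apply: (le_integrable_EFin _ _ (integrable_EFinZ M (integrable_EFin_norm iF))).
  by apply: measurable_funM => //; exact: measurable_rho_shift.
by move=> y; rewrite normrM mulrC ler_wpM2r.
Qed.

(** The convolution of [rho] with the measure F mu: the density g is the case of Lebesgue measure, a
    derivative measure is the case F = 1. *)
Definition mollify (mu : {measure set V -> \bar R}) (F : V -> R) (x : V) : R :=
  \int[mu]_y (F y * rho (y - x)).

Lemma measurable_mollify (mu : {sigma_finite_measure set V -> \bar R}) (F : V -> R) :
  measurable_fun setT F -> measurable_fun setT (mollify mu F).
Proof.
move=> mF; apply: (@measurable_Rintegral_param _ _ _ _ _ mu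
  (fun p : V * V => F p.2 * rho (p.2 - p.1))).
apply: measurable_funM; last exact: measurable_rho_diff.
exact: measurableT_comp mF measurable_snd.
Qed.

Lemma mollify_ge0 (mu : {measure set V -> \bar R}) (F : V -> R) x :
  (forall y, 0 <= F y) -> 0 <= mollify mu F x.
Proof.
by move=> F0; apply: Rintegral_ge0 => y _; rewrite mulr_ge0//; have [_ r0 _ _ _] := Hrho.
Qed.

Lemma mollify_weight_le (mu : {sigma_finite_measure set V -> \bar R}) (F : V -> R) :
  (forall y, 0 <= F y) ->
  mu.-integrable setT (EFin \o F) ->
  mu.-integrable setT (EFin \o (fun y => F y * w4 y)) ->
  lam.-integrable setT (EFin \o (fun x => mollify mu F x * w4 x)) /\
  \int[lam]_x (mollify mu F x * w4 x) <=
  mollify_const * \int[mu]_y (F y * w4 y).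
Proof.
move=> F0 iF iFw; have mF := integrableEFin_fun iF.
have w40 x := @moment_weight_ge0 R N 4 x.
apply: integrable_EFin_fin.
- apply: measurable_funM; [exact: measurable_mollify|exact: measurable_moment_weight].
- by move=> x; rewrite mulr_ge0// mollify_ge0.
have := @integral_weight_mollified mu (EFin \o F) _ _.
rewrite EFinM -Rintegral_EFin//.
move=> /(_ _ _) H; apply: le_trans (H _ _) => //.
- rewrite le_eqVlt; apply/orP; left; apply/eqP; apply: eq_integral => x _.
  rewrite mulrC EFinM; congr (_ * _)%E.
  by rewrite -Rintegral_EFin//; exact: integrable_mollifier.
- exact/measurable_EFinP.
Qed.

Lemma integral_rho_row (x : V) : \int[lam]_y rho (y - x) = 1.
Proof.
have [sr r0 r1 _ _] := Hrho.
rewrite /Rintegral (ge0_integral_row_shift (- x) (F := EFin \o rho))//= ?r1//.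
by apply/measurable_EFinP; exact: measurable_smooth_fun.
Qed.

Lemma integrable_rho_row (x : V) :
  lam.-integrable setT (EFin \o (fun y : V => rho (y - x))).
Proof.
have [sr r0 r1 _ _] := Hrho.
apply/integrableP; split; first by apply/measurable_EFinP; exact: measurable_rho_shift.
under eq_integral => y _ do rewrite /= ger0_norm//.
rewrite (ge0_integral_row_shift (- x) (F := EFin \o rho))//= ?r1 ?ltry//.
by apply/measurable_EFinP; exact: measurable_smooth_fun.
Qed.

Lemma mollify_sub_le (F : V -> R) (x : V) (e : R) :
  lam.-integrable setT (EFin \o F) ->
  (forall y, (forall j, `|(y - x) ord0 j| <= delta) -> `|F y - F x| <= e) ->
  `|mollify lam F x - F x| <= e.
Proof.
have [sr r0 r1 _ rs] := Hrho.
move=> iF H; have mF := integrableEFin_fun iF.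
have ir := integrable_rho_row x.
have iFr := @integrable_mollifier lam F x iF.
rewrite -[F x in X in `|X|](mulr1) -(integral_rho_row x) -RintegralZl//.
rewrite -RintegralB//; last exact: integrable_EFinZ.
rewrite -[leRHS]mulr1 -(integral_rho_row x) -RintegralZl//.
apply: normr_Rintegral_le; last exact: integrable_EFinZ.
- apply: measurable_funB; apply: measurable_funM => //; exact: measurable_rho_shift.
- move=> y; rewrite -mulrBl normrM (ger0_norm (r0 _)).
  have [->|/rs K] := eqVneq (rho (y - x)) 0; first by rewrite !mulr0.
  by rewrite ler_wpM2r// H.
Qed.

End mollifier.

Section mollify_cvg.
Context {R : realType} {N : nat}.
Notation V := 'rV[R]_N.
Notation lam := (lebesgue_row R N).
Notation w4 := (@moment_weight R N 4).
Variable rho : nat -> V -> R.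
Hypothesis Hrho : forall n, mollifier n.+1%:R^-1 (rho n).

Let delta1 n : n.+1%:R^-1 <= 1 :> R.
Proof. by rewrite invf_le1// ler1n. Qed.

Lemma mx_norm_le_coord (v : V) (d : R) : 0 <= d ->
  (forall j, `|v ord0 j| <= d) -> `|v| <= d.
Proof.
move=> d0 H; rewrite /Num.norm/= mx_normrE; apply: bigmax_le => //= -[i j] _ /=.
by rewrite (ord1 i); exact: H.
Qed.

Lemma mollify_test_cvg (phi : V -> R) (x : V) : measurable_smooth phi ->
  lam.-integrable setT (EFin \o phi) ->
  (fun n => mollify (rho n) lam phi x) @ \oo --> phi x.
Proof.
move=> sphi iphi; apply/cvgrPdist_le => eps e0.
have /cvgrPdist_le /(_ _ e0) /nbhs_ballP [d /= d0 Hd] := measurable_smooth_continuous sphi (x := x).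
near=> n; rewrite distrC; apply: (mollify_sub_le (Hrho n)) => // y Hy.
rewrite distrC; apply: Hd; rewrite -ball_normE /= -opprB normrN.
apply: (@le_lt_trans _ _ n.+1%:R^-1).
  by apply: mx_norm_le_coord => //; rewrite invr_ge0.
rewrite -(invrK d) ltf_pV2 ?posrE ?invr_gt0//.
apply: (@lt_le_trans _ _ n%:R); last by rewrite ler_nat.
by near: n; exact: nbhs_infty_gtr.
Unshelve. all: by end_near. Qed.

(** Convergence is clear for a smooth [phi] with bounded support. Density transfers it to g, since
    mollification is bounded in the weighted norm with constant K. *)
Lemma mollify_cvg_L1 (g : V -> R) (eps : R) : measurable_fun setT g ->
  (forall v, 0 <= g v) -> lam.-integrable setT (EFin \o g) ->
  lam.-integrable setT (EFin \o (fun v => g v * w4 v)) ->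
  0 < eps ->
  exists n, (\int[lam]_v (`|mollify (rho n) lam g v - g v| * w4 v)%:E <= eps%:E)%E.
Proof.
move=> mg g0 ig igw e0.
have w40 x := @moment_weight_ge0 R N 4 x.
have mw4 := @measurable_moment_weight R N 4.
have w4smooth : measurable_smooth w4.
  rewrite (_ : w4 = fun v => 1 + (energy_weight v + (-1)) * (energy_weight v + (-1))).
    apply: measurable_smoothD; first exact: measurable_smooth_cst.
    by apply: measurable_smoothM; apply: measurable_smoothD;
      do ?[exact: measurable_smooth_energy_weight|exact: measurable_smooth_cst].
  by apply/funext => v; rewrite /moment_weight /energy_weight; ring.
have icut k : lam.-integrable setT (fun v => (cutoff k v * w4 v)%:E).
  have sc : measurable_smooth (fun v : V => w4 v * cutoff k v).
    by apply: measurable_smoothM => //; exact: cutoff_smooth.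
  have bc : bounded_support (fun v : V => w4 v * cutoff k v).
    exact/bounded_supportM/bounded_support_cutoff.
  have [M M0 HM] := bounded_support_bounded sc bc.
  under eq_fun do rewrite mulrC.
  exact: integrable_bounded_support (measurable_smooth_fun sc) HM bc.
pose K : R := @mollify_const R N.
have K0 : 0 <= K by exact: mollify_const_ge0.
have e1 : 0 < eps / 2 by rewrite divr_gt0.
(* The error g - phi is counted once as it is and once mollified, at a total cost of K + 1. *)
have e2 : 0 < eps / 2 / (K + 1) by rewrite divr_gt0// ltr_wpDl.
have [phi [sphi bphi Hphi]] := L1_density mg g0 mw4 w40 igw icut e2.
have mphi := measurable_smooth_fun sphi.
have [B B0 HB] := bounded_support_bounded sphi bphi.
have iphi := integrable_bounded_support mphi HB bphi.
have [r Hr] := bphi.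
(* All mollification radii are at most 1, so this cube contains the supports of all the mollified
   [phi]; B times its indicator dominates the sequence. *)
pose Q := [set v : V | forall i, `[(- (r + 1))%R, (r + 1)]%classic (v ord0 i)].
have mQ : measurable Q by exact: measurable_cube.
pose h v := `|g v - phi v|.
have mh : measurable_fun setT h by apply: measurableT_comp => //; exact: measurable_funB.
have h0 v : 0 <= h v by exact: normr_ge0.
have ih : lam.-integrable setT (EFin \o h).
  exact/integrable_EFin_norm/integrable_EFinB.
have mhw : measurable_fun setT (fun v => h v * w4 v) by exact: measurable_funM.
have [ihw Ihw] : lam.-integrable setT (EFin \o (fun v => h v * w4 v)) /\
    \int[lam]_v (h v * w4 v) <= eps / 2 / (K + 1).
  by apply: integrable_EFin_fin => // v; rewrite mulr_ge0.
have [||||||n Hn] := @weighted_limit _ _ lam w4 mw4 w40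
  (fun n => mollify (rho n) lam phi) phi (fun v => B * \1_Q v) (eps / 2).
- by move=> n; exact: (measurable_mollify (Hrho n)).
- exact: mphi.
- move=> n v; rewrite indicE; case: (boolP (v \in Q)) => [_|].
    rewrite mulr1; have [_ r0 _ _ _] := Hrho n.
    have ir := integrable_rho_row (Hrho n) v.
    rewrite -[B]mulr1 -(integral_rho_row (Hrho n) v) -RintegralZl//.
    apply: normr_Rintegral_le; last exact: integrable_EFinZ.
      by apply: measurable_funM => //; exact: (measurable_rho_shift (Hrho n)).
    by move=> y; rewrite normrM (ger0_norm (r0 _)) ler_wpM2r.
  move=> /negP nQ; rewrite mulr0 [mollify _ _ _ _](_ : _ = 0) ?normr0//.
  rewrite /mollify /Rintegral integral0_eq// => y _.
  have [->|/Hr H1] := eqVneq (phi y) 0; first by rewrite mul0r.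
  have [->|H2] := eqVneq (rho n (y - v)) 0; first by rewrite mulr0.
  have [_ _ _ _ /(_ _ H2) {}H2] := Hrho n.
  exfalso; apply: nQ; rewrite inE => j /=; rewrite in_itv/= -ler_norml.
  rewrite -[v ord0 j](subKr (y ord0 j)) (le_trans (ler_normB _ _))// lerD//.
  by have := H2 j; rewrite !mxE => /le_trans; apply.
- apply: (@integrable_bounded_support _ _ _ (B * (1 + (N%:R * `|r + 1|) ^+ 4))).
  + by apply: measurable_funM => //; apply: measurable_funM => //; exact: measurable_indic.
  + move=> v; rewrite -mulrA normrM (ger0_norm B0) ler_wpM2l// indicE.
    case: (boolP (v \in Q)) => [|_]; last first.
      by rewrite mul0r normr0 addr_ge0// exprn_ge0// mulr_ge0.
    rewrite inE => Qv; rewrite mul1r ger0_norm// lerD2l lerXn2r ?nnegrE ?enorm_ge0 ?mulr_ge0//.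
    rewrite (le_trans (enorm_le_sum _))//.
    apply: (@le_trans _ _ (\sum_(i < N) `|r + 1|)).
      apply: ler_sum => j _; have := Qv j; rewrite /= in_itv/= -ler_norml => /le_trans; apply.
      exact: ler_norm.
    by rewrite sumr_const card_ord mulr_natl.
  + exists (r + 1) => v; rewrite indicE; case: (boolP (v \in Q)) => [|_]; last first.
      by rewrite mulr0 mul0r eqxx.
    by rewrite inE => Qv _ j; have := Qv j; rewrite /= in_itv/= -ler_norml.
- by move=> v; exact: mollify_test_cvg.
- exact: e1.
exists n.
have [imhw Imhw] := mollify_weight_le (Hrho n) (delta1 n) h0 ih ihw.
have mg' := measurable_mollify (Hrho n) lam mg.
have mp' := measurable_mollify (Hrho n) lam mphi.
have mh' := measurable_mollify (Hrho n) lam mh.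
have mphw : measurable_fun setT (fun v => `|mollify (rho n) lam phi v - phi v| * w4 v).
  by apply: measurable_funM => //; apply: measurableT_comp => //; exact: measurable_funB.
apply: (@le_trans _ _ (\int[lam]_v ((mollify (rho n) lam h v * w4 v +
   h v * w4 v) + `|mollify (rho n) lam phi v - phi v| * w4 v)%:E)%E).
  apply: le_integral_EFin.
  - by apply: measurable_funM => //; apply: measurableT_comp => //; exact: measurable_funB.
  - apply: measurable_funD => //; apply: measurable_funD => //; exact: measurable_funM.
  - by move=> v; rewrite mulr_ge0.
  - move=> v; rewrite -!mulrDl ler_wpM2r//.
    have H : `|mollify (rho n) lam g v - mollify (rho n) lam phi v| <= mollify (rho n) lam h v.
      rewrite /mollify -RintegralB//; [|exact: (integrable_mollifier (Hrho n))..].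
      apply: normr_Rintegral_le; last exact: (integrable_mollifier (Hrho n)).
        by apply: measurable_funB; apply: measurable_funM => //; exact: (measurable_rho_shift (Hrho n)).
      by have [_ r0 _ _ _] := Hrho n; move=> y; rewrite -mulrBl normrM (ger0_norm (r0 _)).
    rewrite (_ : _ - g v = (mollify (rho n) lam g v - mollify (rho n) lam phi v) - (g v - phi v) +
      (mollify (rho n) lam phi v - phi v)); last by ring.
    rewrite (le_trans (ler_normD _ _))// lerD2r (le_trans (ler_normB _ _))// lerD2r//.
under eq_integral do rewrite EFinD.
rewrite ge0_integralD//; last 4 first.
- by move=> v _; rewrite lee_fin addr_ge0// mulr_ge0// (mollify_ge0 (Hrho n)).
- by apply/measurable_EFinP; apply: measurable_funD => //; exact: measurable_funM.
- by move=> v _; rewrite lee_fin mulr_ge0.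
- exact/measurable_EFinP.
rewrite [eps]splitr EFinD leeD//.
rewrite Rintegral_EFin; last exact: integrable_EFinD.
rewrite lee_fin RintegralD//.
have K1 : 0 < K + 1 by rewrite ltr_wpDl.
rewrite -[leRHS](divfK (lt0r_neq0 K1)) mulrDr mulr1 mulrC lerD//.
by rewrite (le_trans Imhw)// ler_wpM2l.
Qed.

End mollify_cvg.

Lemma FTC_le {R : realType} (F f : R -> R) :
  (forall t : R, is_derive t 1 F (f t)) -> continuous f ->
  (`|F 1 - F 0|%:E <= \int[lebesgue_measure]_(t in `[0%R, 1%R]) `|f t|%:E)%E.
Proof.
move=> dF cf.
have cF : continuous F.
  move=> t; apply/differentiable_continuous/derivable1_diffP.
  by have [] := dF t.
have cwf : {within `[(0 : R), 1], continuous f} by exact: continuous_subspaceT.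
have := @continuous_FTC2 R f F 0 1 ltr01 cwf.
rewrite -EFinB => H.
rewrite -abse_EFin -H; last 2 first.
- split; last 2 first.
  + by apply: cvg_at_right_filter; exact: cF.
  + by apply: cvg_at_left_filter; exact: cF.
  by move=> t _; have [] := dF t.
- by move=> t _; rewrite derive1E; have [] := dF t.
apply: (le_trans (le_abse_integral _ _ _)) => //.
by apply/measurable_EFinP; apply: measurable_funTS; exact: continuous_measurable_fun.
Qed.

(** * Derivatives of mollified measures along lines *)

Section derivative_along_line.
Context {R : realType} {N : nat}.
Notation V := 'rV[R]_N.
Notation lam := (lebesgue_row R N).

Lemma is_derive_line (f : V -> R) (z h : V) (t : R) :
  differentiable f (z + t *: h) ->
  is_derive t 1 (fun s : R => f (z + s *: h)) ('D_h f (z + t *: h)).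
Proof.
move=> df.
have E : (fun s : R => s^-1 *: (f (z + (s *: 1 + t) *: h) - f (z + t *: h))) =
    (fun s : R => s^-1 *: (f (s *: h + (z + t *: h)) - f (z + t *: h))).
  apply/funext => s; congr (_ *: (f _ - _)).
  by rewrite [s *: 1]mulr1 scalerDl addrCA.
have cv : derivable f (z + t *: h) h by exact: diff_derivable.
rewrite /derivable in cv.
apply: DeriveDef; first by rewrite /derivable /= E.
by rewrite /derive /= E.
Qed.

(** The complement of the closed cube is open, so near any of its points [rho] is identically 0. *)
Lemma partial_support (rho : V -> R) (delta : R) i :
  (forall v, rho v != 0 -> forall j, `|v ord0 j| <= delta) ->
  forall v, partial i rho v != 0 -> forall j, `|v ord0 j| <= delta.
Proof.
move=> H v; apply: contraNP => /existsNP[j /negP]; rewrite -ltNge => vj.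
apply/eqP; rewrite /partial (_ : 0 = 'D_(delta_mx ord0 i) (cst 0) v); last first.
  by rewrite derive_cst.
apply: near_eq_derive.
have cj : {for v, continuous (fun v : V => `|v ord0 j|)}.
  apply: continuous_comp; last exact: norm_continuous.
  exact: coord_continuous.
near=> y.
have yj : delta < `|y ord0 j| by near: y; exact: (cvgr_gt _ cj).
by apply/eqP; apply: contraTT yj => /H/(_ j); rewrite -leNgt.
Unshelve. all: by end_near. Qed.

Variables (mu : {measure set V -> \bar R}) (F : V -> R) (rho : V -> R) (delta : R).
Hypothesis iF : mu.-integrable setT (EFin \o F).
Hypothesis srho : measurable_smooth rho.
Hypothesis rs : forall v, rho v != 0 -> forall j, `|v ord0 j| <= delta.

Lemma integrable_smooth_shift (x : V) :
  mu.-integrable setT (EFin \o (fun y => F y * rho (y - x))).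
Proof.
have bs : bounded_support rho by exists delta.
have mF := integrableEFin_fun iF.
have [M M0 HM] := bounded_support_bounded srho bs.
apply: (le_integrable_EFin _ _ (integrable_EFinZ M (integrable_EFin_norm iF))).
  apply: measurable_funM => //.
  by apply: (measurableT_comp (measurable_smooth_fun srho)); exact: measurable_row_add.
by move=> y; rewrite normrM mulrC ler_wpM2r.
Qed.

Lemma smooth_derive (h : V) : measurable_smooth (fun v => 'D_h rho v) /\
  (forall v, 'D_h rho v != 0 -> forall j, `|v ord0 j| <= delta).
Proof.
have E : (fun v => 'D_h rho v) = fun v => \sum_i h ord0 i * partial i rho v.
  by apply/funext => v; apply: derive_partial; exact: measurable_smooth_diff.
split.
  rewrite E; apply: measurable_smooth_sum => i; apply: measurable_smoothM.
    exact: measurable_smooth_cst.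
  exact: measurable_smooth_partial.
move=> v; apply: contraNP => /existsNP[j /negP vj].
rewrite derive_partial; last exact: measurable_smooth_diff.
rewrite big1// => i _; have [->|/(partial_support rs)/(_ j)] := eqVneq (partial i rho v) 0.
  by rewrite mulr0.
by move=> H; rewrite H in vj.
Qed.

(** Along x - s h the argument y - x of [rho] moves by + s h, so no sign appears. Differentiation
    under the integral is dominated by |F| times the supremum of the derivative of [rho]. *)
Lemma is_derive_mollify_line (x h : V) (t : R) :
  is_derive t 1 (fun s : R => mollify rho mu F (x - s *: h))
    (\int[mu]_y (F y * 'D_h rho (y - (x - t *: h)))).
Proof.
have [sD sDs] := smooth_derive h.
have mF := integrableEFin_fun iF.
have bD : bounded_support (fun v => 'D_h rho v) by exists delta.
have [M M0 HM] := bounded_support_bounded sD bD.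
pose f (s : R) (y : V) := F y * rho (y - (x - s *: h)).
have dr (y : V) (s : R) : is_derive s 1 (fun s : R => rho (y - (x - s *: h))) ('D_h rho (y - (x - s *: h))).
  have E : (fun s : R => rho (y - (x - s *: h))) = (fun s : R => rho ((y - x) + s *: h)).
    by apply/funext => r; rewrite opprB addrA addrAC.
  rewrite E (_ : y - (x - s *: h) = (y - x) + s *: h); last by rewrite opprB addrA addrAC.
  by apply: is_derive_line; exact: measurable_smooth_diff.
have df (y : V) (s : R) : is_derive s 1 (f ^~ y) (F y * 'D_h rho (y - (x - s *: h))).
  exact: (@is_deriveZ R R R^o _ (F y) s 1 _ (dr y s)).
have d1 (s : R) (y : V) : (f ^~ y)^`()%classic s = F y * 'D_h rho (y - (x - s *: h)).
  by rewrite derive1E; have [_] := df y s.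
have It : `](t - 1), (t + 1)[%classic t by rewrite /= in_itv/=; lra.
have iG : mu.-integrable setT (EFin \o (fun y => M * `|F y|)).
  exact/integrable_EFinZ/integrable_EFin_norm.
have D := @derivable_under_integral R _ _ mu f setT measurableT t (t - 1) (t + 1) It
  (fun s _ => integrable_smooth_shift (x - s *: h))
  (fun s y _ _ => @ex_derive _ _ _ _ _ _ _ (df y s))
  (fun y => M * `|F y|) (fun y => mulr_ge0 M0 (normr_ge0 _)) iG.
have E := @differentiation_under_integral R _ _ mu f setT measurableT t (t - 1) (t + 1) It
  (fun s _ => integrable_smooth_shift (x - s *: h))
  (fun s y _ _ => @ex_derive _ _ _ _ _ _ _ (df y s))
  (fun y => M * `|F y|) (fun y => mulr_ge0 M0 (normr_ge0 _)) iG.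
have B (s : R) (y : V) : `](t - 1), (t + 1)[%classic s -> setT y ->
    `|partial1of2 f s y| <= M * `|F y|.
  by move=> _ _; rewrite /partial1of2 d1 normrM mulrC ler_wpM2r.
apply: DeriveDef; first exact: D B.
rewrite -derive1E (E B); apply: eq_Rintegral => y _; exact: d1.
Qed.

Lemma continuous_mollify_line (x h : V) :
  continuous (fun s : R => mollify rho mu F (x - s *: h)).
Proof.
move=> t; apply/differentiable_continuous/derivable1_diffP.
by have [] := is_derive_mollify_line x h t.
Qed.

End derivative_along_line.

Section shift_calculus.
Context {R : realType} {N : nat}.
Notation V := 'rV[R]_N.

Lemma derive_shift_arg (f : V -> R) (x h y : V) :
  'D_h (fun v => f (v - x)) y = 'D_h f (y - x).
Proof.
have E : (fun s : R => s^-1 *: (f (s *: h + y - x) - f (y - x))) =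
    (fun s : R => s^-1 *: (f (s *: h + (y - x)) - f (y - x))).
  by apply/funext => s; rewrite addrA.
by rewrite /derive /= E.
Qed.

Lemma measurable_smooth_shift (f : V -> R) (x : V) : measurable_smooth f ->
  measurable_smooth (fun v => f (v - x)).
Proof.
move=> Hf k; move: (Hf k) => {Hf}; elim: k f => [|k IH] f /= [df mf H].
  split => // [v|].
    by apply: (@differentiable_comp _ _ _ _ (fun v : V => v - x) f).
  by apply: (measurableT_comp mf); exact: measurable_row_add.
split => [v||i].
- by apply: (@differentiable_comp _ _ _ _ (fun v : V => v - x) f).
- by apply: (measurableT_comp mf); exact: measurable_row_add.
- rewrite (_ : partial _ _ = fun v => partial i f (v - x)); first exact: IH.
  by apply/funext => v; exact: derive_shift_arg.
Qed.

Lemma bounded_support_shift (f : V -> R) (x : V) : bounded_support f ->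
  bounded_support (fun v => f (v - x)).
Proof.
move=> [r Hr]; exists (r + enorm x) => v /Hr H j.
have -> : v ord0 j = (v - x) ord0 j + x ord0 j by rewrite !mxE subrK.
rewrite (le_trans (ler_normD _ _))// lerD//.
exact: normr_coord_le.
Qed.

End shift_calculus.

(** * Translation of products of mollified BV densities *)

Section BV_mollified.
Context {R : realType} {N : nat}.
Notation V := 'rV[R]_N.
Notation lam := (lebesgue_row R N).
Notation lam2 := (lebesgue_row R N \x lebesgue_row R N)%E.
Notation w4 := (@moment_weight R N 4).
Notation m := (@energy_weight R N).

(* The finite measures P i and Q i are the positive and negative parts of the
   i-th distributional derivative of g. *)
Definition BV_parts (g : V -> R) (P Q : 'I_N -> {finite_measure set V -> \bar R}) :=
  forall i phi, measurable_smooth phi -> bounded_support phi ->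
    \int[lam]_v (g v * partial i phi v) =
    - (\int[P i]_v phi v - \int[Q i]_v phi v).

Variables (g : V -> R) (P Q : 'I_N -> {finite_measure set V -> \bar R}).
Hypotheses (g0 : forall v, 0 <= g v) (ig : lam.-integrable setT (EFin \o g)).
Hypothesis HPQ : BV_parts g P Q.
Variables (rho : V -> R) (delta : R).
Hypothesis Hrho : mollifier delta rho.

Let srho : measurable_smooth rho. Proof. by case: Hrho. Qed.
Let rho0 v : 0 <= rho v. Proof. by case: Hrho. Qed.
Let rs v : rho v != 0 -> forall j, `|v ord0 j| <= delta.
Proof. by case: Hrho => _ _ _ _; apply. Qed.

Local Notation gn := (mollify rho lam g).

Definition mollified_variation i x : R :=
  mollify rho (P i) (cst 1) x + mollify rho (Q i) (cst 1) x.

Lemma mollified_variation_ge0 i x : 0 <= mollified_variation i x.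
Proof. by rewrite addr_ge0//; apply: (mollify_ge0 Hrho). Qed.

Lemma measurable_mollified_variation i :
  measurable_fun setT (mollified_variation i).
Proof. by apply: measurable_funD; apply: (measurable_mollify Hrho). Qed.

Lemma integrable_partial_shift i x :
  lam.-integrable setT (EFin \o (fun y => g y * partial i rho (y - x))).
Proof.
apply: (integrable_smooth_shift (delta := delta)) => //.
  exact: measurable_smooth_partial.
exact: partial_support rs.
Qed.

(** Testing the distributional derivative of g against y |-> rho (y - x) moves the derivative from
    the mollifier to the measures P i and Q i. *)
Lemma mollify_partial i x : `|mollify (partial i rho) lam g x| <= mollified_variation i x.
Proof.
have := @HPQ i (fun y => rho (y - x)) _ _.
rewrite /mollify (_ : \int[lam]_y (g y * partial i rho (y - x)) =
   \int[lam]_v (g v * partial i (fun y => rho (y - x)) v)); last first.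
  by apply: eq_Rintegral => y _; rewrite /partial derive_shift_arg.
move=> ->; last 2 first.
- exact: measurable_smooth_shift.
- by apply: bounded_support_shift; exists delta.
rewrite normrN (le_trans (ler_normB _ _))// /mollified_variation /mollify.
have E (mu : {measure set V -> \bar R}) : `|\int[mu]_v rho (v - x)| =
    \int[mu]_y (cst 1 y * rho (y - x)).
  rewrite ger0_norm; last exact: Rintegral_ge0.
  by apply: eq_Rintegral => y _; rewrite mul1r.
by rewrite !E.
Qed.

Lemma mollify_derive (h x : V) : `|mollify (fun v => 'D_h rho v) lam g x| <=
  \sum_i `|h ord0 i| * mollified_variation i x.
Proof.
rewrite (_ : mollify _ _ _ x = \sum_i h ord0 i * mollify (partial i rho) lam g x).
  rewrite (le_trans (ler_norm_sum _ _ _))//; apply: ler_sum => i _.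
  by rewrite normrM ler_wpM2l// mollify_partial.
have H (s : seq 'I_N) : \int[lam]_y (\sum_(i <- s) (h ord0 i * (g y * partial i rho (y - x)))) =
   \sum_(i <- s) h ord0 i * mollify (partial i rho) lam g x.
  elim: s => [|i s IH].
    rewrite big_nil; under eq_Rintegral do rewrite big_nil.
    by rewrite /Rintegral integral0.
  rewrite big_cons -IH; under eq_Rintegral do rewrite big_cons.
  rewrite RintegralD//.
  - by rewrite RintegralZl//; exact: integrable_partial_shift.
  - by apply: integrable_EFinZ; exact: integrable_partial_shift.
  - apply: integrable_EFin_sum => j; apply: integrable_EFinZ.
    exact: integrable_partial_shift.
rewrite -H /mollify; apply: eq_Rintegral => y _.
rewrite derive_partial; last exact: measurable_smooth_diff.
by rewrite mulr_sumr; apply: eq_bigr => i _; rewrite mulrCA.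
Qed.

(** The bound depends on [rho]; it gives integrability of x |-> gn (x + u) gn x for fixed u and
    never enters a final constant. *)
Lemma mollify_bounded : exists2 M : R, 0 <= M & forall x, gn x <= M.
Proof.
have [M M0 HM] := mollifier_bounded Hrho.
exists (M * \int[lam]_y g y) => [|x]; first by rewrite mulr_ge0// Rintegral_ge0.
rewrite -RintegralZl//; apply: le_Rintegral => //.
- exact: (integrable_mollifier Hrho).
- exact: integrable_EFinZ.
- by move=> y _; rewrite mulrC ler_wpM2r//; exact: le_trans (ler_norm _) (HM _).
Qed.

Let gn0 x : 0 <= gn x. Proof. exact: (mollify_ge0 Hrho). Qed.

Let mgn : measurable_fun setT gn.
Proof. apply: (measurable_mollify Hrho); exact: integrableEFin_fun ig. Qed.

Section line.
Variables (u h : V).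

(** Majorant, through the Leibniz rule, of the derivative of x |-> gn (x + u) gn x in the direction
    h. *)
Definition line_variation (x : V) : R :=
  \sum_i `|h ord0 i| * (gn (x + u) * mollified_variation i x +
    gn x * mollified_variation i (x + u)).

Lemma line_variation_ge0 x : 0 <= line_variation x.
Proof.
apply: sumr_ge0 => i _; rewrite mulr_ge0// addr_ge0// mulr_ge0//;
  exact: mollified_variation_ge0.
Qed.

Lemma measurable_line_variation : measurable_fun setT line_variation.
Proof.
apply: measurable_sum => i; apply: measurable_funM => //.
have ma := @measurable_row_add R N u.
have mv := measurable_mollified_variation i.
apply: measurable_funD.
  exact: measurable_funM (measurableT_comp mgn ma) mv.
exact: measurable_funM mgn (measurableT_comp mv ma).
Qed.

Lemma line_variation_le (x : V) :
  (`|gn (x - h + u) * gn (x - h) - gn (x + u) * gn x|%:E <=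
   \int[lebesgue_measure]_(t in `[0%R, 1%R]) (line_variation (x - (t : R) *: h))%:E)%E.
Proof.
pose Dg := mollify (fun v => 'D_h rho v) lam g.
have [sD sDs] := smooth_derive srho rs h.
pose F (t : R) := gn (x + u - t *: h) * gn (x - t *: h).
pose f (t : R) := gn (x + u - t *: h) * Dg (x - t *: h) +
  gn (x - t *: h) * Dg (x + u - t *: h).
have dF (t : R) : is_derive t 1 F (f t).
  have d1 := is_derive_mollify_line ig srho rs (x + u) h t.
  have d2 := is_derive_mollify_line ig srho rs x h t.
  exact: (is_deriveM d1 d2).
have cf : continuous f.
  have c1 z := @continuous_mollify_line R N lam g rho delta ig srho rs z h.
  have c2 z := @continuous_mollify_line R N lam g _ delta ig sD sDs z h.
  by move=> t; exact: cvgD (cvgM (c1 _ t) (c2 _ t)) (cvgM (c1 _ t) (c2 _ t)).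
have := FTC_le dF cf.
rewrite {1}/F !scale1r (_ : F 0 = gn (x + u) * gn x); last by rewrite /F !scale0r !subr0.
rewrite (_ : x + u - h = x - h + u); last by rewrite addrAC.
move=> /le_trans; apply.
have mf : measurable_fun setT f by exact: continuous_measurable_fun.
have ml : measurable_fun setT (fun t : R => line_variation (x - t *: h)).
  apply: (measurableT_comp measurable_line_variation).
  by apply: measurable_rowB => //; exact: measurable_rowZ.
apply: ge0_le_integral => //.
- by apply/measurable_EFinP; apply: measurable_funTS; exact: measurableT_comp.
- by apply/measurable_EFinP; apply: measurable_funTS.
move=> t _; rewrite lee_fin /f /line_variation (le_trans (ler_normD _ _))//.
rewrite (_ : \sum_i _ = gn (x + u - t *: h) * (\sum_i `|h ord0 i| * mollified_variation i (x - t *: h)) +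
  gn (x - t *: h) * (\sum_i `|h ord0 i| * mollified_variation i (x + u - t *: h))); last first.
  rewrite !mulr_sumr -big_split; apply: eq_bigr => i _ /=.
  rewrite (_ : x - t *: h + u = x + u - t *: h); last by rewrite addrAC.
  by ring.
have H1 := mollify_derive h (x - t *: h).
have H2 := mollify_derive h (x + u - t *: h).
have aux (a b c d A B : R) : 0 <= a -> 0 <= c -> `|b| <= A -> `|d| <= B ->
    `|a * b| + `|c * d| <= a * A + c * B.
  move=> a0 c0 bA dB; rewrite !normrM (ger0_norm a0) (ger0_norm c0).
  by rewrite lerD// ler_wpM2l.
exact: (aux _ _ _ _ _ _ (gn0 _) (gn0 _) H1 H2).
Qed.

Variables (phi : V -> R) (w : V) (r : R).
Hypotheses (mphi : measurable_fun setT phi) (phim : forall v, `|phi v| <= m v).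
Hypothesis wr : forall t : R, 0 <= t <= 1 -> enorm (w + t *: h) <= r.

Lemma shifted_weight_le (t : R) (x : V) : 0 <= t <= 1 ->
  `|phi (x + t *: h + w)| <= 1 + (enorm x + r) ^+ 2.
Proof.
move=> t01; rewrite (le_trans (phim _))// lerD2l.
have r0 : 0 <= r := le_trans (enorm_ge0 _) (wr t01).
rewrite lerXn2r ?nnegrE ?enorm_ge0 ?addr_ge0 ?enorm_ge0//.
rewrite -addrA (le_trans (ler_enormD _ _))// lerD2l addrC.
exact: wr.
Qed.

(** The increment is an integral over the segment from x to x - h. After Tonelli, x is translated by
    t h for each fixed t: the variation is then taken at x itself, and the shift moves onto [phi],
    where [wr] bounds it uniformly in t. *)
Lemma shift_estimate :
  (\int[lam]_x (`|phi (x + w)| *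
     `|gn (x - h + u) * gn (x - h) - gn (x + u) * gn x|)%:E <=
   \int[lam]_x ((1 + (enorm x + r) ^+ 2) * line_variation x)%:E)%E.
Proof.
have ml := measurable_line_variation.
have l0 := line_variation_ge0.
pose I01 : set R := `[0%R, 1%R]%classic.
pose G (p : V * R) : \bar R :=
  (`|phi (p.1 + w)| * (line_variation (p.1 - p.2 *: h) * \1_I01 p.2))%:E.
have mG : measurable_fun setT G.
  apply/measurable_EFinP; apply: measurable_funM.
    apply: measurableT_comp => //; apply: (measurableT_comp mphi).
    by apply: measurable_row_addf => //; exact: measurable_cst.
  apply: measurable_funM.
    apply: (measurableT_comp ml); apply: measurable_rowB; first exact: measurable_fst.
    by apply: measurable_rowZ; [exact: measurable_snd|exact: measurable_cst].
  apply: (measurableT_comp (f := \1_I01 : R -> R)) measurable_snd.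
  by apply: measurable_indic; exact: measurable_itv.
have G0 p : (0 <= G p)%E by rewrite lee_fin !mulr_ge0.
have mW : measurable_fun setT (fun x : V => 1 + (enorm x + r) ^+ 2).
  apply: measurable_funD => //; apply: measurable_funX; apply: measurable_funD => //.
  exact: measurable_enorm.
apply: (@le_trans _ _ (\int[lam]_x \int[lebesgue_measure]_t G (x, t))%E).
  apply: ge0_le_integral => //.
  - apply/measurable_EFinP; apply: measurable_funM.
      by apply: measurableT_comp => //; apply: (measurableT_comp mphi); exact: measurable_row_add.
    apply: measurableT_comp => //.
    have ma (z : V) : measurable_fun setT (fun x : V => gn (x + z)).
      by apply: (measurableT_comp mgn); exact: measurable_row_add.
    have mb (z z' : V) : measurable_fun setT (fun x : V => gn (x + z + z')).
      apply: (measurableT_comp (ma z')); exact: measurable_row_add.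
    by apply: measurable_funB; apply: measurable_funM.
  - exact: (@measurable_fun_fubini_tonelli_F _ _ _ _ _ lebesgue_measure G mG G0).
  - move=> x _; rewrite /G /=.
    under eq_integral do rewrite EFinM.
    have mli : measurable_fun setT (fun t : R => (line_variation (x - t *: h) * \1_I01 t)).
      apply: measurable_funM.
        apply: (measurableT_comp ml).
        by apply: measurable_rowB => //; exact: measurable_rowZ.
      by apply: measurable_indic; exact: measurable_itv.
    rewrite ge0_integralZl//; last 2 first.
    + exact/measurable_EFinP.
    + by move=> t _; rewrite lee_fin mulr_ge0.
    rewrite EFinM lee_wpmul2l// (le_trans (line_variation_le x))//.
    rewrite [leLHS]integral_mkcond le_eqVlt; apply/orP; left; apply/eqP.
    apply: eq_integral => t _; rewrite /patch indicE.
    by case: (boolP (t \in I01)); rewrite ?mulr1 ?mulr0.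
have fub : (\int[lam]_x \int[lebesgue_measure]_t G (x, t) =
    \int[lebesgue_measure]_t \int[lam]_x G (x, t))%E.
  exact: (@fubini_tonelli _ _ _ _ _ lam lebesgue_measure G mG G0).
rewrite fub.
set A := (\int[lam]_x _)%E.
have A0 : (0 <= A)%E.
  by apply: integral_ge0 => x _; rewrite lee_fin mulr_ge0// addr_ge0// sqr_ge0.
apply: (@le_trans _ _ (\int[lebesgue_measure]_t (A * (\1_I01 t)%:E))%E).
  apply: ge0_le_integral => //.
  - by move=> t _; exact: integral_ge0.
  - exact: (@measurable_fun_fubini_tonelli_G _ _ _ _ _ lam G mG G0).
  - apply: measurable_funeM; apply/measurable_EFinP.
    by apply: measurable_indic; exact: measurable_itv.
  - move=> t _; rewrite /G /=.
    rewrite indicE; case: (boolP (t \in I01)) => [|_]; last first.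
      rewrite mule0; under eq_integral do rewrite !mulr0.
      by rewrite integral0.
    rewrite inE /I01 /= in_itv/= => t01; rewrite mule1.
    pose G' (x : V) : \bar R := (`|phi (x + t *: h + w)| * line_variation x)%:E.
    rewrite [X in (X <= _)%E](_ : _ = \int[lam]_x G' (x - t *: h)%R)%E; last first.
      by apply: eq_integral => x _; rewrite /G' subrK mulr1.
    have mp : measurable_fun setT (fun x : V => `|phi (x + t *: h + w)|).
      apply: measurableT_comp => //; apply: (measurableT_comp mphi).
      by apply: measurable_row_addf => //; exact: measurable_row_add.
    rewrite ge0_integral_row_shift; last 2 first.
    + by apply/measurable_EFinP; exact: measurable_funM.
    + by move=> x; rewrite lee_fin mulr_ge0.
    apply: le_integral_EFin; do ?exact: measurable_funM.
    + by move=> x; rewrite mulr_ge0.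
    + by move=> x; rewrite ler_wpM2r// shifted_weight_le.
rewrite ge0_integralZl//; last first.
  by apply/measurable_EFinP; apply: measurable_indic; exact: measurable_itv.
rewrite integral_indic//= ?setIT; last exact: measurable_itv.
by rewrite lebesgue_measure_itv/= lte_fin ltr01 -EFinB subr0 mule1.
Qed.

End line.
End BV_mollified.

(** * Transport of the collision kernel *)

Section iterated.
Context d1 d2 (X : measurableType d1) (Y : measurableType d2) (R : realType).
Variables (m1 : {sigma_finite_measure set X -> \bar R})
  (m2 : {sigma_finite_measure set Y -> \bar R}).
Variable F : X * Y -> \bar R.
Hypothesis iF : (m1 \x m2)%E.-integrable setT F.

Lemma abse_integral_prod1_le (B : X -> \bar R) :
  measurable_fun setT B -> (forall x, `|\int[m2]_y F (x, y)| <= B x)%E ->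
  (`|\int[(m1 \x m2)%E]_p F p| <= \int[m1]_x B x)%E.
Proof.
move=> mB FB.
have iG := integrable_fubini_F iF.
rewrite -(integral12_prod_meas1 iF).
apply: le_trans (le_abse_integral _ _ _) _ => //; first exact: measurable_int iG.
apply: ge0_le_integral => //.
- by apply: measurableT_comp => //; exact: measurable_int iG.
- by move=> z _; exact: FB.
Qed.

Lemma abse_integral_prod2_le (B : Y -> \bar R) :
  measurable_fun setT B -> (forall y, `|\int[m1]_x F (x, y)| <= B y)%E ->
  (`|\int[(m1 \x m2)%E]_p F p| <= \int[m2]_y B y)%E.
Proof.
move=> mB FB.
have mG := measurable_fubini_G iF.
rewrite -(integral21_prod_meas1 iF).
apply: le_trans (le_abse_integral _ _ _) _ => //.
apply: ge0_le_integral => //.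
- exact: measurableT_comp.
- by move=> z _; exact: FB.
Qed.

End iterated.

Section transport.
Context {R : realType} {N : nat}.
Notation V := 'rV[R]_N.
Notation S := (@sphere_measure R N).
Notation lam := (lebesgue_row R N).
Notation lam2 := (lebesgue_row R N \x lebesgue_row R N)%E.
Notation w4 := (@moment_weight R N 4).
Notation m := (@energy_weight R N).

Lemma integral_row_shift (a : V) (F : V -> R) : measurable_fun setT F ->
  \int[lam]_v F (v + a) = \int[lam]_v F v.
Proof.
move=> mF; rewrite /Rintegral; congr fine; apply/esym.
apply: (@integral_measure_map _ _ _ _ _ lam lam (fun v : V => v + a) (EFin \o F)).
- exact: measurable_row_add.
- by move=> A mA; exact: lebesgue_row_shift.
- exact/measurable_EFinP.
Qed.

(** With z = (1 + a) (1 + b) the left side is at most z^2 (2 z)^2 = 4 (1 + a)^4 (1 + b)^4, and (1 +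
    x)^4 <= 8 (1 + x^4); hence 256 = 4 * 8 * 8. *)
Lemma relative_weight_le (p : V * V) :
  (1 + enorm (p.1 - p.2)) ^+ 2 * (1 + (enorm p.2 + enorm (p.1 - p.2)) ^+ 2) <=
  256 * (w4 p.1 * w4 p.2).
Proof.
have := ler_enormB p.1 p.2.
rewrite /moment_weight; move: (enorm_ge0 p.1) (enorm_ge0 p.2) (enorm_ge0 (p.1 - p.2)).
move: (enorm p.1) (enorm p.2) (enorm (p.1 - p.2)) => a b c a0 b0 c0 cab.
pose z := (1 + a) * (1 + b).
have ab0 : 0 <= a * b by rewrite mulr_ge0.
have z0 : 0 <= z by rewrite mulr_ge0// addr_ge0.
have h1 : 1 + c <= z by rewrite /z; lra.
have h2 : 1 + (b + c) ^+ 2 <= (2 * z) ^+ 2.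
  apply: (@le_trans _ _ ((1 + b + c) ^+ 2)).
    rewrite -addrA [leRHS]sqrrD expr1n -addrA lerD2l lerDr.
    by rewrite mulrn_wge0// mul1r addr_ge0.
  by rewrite lerXn2r ?nnegrE//; [lra|lra|rewrite /z; lra].
have h3 : (1 + c) ^+ 2 <= z ^+ 2 by rewrite lerXn2r ?nnegrE//; lra.
apply: (le_trans (ler_pM _ _ h3 h2)).
- exact: sqr_ge0.
- by rewrite addr_ge0// sqr_ge0.
have H (x : R) : 0 <= x -> (1 + x) ^+ 4 <= 8 * (1 + x ^+ 4).
  move=> x0.
  have -> : (1 + x) ^+ 4 = ((1 + x) ^+ 2) ^+ 2 by rewrite -exprM.
  have -> : x ^+ 4 = (x ^+ 2) ^+ 2 by rewrite -exprM.
  have E1 : (1 + x) ^+ 2 <= 2 * (1 + x ^+ 2).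
    have := sqr_ge0 (1 - x); rewrite !sqrrD sqrrN; lra.
  have E2 : (2 * (1 + x ^+ 2)) ^+ 2 <= 8 * (1 + (x ^+ 2) ^+ 2).
    have := sqr_ge0 (1 - x ^+ 2); rewrite exprMn !sqrrD sqrrN; lra.
  apply: le_trans E2; rewrite lerXn2r ?nnegrE ?sqr_ge0// mulr_ge0// addr_ge0//.
  exact: sqr_ge0.
have -> : z ^+ 2 * (2 * z) ^+ 2 = 4 * ((1 + a) ^+ 4 * (1 + b) ^+ 4) by rewrite /z; ring.
have := ler_pM _ _ (H _ a0) (H _ b0).
by move=> /(_ (exprn_ge0 _ _) (exprn_ge0 _ _)) => /(_ _ _) H'; lra.
Qed.

Variables (k : V * V -> R) (W H : V * V -> V) (phi : V -> R) (M d : R).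
Hypotheses (mk : measurable_fun setT k) (mW : measurable_fun setT W)
  (mH : measurable_fun setT H) (mphi : measurable_fun setT phi)
  (phim : forall v, `|phi v| <= m v) (M0 : 0 <= M) (d0 : 0 <= d).
Hypotheses (k0 : forall q, 0 <= k q) (kM : forall q, k q <= M * enorm q.1)
  (kW : forall q t, k q != 0 -> 0 <= t <= 1 -> enorm (W q + t *: H q) <= enorm q.1)
  (kH : forall q, k q != 0 -> enorm (H q) <= d * enorm q.1).

(** [W] and [W] + [H] are two displacements from vs to an outgoing velocity, functions of the
    relative velocity and the angle. They will come from two restitution coefficients, with [k] the
    collision kernel. *)
Definition transport_diff (p : V * V) (s : V) : R :=
  (phi (p.2 + H (p.1 - p.2, s) + W (p.1 - p.2, s)) - phi (p.2 + W (p.1 - p.2, s))) *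
  k (p.1 - p.2, s).

Lemma transport_weight_le (x u s : V) : k (u, s) != 0 ->
  `|phi (x + H (u, s) + W (u, s))| <= 1 + (enorm x + enorm u) ^+ 2 /\
  `|phi (x + W (u, s))| <= 1 + (enorm x + enorm u) ^+ 2.
Proof.
move=> kus; split.
  have := @shifted_weight_le R N (H (u, s)) phi (W (u, s)) (enorm u) phim
     (fun t => @kW (u, s) t kus) 1 x _.
  by rewrite scale1r; apply; rewrite ler01 lexx.
have := @shifted_weight_le R N (H (u, s)) phi (W (u, s)) (enorm u) phim
   (fun t => @kW (u, s) t kus) 0 x _.
by rewrite scale0r addr0; apply; rewrite ler01 lexx.
Qed.

(** Crude, with nothing gained from a small [H]: two values of [phi] give 2 * 256. It serves
    integrability and the passage to the limit in g, while the smallness comes from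
    [transport_bound]. *)
Lemma transport_diff_le p s : `|transport_diff p s| <= 512 * M * (w4 p.1 * w4 p.2).
Proof.
have ww : 0 <= w4 p.1 * w4 p.2 by rewrite mulr_ge0// moment_weight_ge0.
rewrite /transport_diff; have [->|kus] := eqVneq (k (p.1 - p.2, s)) 0.
  by rewrite mulr0 normr0; exact: mulr_ge0 (mulr_ge0 (ler0n _ _) M0) ww.
have [H1 H2] := transport_weight_le p.2 kus.
rewrite normrM (ger0_norm (k0 _)).
have := relative_weight_le p; have := kM (p.1 - p.2, s) => /=.
have := ler_normB (phi (p.2 + H (p.1 - p.2, s) + W (p.1 - p.2, s))) (phi (p.2 + W (p.1 - p.2, s))).
have := k0 (p.1 - p.2, s); have := enorm_ge0 (p.1 - p.2).
move: H1 H2 ww.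
set c := enorm (p.1 - p.2); set A := `|phi _|; set B := `|phi _|; set D := `|_ - _|.
set K := k _; set w := w4 p.1 * w4 p.2; set z := 1 + _ ^+ 2.
move=> H1 H2 w0 c0 K0 DAB Kc czw.
have z0 : 0 <= z by rewrite addr_ge0// sqr_ge0.
have Dz : D <= 2 * z by lra.
have c1 : c <= (1 + c) ^+ 2 by rewrite sqrrD expr1n; have := sqr_ge0 c; lra.
apply: (@le_trans _ _ (2 * z * (M * c))).
  by rewrite ler_pM// /D.
rewrite (_ : 2 * z * (M * c) = 2 * M * (c * z)); last by ring.
rewrite (_ : 512 * M * w = 2 * M * (256 * w)); last by ring.
rewrite ler_wpM2l ?mulr_ge0//; apply: le_trans czw.
by rewrite ler_wpM2r.
Qed.

Lemma measurable_transport_diff d' (X : measurableType d') (f : X -> V * V) (h : X -> V) :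
  measurable_fun setT f -> measurable_fun setT h ->
  measurable_fun setT (fun x => transport_diff (f x) (h x)).
Proof.
move=> /measurable_fun_pairP[mf1 mf2] mh.
have mq : measurable_fun setT (fun x => ((f x).1 - (f x).2, h x)).
  by apply/measurable_fun_pairP; split => //; exact: measurable_rowB.
have mWq := measurableT_comp mW mq; have mHq := measurableT_comp mH mq.
apply: measurable_funM; last exact: measurableT_comp mk mq.
apply: measurable_funB; apply: (measurableT_comp mphi).
  by apply: measurable_row_addf => //; exact: measurable_row_addf.
exact: measurable_row_addf.
Qed.

Definition transport (p : V * V) : R := \int[S]_s transport_diff p s.

Lemma integrable_transport_diff p : S.-integrable setT (EFin \o transport_diff p).
Proof.
apply: (le_integrable_EFin _ (transport_diff_le p)).
  by apply: measurable_transport_diff => //; exact: measurable_cst.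
exact: finite_measure_integrable_cst.
Qed.

Lemma measurable_transport : measurable_fun setT transport.
Proof.
apply: (@measurable_Rintegral_param _ _ _ _ _ S (fun q => transport_diff q.1 q.2)).
by apply: measurable_transport_diff; [exact: measurable_fst|exact: measurable_snd].
Qed.

Lemma transport_le p : `|transport p| <= 512 * M * fine (S setT) * (w4 p.1 * w4 p.2).
Proof.
rewrite mulrAC -Rintegral_cst//.
apply: normr_Rintegral_le.
- by apply: measurable_transport_diff => //; exact: measurable_cst.
- exact: transport_diff_le.
- exact: finite_measure_integrable_cst.
Qed.

End transport.

(* The library declares the product of sigma-finite measures as a sigma-finite
   measure only when the factors are sub-probabilities. *)
Section product_sigma_finite.
Context d1 d2 (X : measurableType d1) (Y : measurableType d2) (R : realType).
Variables (m1 : {sigma_finite_measure set X -> \bar R})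
  (m2 : {sigma_finite_measure set Y -> \bar R}).

Let product_sigma_finiteT : sigma_finite setT (m1 \x m2)%E.
Proof.
have /sigma_finiteP[F [FT ndF Foo]] := sigma_finiteT m1.
have /sigma_finiteP[G [GT ndG Goo]] := sigma_finiteT m2.
exists (fun k => F k `*` G k).
  rewrite -setXTT FT GT; apply/seteqP; split => -[x y] /=.
    move=> [[i _ Fx] [j _ Gy]]; exists (maxn i j) => //; split => /=.
      by move: x Fx; exact/subsetPset/ndF/leq_maxl.
    by move: y Gy; exact/subsetPset/ndG/leq_maxr.
  by move=> [k _ [/= Fx Gy]]; split; exists k.
move=> k; have [mF Fk] := Foo k; have [mG Gk] := Goo k; split.
  exact: measurableX.
by rewrite product_measure1E// lte_mul_pinfty// ge0_fin_numE.
Qed.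

Definition product_sigma_finite : {sigma_finite_measure set (X * Y)%type -> \bar R} :=
  HB.pack (m1 \x m2)%E (Measure_isSigmaFinite.Build _ _ _ (m1 \x m2)%E product_sigma_finiteT).

End product_sigma_finite.

(** * The transport estimate for mollified densities *)

Section transport_estimate.
Context {R : realType} {N : nat}.
Notation V := 'rV[R]_N.
Notation S := (@sphere_measure R N).
Notation lam := (lebesgue_row R N).
Notation lam2 := (lebesgue_row R N \x lebesgue_row R N)%E.
Notation w4 := (@moment_weight R N 4).
Notation m := (@energy_weight R N).

Variables (k : V * V -> R) (W H : V * V -> V) (phi : V -> R) (M d : R).
Hypotheses (mk : measurable_fun setT k) (mW : measurable_fun setT W)
  (mH : measurable_fun setT H) (mphi : measurable_fun setT phi)
  (phim : forall v, `|phi v| <= m v) (M0 : 0 <= M) (d0 : 0 <= d).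
Hypotheses (k0 : forall q, 0 <= k q) (kM : forall q, k q <= M * enorm q.1)
  (kW : forall q t, k q != 0 -> 0 <= t <= 1 -> enorm (W q + t *: H q) <= enorm q.1)
  (kH : forall q, k q != 0 -> enorm (H q) <= d * enorm q.1).

Local Notation TD := (transport_diff k W H phi).

Let w40 (v : V) : 0 <= w4 v. Proof. exact: moment_weight_ge0. Qed.

Lemma quadratic_shift_le (x : V) (r : R) : 0 <= r ->
  1 + (enorm x + r) ^+ 2 <= (3 + 2 * r ^+ 2) * w4 x.
Proof.
rewrite /moment_weight; have := enorm_ge0 x; move: (enorm x) => a a0 r0.
have -> : a ^+ 4 = (a ^+ 2) ^+ 2 by rewrite -exprM.
have h1 := sqr_ge0 (a - r); have h2 := sqr_ge0 (1 - a ^+ 2).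
have h3 : 0 <= r ^+ 2 * (a ^+ 2) ^+ 2 by rewrite mulr_ge0 ?sqr_ge0.
have h4 := sqr_ge0 (a ^+ 2).
rewrite sqrrD; rewrite !sqrrD !sqrrN in h1 h2; lra.
Qed.

Section mollified.
Variables (g : V -> R) (P Q : 'I_N -> {finite_measure set V -> \bar R}).
Hypotheses (g0 : forall v, 0 <= g v) (ig : lam.-integrable setT (EFin \o g)).
Hypothesis HPQ : BV_parts g P Q.
Variables (rho : V -> R) (delta : R).
Hypothesis Hrho : mollifier delta rho.
Local Notation gn := (mollify rho lam g).
Local Notation mv := (mollified_variation P Q rho).
Hypothesis ignw : lam.-integrable setT (EFin \o (fun v => gn v * w4 v)).
Hypothesis imvw : forall i, lam.-integrable setT (EFin \o (fun v => mv i v * w4 v)).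

Let gn0 x : 0 <= gn x. Proof. exact: (mollify_ge0 Hrho). Qed.

Let mgn : measurable_fun setT gn.
Proof. apply: (measurable_mollify Hrho); exact: integrableEFin_fun ig. Qed.

Let mvt (x : V) : R := \sum_i mv i x.

Let mvt0 x : 0 <= mvt x.
Proof. by apply: sumr_ge0 => i _; exact: mollified_variation_ge0 Hrho i x. Qed.

Let mmvt : measurable_fun setT mvt.
Proof. by apply: measurable_sum => i; exact: (measurable_mollified_variation _ _ Hrho). Qed.

Let imvtw : lam.-integrable setT (EFin \o (fun v => mvt v * w4 v)).
Proof.
rewrite (_ : _ \o _ = EFin \o (fun v => \sum_i (mv i v * w4 v))); last first.
  by apply/funext => v /=; rewrite /mvt mulr_suml.
exact: integrable_EFin_sum.
Qed.

Lemma line_variation_le_sum (u h x : V) (r : R) : enorm h <= r ->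
  line_variation g P Q rho u h x <= r * (gn (x + u) * mvt x + gn x * mvt (x + u)).
Proof.
move=> hr; rewrite /line_variation /mvt !mulr_sumr -big_split mulr_sumr.
apply: ler_sum => i _ /=; apply: ler_wpM2r.
  by rewrite addr_ge0// mulr_ge0//; exact: mollified_variation_ge0 Hrho i _.
exact: le_trans (normr_coord_le _ _) hr.
Qed.

Let F (s : V) (p : V * V) : R := gn p.1 * gn p.2 * TD p s.

Let mF s : measurable_fun setT (F s).
Proof.
apply: measurable_funM.
  by apply: measurable_funM; [exact: measurableT_comp mgn measurable_fst|
    exact: measurableT_comp mgn measurable_snd].
by apply: measurable_transport_diff => //; exact: measurable_cst.
Qed.

Let F_le s p : `|F s p| <= 512 * M * ((gn p.1 * w4 p.1) * (gn p.2 * w4 p.2)).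
Proof.
rewrite /F normrM ger0_norm; last by rewrite mulr_ge0.
rewrite (_ : 512 * M * _ = gn p.1 * gn p.2 * (512 * M * (w4 p.1 * w4 p.2))); last by ring.
rewrite ler_wpM2l//; first by rewrite mulr_ge0.
exact: transport_diff_le.
Qed.

Let iww : lam2.-integrable setT
  (EFin \o (fun p => (gn p.1 * w4 p.1) * (gn p.2 * w4 p.2))).
Proof.
by have [] := integrable_prod (fun x => mulr_ge0 (gn0 x) (w40 x))
  (fun x => mulr_ge0 (gn0 x) (w40 x)) ignw ignw.
Qed.

Let iF s : lam2.-integrable setT (EFin \o F s).
Proof. apply: (le_integrable_EFin (mF s) (F_le s)); exact: integrable_EFinZ. Qed.

(** For fixed (u, s) the vectors [W] and [H] are constant, so the difference of the two values of
    [phi] is exchanged by translation for a difference of the products of densities, to which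
    [shift_estimate] applies. *)
Lemma transport_line_le (u s : V) :
  (`|\int[lam]_x (F s (x + u, x))%:E| <= \int[lam]_x (k (u, s) *
     ((1 + (enorm x + enorm u) ^+ 2) * line_variation g P Q rho u (H (u, s)) x))%:E)%E.
Proof.
have lv0 x := line_variation_ge0 P Q g0 Hrho u (H (u, s)) x.
have rhs0 x : 0 <= (1 + (enorm x + enorm u) ^+ 2) * line_variation g P Q rho u (H (u, s)) x.
  by rewrite mulr_ge0// addr_ge0// sqr_ge0.
have EF x : F s (x + u, x) = k (u, s) * (gn (x + u) * gn x *
    (phi (x + H (u, s) + W (u, s)) - phi (x + W (u, s)))).
  by rewrite /F /transport_diff /= [x + u]addrC addrK; ring.
have [kus|kus] := eqVneq (k (u, s)) 0.
  under eq_integral do rewrite EF kus mul0r.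
  rewrite integral0 abse0; apply: integral_ge0 => x _.
  by rewrite lee_fin mulr_ge0.
set h := H (u, s); set w := W (u, s).
(* Needed to integrate the two halves of the difference separately. *)
have [B B0 HB] := mollify_bounded g0 ig Hrho.
have mgu : measurable_fun setT (fun x : V => gn (x + u)).
  by apply: (measurableT_comp mgn); exact: measurable_row_add.
have mph (z : V) : measurable_fun setT (fun x : V => phi (x + z)).
  by apply: (measurableT_comp mphi); exact: measurable_row_add.
pose c := (3 + 2 * enorm u ^+ 2).
have wle (x : V) := @transport_weight_le R N k W H phi phim kW x u s kus.
have ile (psi : V -> R) : measurable_fun setT psi ->
    (forall x, `|psi x| <= 1 + (enorm x + enorm u) ^+ 2) ->
    lam.-integrable setT (EFin \o (fun x => gn (x + u) * gn x * psi x)).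
  move=> mpsi psile.
  apply: (le_integrable_EFin (g := fun x => B * c * (gn x * w4 x))).
  - by apply: measurable_funM => //; exact: measurable_funM.
  - move=> x; rewrite !normrM !(ger0_norm (gn0 _)).
    rewrite (_ : B * c * (gn x * w4 x) = B * gn x * (c * w4 x)); last by ring.
    apply: ler_pM; rewrite ?mulr_ge0//; first by rewrite ler_wpM2r.
    by apply: le_trans (psile x) _; apply: quadratic_shift_le; exact: enorm_ge0.
  - exact: integrable_EFinZ.
have i1 : lam.-integrable setT (EFin \o (fun x => gn (x + u) * gn x * phi (x + h + w))).
  apply: ile; last by move=> x; have [] := wle x.
  by under eq_fun do rewrite -addrA; exact: mph.
have i2 : lam.-integrable setT (EFin \o (fun x => gn (x + u) * gn x * phi (x + w))).
  by apply: ile => // x; have [] := wle x.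
pose A x := gn (x + u) * gn x * phi (x + h + w).
have mA : measurable_fun setT A := integrableEFin_fun i1.
have iA : lam.-integrable setT (EFin \o (fun x => A (x - h))).
  apply: (@integrable_measure_map _ _ _ _ _ lam lam (fun x : V => x - h) (EFin \o A)) => //.
    exact: measurable_row_add.
  by move=> X mX; exact: lebesgue_row_shift.
have EA x : A (x - h) = gn (x - h + u) * gn (x - h) * phi (x + w).
  by rewrite /A subrK.
pose D x := phi (x + w) * (gn (x - h + u) * gn (x - h) - gn (x + u) * gn x).
have DE : D = fun x => A (x - h) - gn (x + u) * gn x * phi (x + w).
  by apply/funext => x; rewrite /D EA; ring.
have iD : lam.-integrable setT (EFin \o D) by rewrite DE; exact: integrable_EFinB.
(* Translating x by - h in the first half alone removes h from the argument of [phi] and puts it on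
   the two densities. *)
have -> : (\int[lam]_x (F s (x + u, x))%:E = (k (u, s))%:E * \int[lam]_x (D x)%:E)%E.
  under eq_integral do rewrite EF.
  rewrite Rintegral_EFin; last first.
    apply: integrable_EFinZ; under [X in EFin \o X]eq_fun do rewrite mulrBr.
    exact: integrable_EFinB.
  rewrite RintegralZl//; last first.
    under [X in EFin \o X]eq_fun do rewrite mulrBr.
    exact: integrable_EFinB.
  rewrite (Rintegral_EFin iD) EFinM; congr (_ * _%:E)%E.
  under eq_Rintegral do rewrite mulrBr.
  rewrite RintegralB// DE RintegralB//.
  by rewrite (integral_row_shift (- h) mA).
rewrite abseM /= ger0_norm//.
have mrhs : measurable_fun setT (fun x =>
    (1 + (enorm x + enorm u) ^+ 2) * line_variation g P Q rho u h x).
  apply: measurable_funM; last exact: (measurable_line_variation P Q ig Hrho u h).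
  apply: measurable_funD => //; apply: measurable_funX; apply: measurable_funD => //.
  exact: measurable_enorm.
under [leRHS]eq_integral do rewrite EFinM.
rewrite [leRHS]ge0_integralZl ?lee_fin//; last 2 first.
- exact/measurable_EFinP.
- by move=> x _; rewrite lee_fin.
apply: lee_wpmul2l; first by rewrite lee_fin.
apply: le_trans (le_abse_integral _ _ _) _ => //.
  by apply/measurable_EFinP; exact: integrableEFin_fun iD.
apply: le_trans (shift_estimate g0 ig HPQ Hrho u mphi phim (fun t => @kW (u, s) t kus)).
rewrite le_eqVlt; apply/orP; left; apply/eqP; apply: eq_integral => x _.
by rewrite abse_EFin normrM.
Qed.

(** The majorant in the variables (v, vs): one factor |u| comes from the kernel, the other from the
    size of [H]. [Gb] is its version with separated variables. *)
Let Gf (p : V * V) : R := M * d *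
  (enorm (p.1 - p.2) ^+ 2 * (1 + (enorm p.2 + enorm (p.1 - p.2)) ^+ 2)) *
  (gn p.1 * mvt p.2 + gn p.2 * mvt p.1).

Let Gb (p : V * V) : R := 256 * M * d *
  ((gn p.1 * w4 p.1) * (mvt p.2 * w4 p.2) + (mvt p.1 * w4 p.1) * (gn p.2 * w4 p.2)).

Let mfs1 (f : V -> R) : measurable_fun setT f -> measurable_fun setT (fun p : V * V => f p.1).
Proof. by move=> mf; exact: measurableT_comp mf measurable_fst. Qed.

Let mfs2 (f : V -> R) : measurable_fun setT f -> measurable_fun setT (fun p : V * V => f p.2).
Proof. by move=> mf; exact: measurableT_comp mf measurable_snd. Qed.

Let msp : measurable_fun setT (fun p : V * V => enorm (p.1 - p.2)).
Proof.
apply: measurableT_comp (@measurable_enorm _ _) _.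
by apply: measurable_rowB; [exact: measurable_fst|exact: measurable_snd].
Qed.

Let mGf : measurable_fun setT Gf.
Proof.
apply: measurable_funM; last first.
  apply: measurable_funD.
    exact: measurable_funM (mfs1 mgn) (mfs2 mmvt).
  exact: measurable_funM (mfs2 mgn) (mfs1 mmvt).
apply: measurable_funM => //; apply: measurable_funM; first exact: measurable_funX.
apply: measurable_funD => //; apply: measurable_funX; apply: measurable_funD => //.
exact: mfs2 (@measurable_enorm _ _).
Qed.

Let Gf0 p : 0 <= Gf p.
Proof.
apply: mulr_ge0; last by rewrite addr_ge0// mulr_ge0.
apply: mulr_ge0; first exact: mulr_ge0.
by apply: mulr_ge0; [exact: sqr_ge0|rewrite addr_ge0// sqr_ge0].
Qed.

Let Gf_le p : Gf p <= Gb p.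
Proof.
have H0 : 0 <= gn p.1 * mvt p.2 + gn p.2 * mvt p.1 by rewrite addr_ge0// mulr_ge0.
rewrite /Gb (_ : 256 * M * d * _ = M * d * (256 * (w4 p.1 * w4 p.2)) *
  (gn p.1 * mvt p.2 + gn p.2 * mvt p.1)); last by ring.
rewrite /Gf ler_wpM2r// ler_wpM2l//; first by rewrite mulr_ge0.
apply: le_trans (relative_weight_le p).
rewrite ler_wpM2r//; first by rewrite addr_ge0// sqr_ge0.
by rewrite lerXn2r ?nnegrE ?addr_ge0 ?enorm_ge0// lerDr.
Qed.

Let Igb : lam2.-integrable setT (EFin \o Gb) /\
  \int[lam2]_p Gb p = 512 * M * d * (\int[lam]_v (gn v * w4 v)) * (\int[lam]_v (mvt v * w4 v)).
Proof.
have gw0 x : 0 <= gn x * w4 x by rewrite mulr_ge0.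
have mw0 x : 0 <= mvt x * w4 x by rewrite mulr_ge0.
have [i1 e1] := integrable_prod gw0 mw0 ignw imvtw.
have [i2 e2] := integrable_prod mw0 gw0 imvtw ignw.
split; first by apply: integrable_EFinZ; exact: integrable_EFinD.
rewrite RintegralZl//; last exact: integrable_EFinD.
by rewrite RintegralD// e1 e2; ring.
Qed.

(** The shear makes u a free variable, [transport_line_le] applies for each u, and the resulting
    bound is sheared back to (v, vs), where its variables separate. *)
Lemma transport_slice_le s : (`|\int[lam2]_p (F s p)%:E| <=
  (512 * M * d * (\int[lam]_v (gn v * w4 v)) * (\int[lam]_v (mvt v * w4 v)))%:E)%E.
Proof.
have [iGb <-] := Igb.
have msh := @measurable_shear R N.
have -> : (\int[lam2]_p (F s p)%:E = \int[lam2]_p (F s (shear p))%:E)%E.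
  apply: (@integral_measure_map _ _ _ _ _ lam2 lam2 _ (EFin \o F s)) => //.
    by move=> A mA; exact: lebesgue_row_shear.
  exact/measurable_EFinP.
have iFs : lam2.-integrable setT ((EFin \o F s) \o @shear R N).
  apply: (@integrable_measure_map _ _ _ _ _ lam2 lam2) => //.
  by move=> A mA; exact: lebesgue_row_shear.
have mGE : measurable_fun setT (EFin \o Gf) by exact/measurable_EFinP.
have mGs : measurable_fun setT ((EFin \o Gf) \o @shear R N).
  exact: measurableT_comp mGE msh.
have Gs0 p : (0 <= ((EFin \o Gf) \o @shear R N) p)%E.
  by rewrite /= lee_fin; exact: Gf0.
pose B u := (\int[lam]_x (Gf (shear (u, x)))%:E)%E.
have mB : measurable_fun setT B.
  exact: (@measurable_fun_fubini_tonelli_F _ _ _ _ _ lam _ mGs Gs0).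
apply: le_trans (abse_integral_prod1_le iFs mB _) _ => [u|].
  have := transport_line_le u s.
  under eq_integral do rewrite [(_ : V) + u]addrC.
  move=> /le_trans; apply; apply: le_integral_EFin.
  - apply: measurable_funM => //; apply: measurable_funM; last first.
      exact: (measurable_line_variation P Q ig Hrho u (H (u, s))).
    apply: measurable_funD => //; apply: measurable_funX; apply: measurable_funD => //.
    exact: measurable_enorm.
  - apply: (measurableT_comp mGf (measurableT_comp msh _)).
    by apply/measurable_fun_pairP; split; [exact: measurable_cst|exact: measurable_id].
  - move=> x; apply: mulr_ge0 => //; apply: mulr_ge0; first by rewrite addr_ge0// sqr_ge0.
    exact: (line_variation_ge0 P Q g0 Hrho u (H (u, s)) x).
  - move=> x; have [->|kus] := eqVneq (k (u, s)) 0; first by rewrite mul0r.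
    have lv := line_variation_le_sum u x (kH kus).
    rewrite /Gf /shear /= addrK.
    have km := kM (u, s); rewrite /= in km lv.
    have z0 : 0 <= 1 + (enorm x + enorm u) ^+ 2 by rewrite addr_ge0// sqr_ge0.
    have lv0 := line_variation_ge0 P Q g0 Hrho u (H (u, s)) x.
    apply: (le_trans (ler_pM (k0 _) (mulr_ge0 z0 lv0) km (ler_wpM2l z0 lv))).
    rewrite [x + u]addrC le_eqVlt; apply/orP; left; apply/eqP; ring.
(* Back to the variables (v, vs). *)
rewrite /B -(fubini_tonelli1 _ mGs Gs0) /= -(ge0_integral_shear mGE); last first.
  by move=> p; rewrite lee_fin.
rewrite -Rintegral_EFin//; apply: le_integral_EFin => //.
exact: integrableEFin_fun iGb.
Qed.

(** The bound of [transport_slice_le] is the same for all s, so exchanging the order of integration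
    costs only the mass of the sphere. *)
Lemma transport_mollified_le :
  `|\int[lam2]_p (gn p.1 * gn p.2 * transport k W H phi p)| <=
  512 * M * d * (\int[lam]_v (gn v * w4 v)) * (\int[lam]_v (mvt v * w4 v)) * fine (S setT).
Proof.
set c := 512 * M * d * _ * _.
pose G (q : (V * V) * V) : R := F q.2 q.1.
have iG : (lam2 \x S)%E.-integrable setT (EFin \o G).
  have i1 : (lam2 \x S)%E.-integrable setT (EFin \o (fun q : (V * V) * V =>
      (gn q.1.1 * w4 q.1.1) * (gn q.1.2 * w4 q.1.2) * cst 1 q.2)).
    pose nu := product_sigma_finite lam lam.
    have iS : S.-integrable setT (EFin \o cst (1 : R)).
      exact: finite_measure_integrable_cst.
    exact: (@integrable_prod _ _ _ _ _ nu S
      (fun p : V * V => (gn p.1 * w4 p.1) * (gn p.2 * w4 p.2)) (cst 1)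
      (fun p => mulr_ge0 (mulr_ge0 (gn0 p.1) (w40 p.1)) (mulr_ge0 (gn0 p.2) (w40 p.2)))
      (fun=> ler01) iww iS).1.
  apply: (le_integrable_EFin _ _ (integrable_EFinZ (512 * M) i1)).
    apply: measurable_funM.
      by apply: measurable_funM; apply: (measurableT_comp mgn);
        [exact: measurableT_comp measurable_fst measurable_fst|
         exact: measurableT_comp measurable_snd measurable_fst].
    exact: (measurable_transport_diff mk mW mH mphi measurable_fst measurable_snd).
  by move=> q; rewrite mulr1; exact: F_le.
have iTD p := @integrable_transport_diff R N k W H phi M mk mW mH mphi phim M0 k0 kM kW p.
have iT : lam2.-integrable setT (EFin \o (fun p => gn p.1 * gn p.2 * transport k W H phi p)).
  apply: (le_integrable_EFin _ _ (integrable_EFinZ (512 * M * fine (S setT)) iww)).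
    apply: measurable_funM; last exact: measurable_transport.
    by apply: measurable_funM; [exact: mfs1|exact: mfs2].
  move=> p; rewrite normrM ger0_norm; last by rewrite mulr_ge0.
  rewrite (_ : 512 * M * _ * _ = gn p.1 * gn p.2 * (512 * M * fine (S setT) * (w4 p.1 * w4 p.2))); last by ring.
  rewrite ler_wpM2l//; first by rewrite mulr_ge0.
  exact: transport_le.
have E : (\int[lam2]_p (gn p.1 * gn p.2 * transport k W H phi p))%:E =
    (\int[(lam2 \x S)%E]_q (G q)%:E)%E.
  rewrite -(Rintegral_EFin iT) -(@integral12_prod_meas1 _ _ _ _ _ (product_sigma_finite lam lam) S _ iG).
  apply: eq_integral => p _; rewrite /transport -RintegralZl//.
  rewrite -Rintegral_EFin//; exact: integrable_EFinZ.
rewrite -lee_fin -abse_EFin E.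
have := @abse_integral_prod2_le _ _ _ _ _ (product_sigma_finite lam lam) S _ iG (cst c%:E) (measurable_cst _) _.
rewrite integral_cst//= => H'; apply: le_trans (H' _) _.
  by move=> s; exact: transport_slice_le.
have Sfin : S setT \is a fin_num by exact: fin_num_measure.
by rewrite -[in leLHS](fineK Sfin) -EFinM.
Qed.

End mollified.
End transport_estimate.

(** * Removal of the mollification *)

Section transport_limit.
Context {R : realType} {N : nat}.
Notation V := 'rV[R]_N.
Notation S := (@sphere_measure R N).
Notation lam := (lebesgue_row R N).
Notation lam2 := (lebesgue_row R N \x lebesgue_row R N)%E.
Notation w4 := (@moment_weight R N 4).
Notation m := (@energy_weight R N).
Notation K0 := (@mollify_const R N).

Variables (k : V * V -> R) (W H : V * V -> V) (phi : V -> R) (M d : R).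
Hypotheses (mk : measurable_fun setT k) (mW : measurable_fun setT W)
  (mH : measurable_fun setT H) (mphi : measurable_fun setT phi)
  (phim : forall v, `|phi v| <= m v) (M0 : 0 <= M) (d0 : 0 <= d).
Hypotheses (k0 : forall q, 0 <= k q) (kM : forall q, k q <= M * enorm q.1)
  (kW : forall q t, k q != 0 -> 0 <= t <= 1 -> enorm (W q + t *: H q) <= enorm q.1)
  (kH : forall q, k q != 0 -> enorm (H q) <= d * enorm q.1).
Variables (g : V -> R) (P Q : 'I_N -> {finite_measure set V -> \bar R}).
Hypotheses (mg : measurable_fun setT g) (g0 : forall v, 0 <= g v)
  (igw : lam.-integrable setT (EFin \o (fun v => g v * w4 v))).
Hypothesis HPQ : BV_parts g P Q.
Hypotheses (iPw : forall i, (P i).-integrable setT (EFin \o w4))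
  (iQw : forall i, (Q i).-integrable setT (EFin \o w4)).

Let w40 (v : V) : 0 <= w4 v. Proof. exact: moment_weight_ge0. Qed.

Let T := transport k W H phi.
Let c0 := 512 * M * fine (S setT).
Let A := \int[lam]_v (g v * w4 v).
Let D := \sum_i (\int[P i]_v w4 v + \int[Q i]_v w4 v).

Let c00 : 0 <= c0.
Proof. by apply: (mulr_ge0 (mulr_ge0 (ler0n _ _) M0)); exact: fine_ge0. Qed.

Let A0 : 0 <= A.
Proof. by apply: Rintegral_ge0 => v _; rewrite mulr_ge0. Qed.

Let ig : lam.-integrable setT (EFin \o g).
Proof.
apply: (le_integrable_EFin mg _ igw) => v; rewrite ger0_norm// ler_peMr//.
by rewrite lerDl exprn_ge0// enorm_ge0.
Qed.

Let K00 : 0 <= K0. Proof. exact: mollify_const_ge0. Qed.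

Let mT : measurable_fun setT T. Proof. exact: measurable_transport. Qed.

Let T_le p : `|T p| <= c0 * (w4 p.1 * w4 p.2).
Proof. exact: transport_le. Qed.

Let integrable_weighted (a b : V -> R) : (forall v, 0 <= a v) -> (forall v, 0 <= b v) ->
  lam.-integrable setT (EFin \o (fun v => a v * w4 v)) ->
  lam.-integrable setT (EFin \o (fun v => b v * w4 v)) ->
  lam2.-integrable setT (EFin \o (fun p => (a p.1 * w4 p.1) * (b p.2 * w4 p.2))) /\
  \int[lam2]_p ((a p.1 * w4 p.1) * (b p.2 * w4 p.2)) =
  (\int[lam]_v (a v * w4 v)) * (\int[lam]_v (b v * w4 v)).
Proof.
move=> a0 b0 ia ib.
exact: (integrable_prod (fun v => mulr_ge0 (a0 v) (w40 v)) (fun v => mulr_ge0 (b0 v) (w40 v)) ia ib).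
Qed.

Lemma integrable_transport (a : V -> R) : measurable_fun setT a -> (forall v, 0 <= a v) ->
  lam.-integrable setT (EFin \o (fun v => a v * w4 v)) ->
  lam2.-integrable setT (EFin \o (fun p => a p.1 * a p.2 * T p)).
Proof.
move=> ma a0 ia; have [i1 _] := integrable_weighted a0 a0 ia ia.
apply: (le_integrable_EFin _ _ (integrable_EFinZ c0 i1)).
  apply: measurable_funM => //; apply: measurable_funM.
    exact: measurableT_comp ma measurable_fst.
  exact: measurableT_comp ma measurable_snd.
move=> p; rewrite normrM ger0_norm; last by rewrite mulr_ge0.
rewrite (_ : c0 * _ = a p.1 * a p.2 * (c0 * (w4 p.1 * w4 p.2))); last by ring.
by rewrite ler_wpM2l// mulr_ge0.
Qed.

(** The form is quadratic in the density: g g_* - a a_* is, up to sign, (a - g) g_* + a (a -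
    g)_*. *)
Let transport_diff_L1 (a : V -> R) (eps : R) : measurable_fun setT a ->
  (forall v, 0 <= a v) -> lam.-integrable setT (EFin \o (fun v => a v * w4 v)) ->
  (\int[lam]_v (`|a v - g v| * w4 v)%:E <= eps%:E)%E ->
  `|\int[lam2]_p (g p.1 * g p.2 * T p)| <= `|\int[lam2]_p (a p.1 * a p.2 * T p)| +
     c0 * (eps * (A + \int[lam]_v (a v * w4 v))).
Proof.
move=> ma a0 ia Heps.
have mag : measurable_fun setT (fun v => `|a v - g v|).
  by apply: measurableT_comp => //; exact: measurable_funB.
have [id ide] : lam.-integrable setT (EFin \o (fun v => `|a v - g v| * w4 v)) /\
    \int[lam]_v (`|a v - g v| * w4 v) <= eps.
  apply: integrable_EFin_fin => //.
    by apply: measurable_funM => //; exact: measurable_moment_weight.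
  by move=> v; rewrite mulr_ge0.
have n0 v : 0 <= `|a v - g v| by [].
have [i1 e1] := integrable_weighted n0 g0 id igw.
have [i2 e2] := integrable_weighted a0 n0 ia id.
have iTa := integrable_transport ma a0 ia; have iTg := integrable_transport mg g0 igw.
rewrite -lerBlDl; apply: le_trans (lerB_dist _ _) _; rewrite -RintegralB//.
apply: (@le_trans _ _ (\int[lam2]_p (c0 * ((`|a p.1 - g p.1| * w4 p.1) * (g p.2 * w4 p.2) +
    (a p.1 * w4 p.1) * (`|a p.2 - g p.2| * w4 p.2))))).
  apply: normr_Rintegral_le.
  - by apply: measurable_funB; [exact: integrableEFin_fun iTg|exact: integrableEFin_fun iTa].
  - move=> p; rewrite -mulrBl normrM.
    rewrite (_ : c0 * _ = (`|a p.1 - g p.1| * g p.2 + a p.1 * `|a p.2 - g p.2|) *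
      (c0 * (w4 p.1 * w4 p.2))); last by ring.
    apply: ler_pM => //.
    rewrite (_ : _ - _ = - ((a p.1 - g p.1) * g p.2 + a p.1 * (a p.2 - g p.2))); last by ring.
    rewrite normrN (le_trans (ler_normD _ _))// !normrM.
    by rewrite (ger0_norm (g0 _)) (ger0_norm (a0 _)).
  - by apply: integrable_EFinZ; exact: integrable_EFinD.
rewrite RintegralZl//; last exact: integrable_EFinD.
rewrite RintegralD// e1 e2 ler_wpM2l// mulrDr -/A lerD//.
  by rewrite ler_wpM2r.
by rewrite mulrC ler_wpM2r// Rintegral_ge0// => v _; rewrite mulr_ge0.
Qed.

Lemma transport_bound : `|\int[lam2]_p (g p.1 * g p.2 * transport k W H phi p)| <=
  512 * M * d * (K0 * \int[lam]_v (g v * w4 v)) *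
  (K0 * \sum_i (\int[P i]_v w4 v + \int[Q i]_v w4 v)) * fine (S setT).
Proof.
have /choice[rho Hrho] (n : nat) : exists rho : V -> R, mollifier n.+1%:R^-1 rho.
  by apply: mollifier_exists; rewrite invr_gt0.
rewrite -/A -/D -/T; apply/ler_addgt0Pr => eps e0.
(* The mollified density has moment at most K0 A, so the replacement error is c0 eta (A + K0 A) <=
   eps; the added 1 keeps the denominator positive. *)
pose eta := eps / (c0 * (A + K0 * A) + 1).
have q0 : 0 < c0 * (A + K0 * A) + 1.
  by apply: ltr_wpDl => //; rewrite mulr_ge0// addr_ge0// mulr_ge0.
have eta0 : 0 < eta by rewrite divr_gt0.
have [n Hn] := mollify_cvg_L1 Hrho mg g0 ig igw eta0.
have n1 : n.+1%:R^-1 <= 1 :> R by rewrite invf_le1// ler1n.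
have [ignw lgnw] := mollify_weight_le (Hrho n) n1 g0 ig igw.
have ig1 (mu : {finite_measure set V -> \bar R}) : mu.-integrable setT (EFin \o cst (1 : R)).
  exact: finite_measure_integrable_cst.
have e1w (mu : {finite_measure set V -> \bar R}) :
    EFin \o (fun y => cst 1 y * w4 y) = EFin \o w4.
  by apply/funext => y; rewrite /= mul1r.
have iw1 (mu : {finite_measure set V -> \bar R}) : mu.-integrable setT (EFin \o w4) ->
    lam.-integrable setT (EFin \o (fun x => mollify (rho n) mu (cst 1) x * w4 x)) /\
    \int[lam]_x (mollify (rho n) mu (cst 1) x * w4 x) <= K0 * \int[mu]_y w4 y.
  move=> iw; have [] := mollify_weight_le (mu := mu) (F := cst 1) (Hrho n) n1 _ (ig1 mu) _ => //.
    by rewrite e1w.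
  by under [in X in _ <= X]eq_Rintegral do rewrite mul1r.
have imv i : lam.-integrable setT (EFin \o (fun v => mollified_variation P Q (rho n) i v * w4 v)) /\
    \int[lam]_v (mollified_variation P Q (rho n) i v * w4 v) <=
    K0 * (\int[P i]_v w4 v + \int[Q i]_v w4 v).
  have [i1 l1] := iw1 _ (iPw i); have [i2 l2] := iw1 _ (iQw i).
  have E : (fun v => mollified_variation P Q (rho n) i v * w4 v) =
    fun v => mollify (rho n) (P i) (cst 1) v * w4 v + mollify (rho n) (Q i) (cst 1) v * w4 v.
    by apply/funext => v; rewrite mulrDl.
  rewrite E; split; first exact: integrable_EFinD.
  by rewrite RintegralD// mulrDr lerD.
have mgn : measurable_fun setT (mollify (rho n) lam g) by exact: (measurable_mollify (Hrho n)).
have gn0 v : 0 <= mollify (rho n) lam g v by exact: (mollify_ge0 (Hrho n)).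
apply: le_trans (transport_diff_L1 mgn gn0 ignw Hn) _; apply: lerD.
  apply: le_trans (transport_mollified_le mk mW mH mphi phim M0 d0 k0 kM kW kH g0 ig HPQ (Hrho n)
    ignw (fun i => (imv i).1)) _.
  rewrite ler_wpM2r ?fine_ge0//.
  have cM : 0 <= 512 * M * d := mulr_ge0 (mulr_ge0 (ler0n _ _) M0) d0.
  apply: ler_pM.
  - by rewrite mulr_ge0// Rintegral_ge0// => v _; rewrite mulr_ge0.
  - rewrite Rintegral_ge0// => v _; rewrite mulr_ge0// sumr_ge0// => i _.
    exact: mollified_variation_ge0 (Hrho n) i v.
  - by rewrite ler_wpM2l.
  - rewrite (_ : \int[lam]_v _ = \sum_i \int[lam]_v (mollified_variation P Q (rho n) i v * w4 v)).
      by rewrite mulr_sumr; apply: ler_sum => i _; exact: (imv i).2.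
    have Hs (s : seq 'I_N) : \int[lam]_v (\sum_(i <- s) mollified_variation P Q (rho n) i v * w4 v) =
        \sum_(i <- s) \int[lam]_v (mollified_variation P Q (rho n) i v * w4 v).
      elim: s => [|i s IH].
        rewrite big_nil; under eq_Rintegral do rewrite big_nil.
        by rewrite /Rintegral integral0.
      rewrite big_cons -IH; under eq_Rintegral do rewrite big_cons.
      rewrite RintegralD//; first exact: (imv i).1.
      by apply: integrable_EFin_sum => j; exact: (imv j).1.
    by rewrite -Hs; apply: eq_Rintegral => v _; rewrite mulr_suml.
apply: (@le_trans _ _ (c0 * (eta * (A + K0 * A)))).
  by rewrite ler_wpM2l// ler_wpM2l ?(ltW eta0)// lerD2l.
rewrite mulrCA /eta mulrAC -mulrA -[leRHS]mulr1 ler_wpM2l ?(ltW e0)//.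
by rewrite ler_pdivrMr// mul1r lerDl.
Qed.

End transport_limit.

(** * Lipschitz dependence on the energy *)

Section scatter.
Context {R : realType} {N : nat}.
Notation V := 'rV[R]_N.

(* At q = (v - vs, s), the velocities v' (sg = 1) and v'_* (sg = -1) relative to vs. *)
Definition scatter (sg r : R) (q : V * V) : V :=
  2^-1 *: q.1 + (sg * (enorm q.1 / 2)) *: inelastic_direction r q.1 q.2.

Lemma post_scatter r (p : V * V) s :
  post p.1 p.2 (inelastic_direction r (p.1 - p.2) s) = p.2 + scatter 1 r (p.1 - p.2, s).
Proof.
rewrite /post /scatter /= enormC; move: (inelastic_direction _ _ _) (enorm _) => z c.
by apply/rowP => i; rewrite !mxE; field.
Qed.

Lemma post_star_scatter r (p : V * V) s :
  post_star p.1 p.2 (inelastic_direction r (p.1 - p.2) s) = p.2 + scatter (- 1) r (p.1 - p.2, s).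
Proof.
rewrite /post_star /scatter /= enormC; move: (inelastic_direction _ _ _) (enorm _) => z c.
by apply/rowP => i; rewrite !mxE; field.
Qed.

(** Displacements are affine in the restitution coefficient, so an intermediate point W + t H is
    again a scattering displacement with a coefficient in [0, 1], hence of length at most |u|. *)
Lemma scatter_affine sg r r' t q :
  scatter sg r q + t *: (scatter sg r' q - scatter sg r q) = scatter sg (r + t * (r' - r)) q.
Proof.
rewrite /scatter /inelastic_direction; move: (hat _) (enorm _) => z c.
by apply/rowP => i; rewrite !mxE; field.
Qed.

Lemma enorm_scatter_le sg r q : `|sg| = 1 -> 0 <= r <= 1 -> enorm q.2 = 1 ->
  enorm (scatter sg r q) <= enorm q.1.
Proof.
move=> sg1 r01 s1; rewrite /scatter (le_trans (ler_enormD _ _))// !enormZ.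
rewrite normrM sg1 mul1r !ger0_norm ?divr_ge0 ?enorm_ge0//.
have := enorm_inelastic_direction q.1 r01 s1.
have := enorm_ge0 q.1; move: (enorm q.1) (enorm (inelastic_direction r q.1 q.2)) => a b a0 b1.
have : a / 2 * b <= a / 2 by rewrite ler_piMr// divr_ge0.
lra.
Qed.

(** The derivative of the direction in the restitution coefficient is (s - hat u) / 2, of norm at
    most 1, and it is scaled by |u| / 2. *)
Lemma enorm_scatterB_le sg r r' q : `|sg| = 1 -> enorm q.2 = 1 ->
  enorm (scatter sg r' q - scatter sg r q) <= `|r' - r| / 2 * enorm q.1.
Proof.
move=> sg1 s1.
have -> : scatter sg r' q - scatter sg r q =
    (sg * (enorm q.1 / 2) * ((r' - r) / 2)) *: (q.2 - hat q.1).
  rewrite /scatter /inelastic_direction; move: (hat _) (enorm _) => z c.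
  by apply/rowP => i; rewrite !mxE; field.
rewrite enormZ !normrM sg1 mul1r (ger0_norm (enorm_ge0 _)) !(ger0_norm (_ : 0 <= 2^-1))//.
have : enorm (q.2 - hat q.1) <= 2.
  by rewrite (le_trans (ler_enormB _ _))// s1 (_ : 2 = 1 + 1)// lerD2l enorm_hat_le1.
have := enorm_ge0 q.1; have := normr_ge0 (r' - r).
move: (enorm q.1) (enorm (q.2 - hat q.1)) `|r' - r| => a b c c0 a0 b2.
rewrite (_ : c / 2 * a = a / 2 * (c / 2) * 2); last by field.
by rewrite ler_wpM2l// mulr_ge0// divr_ge0.
Qed.

Lemma measurable_scatter sg r : measurable_fun setT (scatter sg r).
Proof.
apply: measurable_row_addf.
  exact: measurable_rowZ (measurable_cst _) measurable_fst.
apply: measurable_rowZ; last first.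
  exact: measurable_inelastic_direction measurable_fst measurable_snd.
apply: measurable_funM => //; apply: measurable_funM => //.
exact: measurableT_comp (@measurable_enorm _ _) measurable_fst.
Qed.

End scatter.

Section energy_lipschitz.
Context {R : realType} {N : nat}.
Notation V := 'rV[R]_N.
Notation S := (@sphere_measure R N).
Notation lam := (lebesgue_row R N).
Notation lam2 := (lebesgue_row R N \x lebesgue_row R N)%E.
Notation w4 := (@moment_weight R N 4).
Notation m := (@energy_weight R N).
Notation K0 := (@mollify_const R N).

(** The form in which the BV bound is used: pointwise nonnegativity, the fourth moment, and the
    derivatives as differences of finite measures with bounded weighted mass. *)
Definition BV_bounded (C : R) (g : V -> R) :=
  [/\ measurable_fun setT g, forall v, 0 <= g v,
      lam.-integrable setT (EFin \o (fun v => g v * w4 v)),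
      \int[lam]_v (g v * w4 v) <= C &
      exists P Q : 'I_N -> {finite_measure set V -> \bar R},
        [/\ BV_parts g P Q,
            forall i, (P i).-integrable setT (EFin \o w4),
            forall i, (Q i).-integrable setT (EFin \o w4) &
            \sum_i (\int[P i]_v w4 v + \int[Q i]_v w4 v) <= C]].

Variables (bt : R -> R -> R -> R) (e : R -> R).
Hypotheses (Hbt : bounded_density bt) (He : restitution e).

Let w40 (v : V) : 0 <= w4 v. Proof. exact: moment_weight_ge0. Qed.

(** Both |v| and |vs| are at most |vs| + |u|, so each of the two weights [m] falls under
    [relative_weight_le]; hence 2 * 256. *)
Lemma energy_weight_speed_le (p : V * V) :
  (m p.1 + m p.2) * enorm (p.1 - p.2) <= 512 * (w4 p.1 * w4 p.2).
Proof.
rewrite (_ : 512 * _ = 2 * (256 * (w4 p.1 * w4 p.2))); last by ring.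
apply: le_trans (ler_wpM2l _ (relative_weight_le p)) => //.
have hb : enorm p.1 <= enorm p.2 + enorm (p.1 - p.2).
  by rewrite -[p.1 in leLHS](subrKC p.2) ler_enormD.
have := enorm_ge0 p.1; have := enorm_ge0 p.2; have := enorm_ge0 (p.1 - p.2).
move: hb; rewrite /energy_weight.
move: (enorm p.1) (enorm p.2) (enorm (p.1 - p.2)) => a b c abc c0 b0 a0.
rewrite [leRHS]mulrCA [leLHS]mulrC; apply: ler_pM => //.
- by rewrite !addr_ge0// sqr_ge0.
- by rewrite sqrrD expr1n; have := sqr_ge0 c; lra.
- have h1 : a ^+ 2 <= (b + c) ^+ 2 by rewrite lerXn2r ?nnegrE// addr_ge0.
  have h2 : b ^+ 2 <= (b + c) ^+ 2 by rewrite lerXn2r ?nnegrE// ?addr_ge0// lerDl.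
  lra.
Qed.

Section two_energies.
Variables (E E' : R) (phi : V -> R) (L : R).
Hypotheses (E0 : 0 < E) (E'0 : 0 < E') (mphi : measurable_fun setT phi)
  (phim : forall v, `|phi v| <= m v).
Hypothesis HL : forall u : V, u != 0 ->
  (density_distance bt E' E u <= (L * `|E' - E|)%:E)%E.
Hypothesis HLe : `|e E' - e E| <= L * `|E' - E|.

Local Notation k := (fun q : V * V => kernel bt E q.1 q.2).

Let L0 : 0 <= L * `|E' - E|. Proof. exact: le_trans (normr_ge0 _) HLe. Qed.

(** [density_distance] leaves out the factor |u|, which is restored here. The hypothesis excludes u
    = 0, where the kernel vanishes. *)
Lemma kernel_distance_le (u : V) :
  S.-integrable setT (EFin \o (fun s => `|kernel bt E' u s - kernel bt E u s|)) /\
  \int[S]_s `|kernel bt E' u s - kernel bt E u s| <= enorm u * (L * `|E' - E|).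
Proof.
have ik := integrable_EFin_norm (integrable_EFinB (integrable_kernel Hbt u E'0) (integrable_kernel Hbt u E0)).
split => //; have [u0|u0] := eqVneq u 0.
  rewrite u0; under eq_Rintegral do rewrite /kernel enorm0 !mul0r !mulr0 subrr normr0.
  by rewrite /Rintegral integral0 mulr_ge0// enorm_ge0.
have pu : 0 < enorm u by rewrite lt_def enorm_eq0 u0 enorm_ge0.
have H : (\int[S]_s ((enorm u)^-1 * `|kernel bt E' u s - kernel bt E u s|)%:E <=
    (L * `|E' - E|)%:E)%E.
  apply: le_trans (HL u0); rewrite /density_distance [leRHS]integral_mkcond.
  rewrite le_eqVlt; apply/orP; left; apply/eqP; apply: eq_integral => s _.
  rewrite /patch /kernel indicE; case: ifP => _; last by rewrite !mul0r subr0 normr0 mulr0.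
  rewrite !mul1r -mulrBr normrM (ger0_norm (enorm_ge0 _)) mulrA mulVf ?mul1r//.
  by rewrite gt_eqF.
move: H; rewrite Rintegral_EFin; last exact: integrable_EFinZ.
by rewrite lee_fin RintegralZl// mulrC ler_pdivrMr// mulrC.
Qed.

Lemma transport_hypotheses (sg : R) : `|sg| = 1 ->
  (forall (q : V * V) (t : R), k q != 0 -> 0 <= t <= 1 ->
    enorm (scatter sg (e E') q + t *: (scatter sg (e E) q - scatter sg (e E') q)) <= enorm q.1) /\
  (forall q : V * V, k q != 0 ->
    enorm (scatter sg (e E) q - scatter sg (e E') q) <= L * `|E' - E| / 2 * enorm q.1).
Proof.
move=> sg1.
have kS q : k q != 0 -> enorm q.2 = 1.
  rewrite /kernel indicE; case: (boolP (_ \in _)) => [|_]; first by rewrite inE.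
  by rewrite mul0r eqxx.
split => [q t /kS s1 /andP[t0 t1]|q /kS s1].
  rewrite scatter_affine; apply: enorm_scatter_le => //.
  have /andP[a0 a1] := He.1 _ E0; have /andP[b0 b1] := He.1 _ E'0.
  have h1 : 0 <= t * e E by rewrite mulr_ge0.
  have h2 : 0 <= (1 - t) * e E' by rewrite mulr_ge0// subr_ge0.
  have h3 : 0 <= t * (1 - e E) by rewrite mulr_ge0// subr_ge0.
  have h4 : 0 <= (1 - t) * (1 - e E') by rewrite mulr_ge0// ?subr_ge0.
  by apply/andP; split; lra.
rewrite (le_trans (enorm_scatterB_le _ _ sg1 s1))// ler_wpM2r ?enorm_ge0//.
by rewrite ler_wpM2r// distrC.
Qed.

Definition scatter_transport (sg : R) : V * V -> R :=
  transport k (scatter sg (e E')) (fun q => scatter sg (e E) q - scatter sg (e E') q) phi.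

Let mk : measurable_fun setT k. Proof. exact: measurable_kernel. Qed.

Let mW sg : measurable_fun setT (scatter sg (e E') : V * V -> V).
Proof. exact: measurable_scatter. Qed.

Let mH sg : measurable_fun setT (fun q : V * V => scatter sg (e E) q - scatter sg (e E') q).
Proof. by apply: measurable_rowB; exact: measurable_scatter. Qed.

(** The gain terms split as (gain_E - gain_E') k_E + gain_E' (k_E - k_E'). The first part is exactly
    the two transports, of v' and of v'_*; what is left involves only the change of the kernel. *)
Lemma collision_average_energyB p :
  `|collision_average bt e E phi p - collision_average bt e E' phi p -
    scatter_transport 1 p - scatter_transport (- 1) p| <=
  2 * (m p.1 + m p.2) * (enorm (p.1 - p.2) * (L * `|E' - E|)).
Proof.
have [M M0 kM] := @kernel_bound R N bt Hbt.
have k0 q : 0 <= k q by exact: kernel_ge0.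
have kM' q : k q <= M * enorm q.1 by exact: kM.
have iT (sg : R) (sg1 : `|sg| = 1) := integrable_transport_diff mk (@mW sg) (@mH sg) mphi phim M0 k0 kM'
  (transport_hypotheses sg1).1 p.
have iT1 := iT 1 (normr1 _).
have iT2 := iT (-1) (normrN1 _).
have ig := integrable_gain Hbt He E0 mphi phim p (p.1 - p.2).
have ig' := integrable_gain Hbt He E'0 mphi phim p (p.1 - p.2).
have [id dle] := kernel_distance_le (p.1 - p.2).
rewrite (collision_averageE Hbt He E0 mphi phim) (collision_averageE Hbt He E'0 mphi phim).
set D := fun s => gain e E' phi p s * (kernel bt E (p.1 - p.2) s - kernel bt E' (p.1 - p.2) s).
have -> : gain_average bt e E phi p - (phi p.1 + phi p.2) * total_kernel bt E (p.1 - p.2) -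
    (gain_average bt e E' phi p - (phi p.1 + phi p.2) * total_kernel bt E' (p.1 - p.2)) -
    scatter_transport 1 p - scatter_transport (- 1) p =
    \int[S]_s D s - (phi p.1 + phi p.2) *
    \int[S]_s (kernel bt E (p.1 - p.2) s - kernel bt E' (p.1 - p.2) s).
  rewrite RintegralB//; [|exact: integrable_kernel|exact: integrable_kernel].
  rewrite (_ : \int[S]_s D s = gain_average bt e E phi p - gain_average bt e E' phi p -
    scatter_transport 1 p - scatter_transport (- 1) p).
    have aux (a a' b b' x t1 t2 : R) : a - x * b - (a' - x * b') - t1 - t2 =
      (a - a' - t1 - t2) - x * (b - b') by ring.
    exact: aux.
  rewrite /gain_average /scatter_transport /transport -RintegralB//.
  rewrite -RintegralB//; last exact: integrable_EFinB.
  rewrite -RintegralB//; last by apply: integrable_EFinB => //; exact: integrable_EFinB.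
  apply: eq_Rintegral => s _; rewrite /D /gain !post_scatter !post_star_scatter /transport_diff /=.
  have tele (x y z : V) : x + (y - z) + z = x + y by rewrite -addrA subrK.
  rewrite !tele; clear.
  move: (kernel _ _ _ _) (kernel _ _ _ _) (phi _) (phi _) (phi _) (phi _) => *.
  by ring.
have dE s : `|kernel bt E (p.1 - p.2) s - kernel bt E' (p.1 - p.2) s| =
    `|kernel bt E' (p.1 - p.2) s - kernel bt E (p.1 - p.2) s| by rewrite distrC.
have mD : measurable_fun setT (fun s => kernel bt E (p.1 - p.2) s - kernel bt E' (p.1 - p.2) s).
  by apply: measurable_funB; apply: measurable_kernel2 => //; exact: measurable_cst.
have h1 : `|\int[S]_s (kernel bt E (p.1 - p.2) s - kernel bt E' (p.1 - p.2) s)| <=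
    enorm (p.1 - p.2) * (L * `|E' - E|).
  apply: le_trans dle; apply: normr_Rintegral_le => //.
  by move=> s; rewrite dE.
have mm0 : 0 <= m p.1 + m p.2 by rewrite addr_ge0// energy_weight_ge0.
have h2 : `|\int[S]_s D s| <= (m p.1 + m p.2) * (enorm (p.1 - p.2) * (L * `|E' - E|)).
  apply: le_trans (ler_wpM2l mm0 dle); rewrite -RintegralZl//.
  apply: normr_Rintegral_le; last exact: integrable_EFinZ.
    exact: measurable_funM (measurable_gain e E' mphi (measurable_cst p) (@measurable_id _ _ setT)) mD.
  move=> s; rewrite /D normrM dE.
  have [s1|s1] := boolP (s \in @unit_sphere R N); last first.
    by rewrite /kernel indicE (negbTE s1)/= !mul0r subr0 normr0 !mulr0.
  rewrite ler_wpM2r// /gain (le_trans (ler_normD _ _))//.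
  apply: le_trans (lerD (phim _) (phim _)) _.
  apply: energy_weight_post; apply: enorm_inelastic_direction; first exact: He.1.
  by rewrite inE in s1.
rewrite (le_trans (ler_normB _ _))// normrM.
have h3 : `|phi p.1 + phi p.2| <= m p.1 + m p.2.
  by rewrite (le_trans (ler_normD _ _))// lerD.
have h4 := ler_pM (normr_ge0 _) (normr_ge0 _) h3 h1.
by rewrite -mulrA mulr_natl mulr2n lerD.
Qed.

(** Each of the two transports contributes 256 = 512 / 2, since the shift is at most L |E' - E| / 2
    times |u|. The change of kernel contributes 1024 = 2 * 512. *)
Lemma energy_difference_le (M C : R) (g : V -> R) : 0 <= M ->
  (forall u s : V, kernel bt E u s <= M * enorm u) ->
  BV_bounded C g ->
  `|\int[lam2]_p (g p.2 * g p.1 * collision_average bt e E phi p) -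
    \int[lam2]_p (g p.2 * g p.1 * collision_average bt e E' phi p)| <=
  (512 * M * K0 ^+ 2 * fine (S setT) + 1024) * C ^+ 2 * (L * `|E' - E|).
Proof.
move=> M0 kM [mg g0 igw gC [P [Q [HPQ iP iQ PQC]]]].
have k0 q : 0 <= k q by exact: kernel_ge0.
have kM' q : k q <= M * enorm q.1 by exact: kM.
have C0 : 0 <= C by apply: le_trans gC; apply: Rintegral_ge0 => v _; rewrite mulr_ge0.
have D0 : 0 <= \sum_i (\int[P i]_v w4 v + \int[Q i]_v w4 v).
  by apply: sumr_ge0 => i _; rewrite addr_ge0// Rintegral_ge0.
have d0 : 0 <= L * `|E' - E| / 2 by rewrite divr_ge0.
have iT (sg : R) (sg1 : `|sg| = 1) := integrable_transport mk (@mW sg) (@mH sg) mphi phim M0 k0 kM'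
  (transport_hypotheses sg1).1 mg g0 igw.
have bT (sg : R) (sg1 : `|sg| = 1) : `|\int[lam2]_p (g p.1 * g p.2 * scatter_transport sg p)| <=
    256 * M * K0 ^+ 2 * fine (S setT) * C ^+ 2 * (L * `|E' - E|).
  have [h1 h2] := transport_hypotheses sg1.
  apply: le_trans (transport_bound mk (@mW sg) (@mH sg) mphi phim M0 d0 k0 kM' h1 h2
    mg g0 igw HPQ iP iQ) _.
  have A0 : 0 <= \int[lam]_v (g v * w4 v) by apply: Rintegral_ge0 => v _; rewrite mulr_ge0.
  have K00 := @mollify_const_ge0 R N.
  rewrite (_ : 256 * M * _ * _ * _ * _ = 512 * M * (L * `|E' - E| / 2) * (K0 * C) * (K0 * C) * fine (S setT)); last by field.
  rewrite ler_wpM2r ?fine_ge0//.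
  have c0 : 0 <= 512 * M * (L * `|E' - E| / 2) := mulr_ge0 (mulr_ge0 (ler0n _ _) M0) d0.
  apply: ler_pM.
  - exact: mulr_ge0 c0 (mulr_ge0 K00 A0).
  - exact: mulr_ge0.
  - by rewrite ler_wpM2l// ler_wpM2l.
  - by rewrite ler_wpM2l.
have iT1 := iT 1 (normr1 _); have bT1 := bT 1 (normr1 _).
have iT2 := iT (-1) (normrN1 _); have bT2 := bT (-1) (normrN1 _).
have i1 := integrable_collision Hbt He E0 mphi phim mg g0 igw.
have i2 := integrable_collision Hbt He E'0 mphi phim mg g0 igw.
pose X p := g p.2 * g p.1 * collision_average bt e E phi p -
  g p.2 * g p.1 * collision_average bt e E' phi p -
  g p.1 * g p.2 * scatter_transport 1 p - g p.1 * g p.2 * scatter_transport (-1) p.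
have iX1 := integrable_EFinB i1 i2.
have iX2 := integrable_EFinB iX1 iT1.
have iX : lam2.-integrable setT (EFin \o X) := integrable_EFinB iX2 iT2.
have gw0 v : 0 <= g v * w4 v by rewrite mulr_ge0.
have [iw ew] := integrable_prod gw0 gw0 igw igw.
have bX : `|\int[lam2]_p X p| <= 1024 * C ^+ 2 * (L * `|E' - E|).
  apply: (@le_trans _ _ (\int[lam2]_p (1024 * (L * `|E' - E|) * ((g p.1 * w4 p.1) * (g p.2 * w4 p.2))))).
    apply: normr_Rintegral_le; [exact: integrableEFin_fun iX| |exact: integrable_EFinZ].
    move=> p; rewrite (_ : X p = g p.1 * g p.2 * (collision_average bt e E phi p -
      collision_average bt e E' phi p - scatter_transport 1 p - scatter_transport (- 1) p)); last first.
      have aux (a b c c' t t' : R) : b * a * c - b * a * c' - a * b * t - a * b * t' =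
        a * b * (c - c' - t - t') by ring.
      exact: aux.
    rewrite normrM ger0_norm ?mulr_ge0//.
    rewrite (_ : 1024 * _ * _ = g p.1 * g p.2 * (2 * (512 * (w4 p.1 * w4 p.2)) * (L * `|E' - E|))); last by ring.
    rewrite ler_wpM2l ?mulr_ge0//; apply: le_trans (collision_average_energyB p) _.
    rewrite -mulrA -[leRHS]mulrA ler_wpM2l// mulrA ler_wpM2r//.
    exact: energy_weight_speed_le.
  rewrite RintegralZl// ew.
  rewrite (_ : 1024 * C ^+ 2 * _ = 1024 * (L * `|E' - E|) * (C * C)); last by ring.
  apply: (ler_wpM2l (mulr_ge0 (ler0n _ _) L0)).
  by apply: ler_pM => //; apply: Rintegral_ge0 => v _.
have -> : \int[lam2]_p (g p.2 * g p.1 * collision_average bt e E phi p) -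
    \int[lam2]_p (g p.2 * g p.1 * collision_average bt e E' phi p) =
    \int[lam2]_p X p + \int[lam2]_p (g p.1 * g p.2 * scatter_transport 1 p) +
    \int[lam2]_p (g p.1 * g p.2 * scatter_transport (-1) p).
  rewrite /X (RintegralB measurableT iX2 iT2) (RintegralB measurableT iX1 iT1).
  rewrite (RintegralB measurableT i1 i2).
  have aux (x y a b : R) : x - y = x - y - a - b + a + b by rewrite addrAC !subrK.
  exact: aux.
apply: (le_trans (ler_normD _ _)).
apply: (le_trans (lerD (le_trans (ler_normD _ _) (lerD bX bT1)) bT2)).
rewrite le_eqVlt; apply/orP; left; apply/eqP; clear.
by move: (fine _) (L * _) => s l; ring.
Qed.

End two_energies.
End energy_lipschitz.

(** * The weak formulation in time *)

Section one_variable.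
Context {R : realType}.
Notation leb := (@lebesgue_measure R).
Implicit Types (q : R -> R) (T t : R).

Lemma derivable_is_continuous (F f : R -> R) : (forall t, is_derive t 1 F (f t)) -> continuous F.
Proof.
move=> dF t; apply/differentiable_continuous/derivable1_diffP.
by have [] := dF t.
Qed.

Lemma Rintegral_derivative (F f : R -> R) (a b : R) : a < b ->
  (forall t, is_derive t 1 F (f t)) -> continuous f ->
  \int[leb]_(t in `[a, b]) f t = F b - F a.
Proof.
move=> ab dF cf; have cF := derivable_is_continuous dF.
rewrite /Rintegral (@continuous_FTC2 R f F a b ab).
- by [].
- exact: continuous_subspaceT.
- split; last 2 first.
  + by apply: cvg_at_right_filter; exact: cF.
  + by apply: cvg_at_left_filter; exact: cF.
  by move=> t _; have [] := dF t.
- by move=> t _; rewrite derive1E; have [] := dF t.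
Qed.

(** Vanishing outside a bounded interval makes f integrable on the line, so the integral from -oo is
    a primitive at every point. *)
Lemma antiderivative (f : R -> R) (r : R) : continuous f ->
  (forall t, r < `|t| -> f t = 0) -> exists F : R -> R, forall t, is_derive t 1 F (f t).
Proof.
move=> cf fr.
have fi : leb.-integrable setT (EFin \o f).
  have E : EFin \o f = (EFin \o f) \_ `[- r, r].
    apply/funext => t; rewrite /patch; case: ifPn => //; rewrite notin_setE /= in_itv /= => /negP.
    by rewrite -ler_norml -ltNge => /fr ->.
  rewrite E; apply/(integrable_mkcond _ _).1 => //.
  apply: continuous_compact_integrable; first exact: segment_compact.
  exact: continuous_subspaceT.
exists (fun x => \int[leb]_(t in [set` `]-oo, x]]) f t) => x.
have [] := @continuous_FTC1 R f -oo%O x (x + 1) _ _ _ (cf x) => //.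
- by rewrite ltrDl.
- exact: integrableS fi.
- exact: ltNyr.
by move=> d1 d2; apply: (DeriveDef d1); rewrite -derive1E; exact: d2.
Qed.

Lemma is_derive_const (F f : R -> R) (a b : R) : a <= b ->
  (forall t, is_derive t 1 F (f t)) -> (forall t, a <= t <= b -> f t = 0) -> F a = F b.
Proof.
move=> ab dF f0; have cF := derivable_is_continuous dF.
have [c cab /eqP] := @MVT_segment R F f a b ab (fun x _ => dF x) (continuous_subspaceT cF).
by rewrite f0 ?mul0r ?subr_eq0; [move/eqP->|move: cab; rewrite in_itv].
Qed.

(** A primitive of h is nondecreasing with equal values at a and b, hence constant between them, and
    so is its derivative zero there. *)
Lemma zero_of_zero_integral (h : R -> R) (r a b : R) : a < b -> continuous h ->
  (forall t, 0 <= h t) -> (forall t, r < `|t| -> h t = 0) ->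
  \int[leb]_(t in `[a, b]) h t = 0 -> forall t, a < t < b -> h t = 0.
Proof.
move=> ab ch h0 hr hi t /andP[at0 tb].
have [F dF] := antiderivative ch hr.
have cF := derivable_is_continuous dF.
rewrite (Rintegral_derivative ab dF ch) in hi.
have incr x y : x <= y -> F x <= F y.
  move=> xy; have [c _ E] := @MVT_segment R F h x y xy (fun x _ => dF x) (continuous_subspaceT cF).
  by rewrite -subr_ge0 E mulr_ge0// subr_ge0.
have Fc x : a <= x -> x <= b -> F x = F a.
  move=> ax xb; apply/eqP; rewrite eq_le (incr a x)// andbT.
  by apply: le_trans (incr _ _ xb) _; rewrite -subr_le0 hi.
have [_ <-] := dF t.
rewrite (near_eq_derive (g := cst (F a))) ?derive_cst// ?oner_eq0//.
near=> x; apply: Fc; apply: ltW; near: x.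
  exact: lt_nbhsr.
exact: lt_nbhsl.
Unshelve. all: by end_near. Qed.

Definition clamp T t := Num.max 0 (Num.min T t).

Lemma clamp_bounds T t : 0 <= T -> 0 <= clamp T t <= T.
Proof. by move=> T0; rewrite /clamp le_max lexx /= ge_max T0 ge_min lexx. Qed.

Lemma clamp_id T t : 0 <= t <= T -> clamp T t = t.
Proof. by move=> /andP[t0 tT]; rewrite /clamp (min_idPr tT) (max_idPr t0). Qed.

Lemma continuous_clamp T : continuous (clamp T).
Proof.
move=> t; apply: (@continuous_max R R (cst 0) (fun t => Num.min T t) t); first exact: cvg_cst.
by apply: (@continuous_min R R (cst T) id t); [exact: cvg_cst|exact: cvg_id].
Qed.

Definition continuous_on T q := forall t, 0 <= t <= T ->
  q s @[s --> within [set t | 0 <= t <= T] (nbhs t)] --> q t.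

Lemma continuous_on_clamp T q : 0 <= T -> continuous_on T q -> continuous (q \o clamp T).
Proof.
move=> T0 cq t; apply: (cvg_comp (clamp T) q _ (cq _ (clamp_bounds t T0))).
move=> U HU; have HU' : \forall s \near t, 0 <= clamp T s <= T -> U (clamp T s).
  exact: (@continuous_clamp T t _ HU).
suff : \forall s \near t, U (clamp T s) by [].
by apply: filterS HU' => s; apply; exact: clamp_bounds.
Qed.

(** Continuous extension from [0, T] to the line with bounded support, as [antiderivative] asks: the
    value at the nearest endpoint times a tent of width 1. *)
Definition extend T q t := q (clamp T t) * Num.max 0 (1 - `|t - clamp T t|).

Lemma continuous_extend T q : 0 <= T -> continuous_on T q -> continuous (extend T q).
Proof.
move=> T0 cq t; apply: cvgM; first exact: continuous_on_clamp.
apply: (@continuous_max R R (cst 0) (fun t => 1 - `|t - clamp T t|) t); first exact: cvg_cst.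
apply: cvgB; first exact: cvg_cst.
by apply: cvg_norm; apply: cvgB; [exact: cvg_id|exact: continuous_clamp].
Qed.

Lemma extend_id T q t : 0 <= t <= T -> extend T q t = q t.
Proof. by move=> tT; rewrite /extend clamp_id// subrr normr0 subr0 (max_idPr ler01) mulr1. Qed.

Lemma extend_support T q t : 0 <= T -> T + 1 < `|t| -> extend T q t = 0.
Proof.
move=> T0 Tt; rewrite /extend (max_idPl _) ?mulr0// subr_le0.
have /andP[c0 cT] := clamp_bounds t T0.
have := lerB_dist t (clamp T t); rewrite (ger0_norm c0); lra.
Qed.

Lemma continuous_extend_eq0 T q : 0 < T -> continuous_on T q ->
  (forall t, 0 < t < T -> q t = 0) -> forall t, 0 <= t <= T -> q t = 0.
Proof.
move=> T0 cq q0 t /[dup] tT /andP[t0 tT'].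
apply/eqP/negPn/negP => qt.
have ce := continuous_extend (ltW T0) cq.
have : \forall s \near t, extend T q s != 0.
  apply: (@cvgr_neq0 _ R^o _ _ _ _ _ (ce t)).
  by rewrite extend_id.
move=> /nbhs_ballP[d /= d0 Hd].
pose eta := Num.min 1 (d / T).
have eta0 : 0 < eta by rewrite lt_min ltr01 divr_gt0.
have eta1 : eta <= 1 by rewrite ge_min lexx.
have etad : eta * T <= d by rewrite -ler_pdivlMr// ge_min lexx orbT.
(* A point pulled from t towards the midpoint lies in the open interval, and eta T <= d keeps it in
   the ball. *)
pose s := t + eta * (T / 2 - t).
have e1 : 0 <= (1 - eta) * t by rewrite mulr_ge0// subr_ge0.
have e2 : 0 < eta * T by rewrite mulr_gt0.
have e3 : 0 <= (1 - eta) * (T - t) by rewrite mulr_ge0// subr_ge0.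
have s0T : 0 < s < T by rewrite /s; apply/andP; split; lra.
have e4 : 0 <= eta * t by rewrite mulr_ge0// ltW.
have e5 : 0 <= eta * (T - t) by rewrite mulr_ge0 ?subr_ge0// ltW.
have : ball t d s.
  rewrite /ball /= /s opprD addNKr normrN ltr_norml; apply/andP; split; lra.
move=> /Hd /=; rewrite extend_id; last by case/andP: s0T => a b; rewrite !ltW.
by rewrite q0// eqxx.
Qed.

(** The lemma of du Bois-Reymond: with P the primitive of q starting from a0, the difference b = a -
    P is tested against itself. As test functions may be nonzero at 0, the initial value is obtained
    at the same time. *)
Lemma weak_derivative T (a q : R -> R) (a0 : R) : 0 < T ->
  continuous_on T a -> continuous_on T q ->
  (forall chi dchi : R -> R, (forall t, is_derive t 1 chi (dchi t)) -> continuous dchi ->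
    (exists2 d : R, 0 < d & forall t, T - d <= t -> chi t = 0) ->
    \int[leb]_(t in `[0, T]) (dchi t * a t + chi t * q t) = - (chi 0 * a0)) ->
  exists P Pd : R -> R, [/\ forall t, is_derive t 1 P (Pd t),
    forall t, 0 <= t <= T -> Pd t = q t,
    forall t, 0 <= t <= T -> P t = a t & P 0 = a0].
Proof.
move=> T0 ca cq H; have T0' := ltW T0.
have cqe := continuous_extend T0' cq.
have [P1 dP1] := antiderivative cqe (fun t => @extend_support T q t T0').
pose P t := P1 t - P1 0 + a0.
have dP t : is_derive t 1 P (extend T q t).
  have := is_deriveD (is_deriveB (dP1 t) (is_derive_cst (P1 0) t 1)) (is_derive_cst a0 t 1).
  by rewrite subr0 addr0.
have cP := derivable_is_continuous dP.
pose b t := a t - P t.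
have cb : continuous_on T b.
  move=> t tT; apply: cvgB; first exact: ca.
  by apply: cvg_within_filter; exact: cP.
have cbe := continuous_extend T0' cb.
have b0 : forall t, 0 <= t <= T -> b t = 0.
  apply: continuous_extend_eq0 => // t /andP[t0 tT].
  pose d := (T - t) / 2.
  have d0 : 0 < d by rewrite divr_gt0// subr_gt0.
  (* The derivative of the test function is b, damped so as to vanish from T - d on. At t the
     damping factor is T - d - t = d > 0. *)
  pose c s := extend T b s * Num.max 0 (T - d - s).
  have cc : continuous c.
    move=> s; apply: cvgM; first exact: cbe.
    apply: (@continuous_max R R (cst 0) (fun s => T - d - s) s); first exact: cvg_cst.
    by apply: cvgB; [exact: cvg_cst|exact: cvg_id].
  have csup s : T + 1 < `|s| -> c s = 0 by move=> Hs; rewrite /c extend_support// mul0r.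
  have [C dC] := antiderivative cc csup.
  pose chi s := C s - C T.
  have dchi (s : R) : is_derive s 1 chi (c s).
    have := is_deriveB (dC s) (is_derive_cst (C T) s 1).
    by rewrite subr0.
  have c0 s : T - d <= s -> c s = 0.
    by move=> Hs; rewrite /c (max_idPl _) ?mulr0//; lra.
  have chi0 s : T - d <= s -> chi s = 0.
    move=> Hs; rewrite /chi; apply/eqP; rewrite subr_eq0; apply/eqP.
    have [sT|Ts] := leP s T.
      by apply: (is_derive_const sT dC) => x /andP[sx _]; apply: c0; exact: le_trans sx.
    apply/esym; apply: (is_derive_const (ltW Ts) dC) => x /andP[sx _]; apply: c0.
    by apply: le_trans sx; rewrite gerBl ltW.
  have HW := H chi c dchi cc (ex_intro2 _ _ d d0 chi0).
  have dF (s : R) : is_derive s 1 (fun s => chi s * P s) (c s * P s + chi s * extend T q s).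
    have := is_deriveM (dchi s) (dP s); rewrite /GRing.scale /= addrC [X in X + _]mulrC.
    by [].
  have cchi := derivable_is_continuous dchi.
  have cf : continuous (fun s => c s * P s + chi s * extend T q s).
    by move=> s; exact: cvgD (cvgM (cc s) (cP s)) (cvgM (cchi s) (cqe s)).
  have HF := Rintegral_derivative T0 dF cf.
  pose h s := c s * extend T b s.
  have ch : continuous h by move=> s; exact: cvgM (cc s) (cbe s).
  have hE s : h s = extend T b s ^+ 2 * Num.max 0 (T - d - s) by rewrite /h /c mulrAC -expr2.
  have h0 s : 0 <= h s by rewrite hE mulr_ge0 ?sqr_ge0// le_max lexx.
  have hs s : T + 1 < `|s| -> h s = 0 by move=> /csup; rewrite /h => ->; rewrite mul0r.
  have iab (f : R -> R) : continuous f -> leb.-integrable `[0, T] (EFin \o f).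
    move=> cf'; apply: continuous_compact_integrable; first exact: segment_compact.
    exact: continuous_subspaceT.
  (* The integral of the derivative of chi P is - chi 0 * a0, as chi T = 0 and P 0 = a0. Subtracting
     it from the weak identity leaves the integral of c b. *)
  have hi : \int[leb]_(s in `[0, T]) h s = 0.
    have E : \int[leb]_(s in `[0, T]) (h s + (c s * P s + chi s * extend T q s)) = - (chi 0 * a0).
      rewrite -HW; apply: eq_Rintegral => s; rewrite inE /= in_itv /= => sT.
      by rewrite /h !extend_id// /b; ring.
    move: E; rewrite RintegralD//; [|exact: iab|exact: iab].
    rewrite HF chi0 ?mul0r ?sub0r; last by rewrite gerBl ltW.
    rewrite /P subrr add0r; move/(canRL (addrK _)); rewrite opprK addNr.
    by [].
  have := zero_of_zero_integral T0 ch h0 hs hi.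
  move=> /(_ t); rewrite t0 tT hE => /(_ isT)/eqP.
  rewrite mulf_eq0 sqrf_eq0 extend_id; last by rewrite !ltW.
  case/orP=> [/eqP//|]; rewrite (max_idPr _).
    by rewrite /d => /eqP; lra.
  by rewrite /d; lra.
exists P, (extend T q); split => //.
- by move=> t tT; rewrite extend_id.
- by move=> t /b0 /eqP; rewrite subr_eq0 => /eqP.
- by rewrite /P subrr add0r.
Qed.

End one_variable.

(* Solutions are nonnegative only almost everywhere; replacing f by |f| makes
   the pointwise estimates applicable. *)
Section absolute_value.
Context {R : realType} {N : nat}.
Notation V := 'rV[R]_N.
Notation lam := (lebesgue_row R N).
Notation lam2 := (lebesgue_row R N \x lebesgue_row R N)%E.
Notation w4 := (@moment_weight R N 4).
Notation m := (@energy_weight R N).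

Variable f : V -> R.
Hypotheses (mf : measurable_fun setT f) (f0 : nonneg_ae f).

Let F v := `|f v|.

Lemma measurable_normr_fun : measurable_fun setT F.
Proof. exact: measurableT_comp. Qed.

Lemma Rintegral_abs (w : V -> R) : measurable_fun setT w ->
  \int[lam]_v (`|f v| * w v) = \int[lam]_v (f v * w v).
Proof.
move=> mw; rewrite /Rintegral; congr fine; apply: ae_eq_integral => //.
- by apply/measurable_EFinP; apply: measurable_funM => //; exact: measurable_normr_fun.
- by apply/measurable_EFinP; exact: measurable_funM.
- by apply: filterS f0 => v fv _; rewrite ger0_norm.
Qed.

(** The two integrands can differ only on the union of two cylinders over the null set where f is
    negative. *)
Lemma Rintegral_abs_prod (w : V * V -> R) : measurable_fun setT w ->
  \int[lam2]_p (`|f p.2| * `|f p.1| * w p) = \int[lam2]_p (f p.2 * f p.1 * w p).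
Proof.
move=> mw.
have mf1 : measurable_fun setT (fun p : V * V => f p.1) by exact: measurableT_comp mf measurable_fst.
have mf2 : measurable_fun setT (fun p : V * V => f p.2) by exact: measurableT_comp mf measurable_snd.
rewrite /Rintegral; congr fine; apply: ae_eq_integral => //.
- apply/measurable_EFinP; apply: measurable_funM => //.
  by apply: measurable_funM; exact: measurableT_comp.
- by apply/measurable_EFinP; apply: measurable_funM => //; exact: measurable_funM.
have mA : measurable [set v : V | f v < 0].
  rewrite (_ : [set _ | _] = setT `&` f @^-1` `]-oo, 0[%classic); first exact: mf.
  by rewrite setTI; apply/seteqP; split => v /=; rewrite in_itv.
have A0 : lam [set v : V | f v < 0] = 0%E.
  apply/(negligibleP _ mA); apply: negligibleS f0 => v /= fv /=.
  by apply/negP; rewrite -ltNge.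
apply: (@negligibleS _ _ _ _ (([set v : V | f v < 0] `*` setT) `|` (setT `*` [set v : V | f v < 0]))).
  move=> p /= H; apply: contrapT => /not_orP[/= n1 n2]; apply: H => _.
  rewrite !ger0_norm// leNgt; apply/negP => H; [apply: n1|apply: n2]; split => //.
apply: negligibleU; apply/negligibleP.
- exact: measurableX.
- have E := @product_measure1E _ _ _ _ _ lam lam _ _ mA measurableT.
  exact: etrans E (etrans (congr1 (fun x => (x * _)%E) A0) (mul0e _)).
- exact: measurableX.
- have E := @product_measure1E _ _ _ _ _ lam lam _ _ measurableT mA.
  exact: etrans E (etrans (congr1 (fun x => (_ * x)%E) A0) (mule0 _)).
Qed.

Lemma energy_abs : energy F = energy f.
Proof.
by apply: Rintegral_abs; apply: measurable_funX; exact: measurable_enorm.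
Qed.

(** The infimum in [variation_partial] is approached within 1 for each of the N derivatives, hence C
    + N. The parts of the near-optimal Jordan decomposition serve as the two finite measures. *)
Lemma BV_bounded_abs (C : R) : (BVnorm 4 f <= C%:E)%E -> BV_bounded (C + N%:R) F.
Proof.
move=> BC.
have w40 v : 0 <= w4 v by exact: moment_weight_ge0.
have L0 : (0 <= L1norm 4 f)%E.
  by apply: integral_ge0 => v _; rewrite lee_fin mulr_ge0//; exact: w40.
have v0 i : (0 <= variation_partial 4 i f)%E.
  apply: le_ereal_inf_tmp => _ [nu [P [M [PM [_ ->]]]]].
  by apply: integral_ge0 => v _; rewrite lee_fin; exact: w40.
have S0 : (0 <= \sum_(i < N) variation_partial 4 i f)%E by exact: sume_ge0.
have LC : (L1norm 4 f <= C%:E)%E by apply: le_trans BC; rewrite /BVnorm leeDl.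
have SC : (\sum_(i < N) variation_partial 4 i f <= C%:E)%E.
  by apply: le_trans BC; rewrite /BVnorm leeDr.
have vfin i : variation_partial 4 i f \is a fin_num.
  rewrite ge0_fin_numE//; apply: le_lt_trans (ltry C); apply: le_trans SC.
  by rewrite (bigD1 i)//= leeDl// sume_ge0.
have [iw lw] : lam.-integrable setT (EFin \o (fun v => F v * w4 v)) /\
    \int[lam]_v (F v * w4 v) <= C.
  apply: integrable_EFin_fin => //.
    by apply: measurable_funM; [exact: measurable_normr_fun|exact: measurable_moment_weight].
  by move=> v; exact: mulr_ge0 (normr_ge0 _) (w40 v).
have H i : exists PQ : {finite_measure set V -> \bar R} * {finite_measure set V -> \bar R},
    [/\ forall phi, measurable_smooth phi -> bounded_support phi -> \int[lam]_v (F v * partial i phi v) =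
          - (\int[PQ.1]_v phi v - \int[PQ.2]_v phi v),
        PQ.1.-integrable setT (EFin \o w4), PQ.2.-integrable setT (EFin \o w4) &
        \int[PQ.1]_v w4 v + \int[PQ.2]_v w4 v <= fine (variation_partial 4 i f) + 1].
  have [_ [nu [P [M [PM [dnu ->]]]]] Hnu] := lb_ereal_inf_adherent ltr01 (vfin i).
  rewrite (@eq_measure_integral _ _ _ _ (measure_add (jordan_pos PM) (jordan_neg PM))) in Hnu; last first.
    by move=> A mA _; apply/esym; exact: measure_addE.
  have mw : measurable_fun setT (EFin \o w4) by apply/measurable_EFinP; exact: measurable_moment_weight.
  rewrite ge0_integral_measure_add// in Hnu; last by move=> v _; rewrite lee_fin; exact: w40.
  rewrite -/(variation_partial 4 i f) -(fineK (vfin i)) -EFinD in Hnu.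
  set a := (\int[jordan_pos PM]_x _)%E in Hnu; set b := (\int[jordan_neg PM]_x _)%E in Hnu.
  have a0 : (0 <= a)%E by apply: integral_ge0 => v _; rewrite lee_fin; exact: w40.
  have b0 : (0 <= b)%E by apply: integral_ge0 => v _; rewrite lee_fin; exact: w40.
  have al : (a <= (fine (variation_partial 4 i f) + 1)%:E)%E.
    by apply: le_trans (ltW Hnu); rewrite leeDl.
  have bl : (b <= (fine (variation_partial 4 i f) + 1)%:E)%E.
    by apply: le_trans (ltW Hnu); rewrite leeDr.
  have [ia _] := integrable_EFin_fin (measurable_moment_weight 4) w40 al.
  have [ib _] := integrable_EFin_fin (measurable_moment_weight 4) w40 bl.
  exists (jordan_pos PM : {finite_measure set V -> \bar R}, jordan_neg PM : {finite_measure set V -> \bar R}).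
  split => //=.
    move=> phi sphi bphi; rewrite Rintegral_abs.
      by apply: dnu; exact: test_function_bounded_support.
    by apply: measurable_smooth_fun; exact: measurable_smooth_partial.
  rewrite -lee_fin EFinD -!Rintegral_EFin//; exact: ltW.
have {H} [PQ HPQ] := choice H.
split => //.
- exact: measurable_normr_fun.
- by move=> v; exact: normr_ge0.
- by rewrite (le_trans lw)// lerDl.
exists (fun i => (PQ i).1), (fun i => (PQ i).2); split.
- by move=> i; have [] := HPQ i.
- by move=> i; have [] := HPQ i.
- by move=> i; have [] := HPQ i.
apply: (@le_trans _ _ (\sum_(i < N) (fine (variation_partial 4 i f) + 1))).
  by apply: ler_sum => i _; have [] := HPQ i.
rewrite big_split /= lerD//.
  by rewrite -lee_fin -sumEFin; under eq_bigr do rewrite fineK//.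
by rewrite sumr_const card_ord.
Qed.

End absolute_value.

(** * Distance between two collision operators *)

Section collision_difference.
Context {R : realType} {N : nat}.
Notation V := 'rV[R]_N.
Notation S := (@sphere_measure R N).
Notation lam := (lebesgue_row R N).
Notation lam2 := (lebesgue_row R N \x lebesgue_row R N)%E.
Notation w4 := (@moment_weight R N 4).
Notation m := (@energy_weight R N).
Notation K0 := (@mollify_const R N).

Let w40 (v : V) : 0 <= w4 v. Proof. exact: moment_weight_ge0. Qed.
Let m0 (v : V) : 0 <= m v. Proof. exact: energy_weight_ge0. Qed.
Let w10 (v : V) : 0 <= 1 + enorm v. Proof. by rewrite addr_ge0// enorm_ge0. Qed.

Lemma energy_weight_le_moment4 (v : V) : m v <= 4 * w4 v.
Proof.
apply: le_trans (weight3_le v); rewrite ler_peMl// lerDl; exact: enorm_ge0.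
Qed.

Lemma integrable_weighted_difference (C : R) (f g w : V -> R) (k : R) :
  BV_bounded C f -> BV_bounded C g -> measurable_fun setT w -> 0 <= k ->
  (forall v, 0 <= w v <= k * w4 v) ->
  lam.-integrable setT (EFin \o (fun v => `|f v - g v| * w v)) /\
  \int[lam]_v (`|f v - g v| * w v) <= 2 * k * C.
Proof.
move=> [mf f0 fw fC _] [mg g0 gw gC _] mw k0 wk.
have [i1 l1] := integrable_moment_le mf f0 mw wk fw fC k0.
have [i2 l2] := integrable_moment_le mg g0 mw wk gw gC k0.
have w0 v : 0 <= w v by have /andP[] := wk v.
have le v : `|f v - g v| * w v <= f v * w v + g v * w v.
  rewrite -mulrDl ler_wpM2r// (le_trans (ler_normB _ _))//.
  by rewrite !ger0_norm.
have mfg : measurable_fun setT (fun v => `|f v - g v| * w v).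
  by apply: measurable_funM => //; apply: measurableT_comp => //; exact: measurable_funB.
have i : lam.-integrable setT (EFin \o (fun v => `|f v - g v| * w v)).
  apply: (le_integrable_EFin mfg _ (integrable_EFinD i1 i2)) => v.
  by rewrite ger0_norm// mulr_ge0.
split => //; apply: le_trans (le_Rintegral _ i (integrable_EFinD i1 i2) (fun v _ => le v)) _ => //.
rewrite RintegralD//; apply: le_trans (lerD l1 l2) _.
by rewrite le_eqVlt; apply/orP; left; apply/eqP; ring.
Qed.

Definition energy_distance (f g : V -> R) : R := \int[lam]_v (`|f v - g v| * m v).

(** The weight is that of [sign_defect]. This distance controls how the defect and the bracket
    change in time. *)
Definition cubic_distance (f g : V -> R) : R :=
  \int[lam]_v (`|f v - g v| * ((1 + enorm v) * m v)).

Definition sign_defect (f g psi : V -> R) : R :=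
  \int[lam]_v ((`|f v - g v| * m v - (f v - g v) * psi v) * (1 + enorm v)).

Section pair.
Variables (C : R) (f g : V -> R).
Hypotheses (Hf : BV_bounded C f) (Hg : BV_bounded C g).

Let mf : measurable_fun setT f. Proof. by case: Hf. Qed.
Let mg : measurable_fun setT g. Proof. by case: Hg. Qed.

Lemma integrable_energy_distance :
  lam.-integrable setT (EFin \o (fun v => `|f v - g v| * m v)).
Proof.
exact: (integrable_weighted_difference (k := 4) Hf Hg (@measurable_energy_weight R N)
  (ler0n _ _) (fun v => introT andP (conj (m0 v) (energy_weight_le_moment4 v)))).1.
Qed.

Lemma integrable_cubic_distance :
  lam.-integrable setT (EFin \o (fun v => `|f v - g v| * ((1 + enorm v) * m v))).
Proof.
exact: (integrable_weighted_difference (k := 4) Hf Hg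
  (measurable_funM (@measurable_cst_enorm R N) (@measurable_energy_weight R N))
  (ler0n _ _) (fun v => introT andP (conj (mulr_ge0 (w10 v) (m0 v)) (weight3_le v)))).1.
Qed.

Lemma energy_distance_ge0 : 0 <= energy_distance f g.
Proof. by apply: Rintegral_ge0 => v _; rewrite mulr_ge0. Qed.

Lemma energy_distance_le_cubic : energy_distance f g <= cubic_distance f g.
Proof.
apply: le_Rintegral => //; [exact: integrable_energy_distance|exact: integrable_cubic_distance|].
by move=> v _; rewrite ler_wpM2l// ler_peMl// lerDl enorm_ge0.
Qed.

(** From eta (r (1/eta - r))^2 >= 0: twice the cubic moment is at most r^2 / eta + eta r^4. *)
Lemma cubic_distance_interpolation (eta : R) : 0 < eta ->
  cubic_distance f g <= (3 + eta^-1) * energy_distance f g + eta * (4 * C).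
Proof.
move=> e0.
have [i4 l4] := integrable_weighted_difference (w := w4) (k := 1) Hf Hg
  (measurable_moment_weight 4) ler01 (fun v => introT andP (conj (w40 v) (eq_ind _ (fun x => w4 v <= x) (lexx _) _ (esym (mul1r _))))).
have ie := integrable_energy_distance.
apply: (@le_trans _ _ ((3 + eta^-1) * energy_distance f g + eta * \int[lam]_v (`|f v - g v| * w4 v))).
  rewrite /energy_distance -!RintegralZl// -RintegralD//; last 2 first.
  - exact: integrable_EFinZ.
  - exact: integrable_EFinZ.
  apply: le_Rintegral => //.
  - exact: integrable_cubic_distance.
  - by apply: integrable_EFinD; exact: integrable_EFinZ.
  move=> v _.
  rewrite [leRHS](_ : _ = `|f v - g v| * ((3 + eta^-1) * m v + eta * w4 v)); last by ring.
  rewrite ler_wpM2l//.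
  rewrite /energy_weight /moment_weight; have := enorm_ge0 v; move: (enorm v) => r r0.
  have ei0 : 0 < eta^-1 by rewrite invr_gt0.
  have h1 : 0 <= eta * (r * (eta^-1 - r)) ^+ 2 by rewrite mulr_ge0 ?sqr_ge0// ltW.
  have h2 : eta * (r * (eta^-1 - r)) ^+ 2 = eta^-1 * r ^+ 2 - 2 * r ^+ 3 + eta * r ^+ 4.
    by field; rewrite gt_eqF.
  have h3 := sqr_ge0 (1 - r); have h4 := sqr_ge0 r.
  have h5 : 0 <= eta * r ^+ 4 by rewrite mulr_ge0 ?exprn_ge0// ltW.
  have h6 : 0 <= eta^-1 * r ^+ 2 by rewrite mulr_ge0 ?exprn_ge0// ltW.
  rewrite h2 in h1; rewrite sqrrB expr1n mul1r in h3.
  rewrite !mulrDl !mulrDr !mul1r !mulr1 -exprS.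
  lra.
rewrite lerD2l ler_wpM2l ?(ltW e0)//; apply: le_trans l4 _.
have C0 : 0 <= C by case: Hf => _ f0 _ fC _; apply: le_trans fC; apply: Rintegral_ge0 => v _; rewrite mulr_ge0.
lra.
Qed.

Lemma integrable_sign_defect (psi : V -> R) : measurable_fun setT psi ->
  (forall v, `|psi v| <= m v) ->
  lam.-integrable setT (EFin \o (fun v => (`|f v - g v| * m v - (f v - g v) * psi v) * (1 + enorm v))).
Proof.
move=> mpsi psim.
apply: (le_integrable_EFin (g := fun v => 2 * (`|f v - g v| * ((1 + enorm v) * m v)))).
- apply: measurable_funM; last exact: measurable_cst_enorm.
  apply: measurable_funB; apply: measurable_funM => //; last exact: measurable_funB.
    by apply: measurableT_comp => //; exact: measurable_funB.
  exact: measurable_energy_weight.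
- move=> v; rewrite normrM (ger0_norm (w10 v)).
  rewrite (_ : 2 * _ = (`|f v - g v| * m v + `|f v - g v| * m v) * (1 + enorm v)); last by ring.
  rewrite ler_wpM2r// (le_trans (ler_normB _ _))// !normrM normr_id (ger0_norm (m0 v)) lerD2l.
  by rewrite ler_wpM2l.
- by apply: integrable_EFinZ; exact: integrable_cubic_distance.
Qed.

Lemma sign_defect_ge0 (psi : V -> R) : (forall v, `|psi v| <= m v) -> 0 <= sign_defect f g psi.
Proof.
move=> psim; apply: Rintegral_ge0 => v _; rewrite mulr_ge0// subr_ge0.
by rewrite (le_trans (ler_norm _))// normrM ler_wpM2l.
Qed.

Lemma sign_defect_le (psi : V -> R) : measurable_fun setT psi -> (forall v, `|psi v| <= m v) ->
  sign_defect f g psi <= 2 * cubic_distance f g.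
Proof.
move=> mpsi psim; rewrite -RintegralZl//; last exact: integrable_cubic_distance.
apply: le_Rintegral => //; first exact: integrable_sign_defect.
  by apply: integrable_EFinZ; exact: integrable_cubic_distance.
move=> v _.
rewrite (_ : 2 * _ = (`|f v - g v| * m v + `|f v - g v| * m v) * (1 + enorm v)); last by ring.
rewrite ler_wpM2r// lerD2l -mulNr (le_trans (ler_norm _))// normrM normrN.
by rewrite ler_wpM2l.
Qed.

Lemma energy_distanceC : energy_distance f g = energy_distance g f.
Proof. by apply: eq_Rintegral => v _; rewrite distrC. Qed.

Lemma cubic_distanceC : cubic_distance f g = cubic_distance g f.
Proof. by apply: eq_Rintegral => v _; rewrite distrC. Qed.

Lemma normr_energyB_le : `|energy g - energy f| <= energy_distance f g.
Proof.
have mw : measurable_fun setT (fun v : V => enorm v ^+ 2).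
  by apply: measurable_funX; exact: measurable_enorm.
have wle (v : V) : 0 <= enorm v ^+ 2 <= 4 * w4 v.
  by rewrite sqr_ge0 (le_trans _ (energy_weight_le_moment4 v))// lerDr.
have [_ f0 fw fC _] := Hf; have [_ g0 gw gC _] := Hg.
have [i1 _] := integrable_moment_le mf f0 mw wle fw fC (ler0n _ _).
have [i2 _] := integrable_moment_le mg g0 mw wle gw gC (ler0n _ _).
rewrite /energy -RintegralB//; apply: normr_Rintegral_le.
- exact: integrableEFin_fun (integrable_EFinB i2 i1).
- move=> v; rewrite -mulrBl normrM distrC ler_wpM2l// ger0_norm ?sqr_ge0//.
  by rewrite lerDr.
- exact: integrable_energy_distance.
Qed.

End pair.

Variables (alpha : R -> {nonneg R}) (beta : R -> V -> probability V R).
Variables (bt : R -> R -> R -> R) (e : R -> R).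
Hypotheses (Hbt : bounded_density bt) (He : restitution e)
  (Hform : inelastic_form alpha beta bt e) (HL : @lipschitz_in_energy R N bt e).
Local Notation B := (collision_rate alpha beta).

(** The constant c is fixed before C, f and g. The bilinear part is linear in C, the change of
    energy quadratic, hence C + C^2. *)
Lemma Qweak_difference (K : set R) : compact_pos K -> exists2 c : R, 0 <= c &
  forall (C : R) (f g psi : V -> R), BV_bounded C f -> BV_bounded C g ->
    K (energy f) -> K (energy g) ->
    measurable_fun setT psi -> (forall v, `|psi v| <= m v) ->
    Qweak B f psi - Qweak B g psi <=
    c * (C + C ^+ 2) * (energy_distance f g + sign_defect f g psi).
Proof.
move=> HK; have [c1 c10 Hc1] := @bilinear_estimate R N bt e Hbt He.
have [M M0 kM] := @kernel_bound R N bt Hbt.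
have [L L0 HLK] := HL HK.
pose c2 := (512 * M * K0 ^+ 2 * fine (S setT) + 1024) * L.
have c20 : 0 <= c2.
  have h1 : 0 <= 512 * M * K0 ^+ 2 * fine (S setT).
    exact: mulr_ge0 (mulr_ge0 (mulr_ge0 (ler0n _ _) M0) (sqr_ge0 _)) (fine_ge0 (measure_ge0 _ _)).
  exact: mulr_ge0 (addr_ge0 h1 (ler0n _ _)) (ltW L0).
exists (c1 + c2) => [|C f g psi Hf Hg Kf Kg mpsi psim]; first exact: addr_ge0.
have Ef0 : 0 < energy f := HK.2 _ Kf.
have Eg0 : 0 < energy g := HK.2 _ Kg.
rewrite (Qweak_collision_average Hbt Hform Ef0 mpsi).
rewrite (Qweak_collision_average Hbt Hform Eg0 mpsi).
have [mf f0 fw fC _] := Hf; have [mg g0 gw gC _] := Hg.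
have C0 : 0 <= C by apply: le_trans fC; apply: Rintegral_ge0 => v _; rewrite mulr_ge0.
have H1 := Hc1 (energy f) C psi f g Ef0 mpsi psim mf f0 mg g0 fw fC gw gC.
have [h1 h2] := HLK _ _ Kf Kg.
have HLu (u : V) : u != 0 ->
    (density_distance bt (energy g) (energy f) u <= (L * `|energy g - energy f|)%:E)%E.
  by move=> u0; apply: le_trans h1; apply: ereal_sup_ubound; exists u.
have H2 := energy_difference_le Hbt He Ef0 Eg0 mpsi psim HLu h2 M0 (fun u s => kM _ u s Ef0) Hg.
have n0 := energy_distance_ge0 f g; have R0 := sign_defect_ge0 f g psim.
(* The difference of energies is itself bounded by the distance of f and g, which closes the
   estimate. *)
have dE := normr_energyB_le Hf Hg.
rewrite -/(energy_distance f g) -/(sign_defect f g psi) in H1.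
have H3 : (512 * M * K0 ^+ 2 * fine (S setT) + 1024) * C ^+ 2 * (L * `|energy g - energy f|) <=
    c2 * C ^+ 2 * energy_distance f g.
  rewrite (_ : _ * _ * (L * _) = c2 * C ^+ 2 * `|energy g - energy f|); last by rewrite /c2; ring.
  by rewrite ler_wpM2l// mulr_ge0// sqr_ge0.
have H4 := le_trans (ler_norm _) (le_trans H2 H3).
have p1 : 0 <= c1 * C ^+ 2 * (energy_distance f g + sign_defect f g psi).
  by rewrite mulr_ge0 ?addr_ge0// mulr_ge0// sqr_ge0.
have p2 : 0 <= c2 * C * (energy_distance f g + sign_defect f g psi).
  by rewrite mulr_ge0 ?addr_ge0// mulr_ge0.
have p3 : 0 <= c2 * C ^+ 2 * sign_defect f g psi by rewrite mulr_ge0// mulr_ge0// sqr_ge0.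
have p4 : 0 <= c2 * C ^+ 2 * energy_distance f g by rewrite mulr_ge0// mulr_ge0// sqr_ge0.
move: H1 H4 p1 p2 p3 p4; clear.
move: (energy_distance f g) (sign_defect f g psi) c2 => n r c2.
move: (\int[_]_p _) (\int[_]_p _) (\int[_]_p _) => x y z.
lra.
Qed.

(** Exchanging f and g makes the estimate two-sided; 3 counts the energy distance once and the
    defect twice, in terms of the cubic distance. This yields the continuity of the bracket in
    time. *)
Lemma Qweak_distance (K : set R) : compact_pos K -> exists2 c : R, 0 <= c &
  forall (C : R) (f g psi : V -> R), BV_bounded C f -> BV_bounded C g ->
    K (energy f) -> K (energy g) ->
    measurable_fun setT psi -> (forall v, `|psi v| <= m v) ->
    `|Qweak B f psi - Qweak B g psi| <= c * (C + C ^+ 2) * cubic_distance f g.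
Proof.
move=> HK; have [c c0 Hc] := Qweak_difference HK.
exists (3 * c) => [|C f g psi Hf Hg Kf Kg mpsi psim]; first by rewrite mulr_ge0.
have C0 : 0 <= C.
  by case: Hf => _ f0 _ fC _; apply: le_trans fC; apply: Rintegral_ge0 => v _; rewrite mulr_ge0.
have cC : 0 <= c * (C + C ^+ 2) by rewrite mulr_ge0// addr_ge0// sqr_ge0.
have le3 (f' g' : V -> R) : BV_bounded C f' -> BV_bounded C g' ->
    energy_distance f' g' + sign_defect f' g' psi <= 3 * cubic_distance f' g'.
  move=> Hf' Hg'; have := energy_distance_le_cubic Hf' Hg'.
  by have := sign_defect_le Hf' Hg' mpsi psim; lra.
have H1 := le_trans (Hc _ _ _ _ Hf Hg Kf Kg mpsi psim) (ler_wpM2l cC (le3 _ _ Hf Hg)).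
have H2 := le_trans (Hc _ _ _ _ Hg Hf Kg Kf mpsi psim) (ler_wpM2l cC (le3 _ _ Hg Hf)).
rewrite (cubic_distanceC g f) in H2.
move: H1 H2; clear; move: (Qweak _ _ _) (Qweak _ _ _) (cubic_distance _ _) => x y z H1 H2.
rewrite ler_norml; apply/andP; split; lra.
Qed.

End collision_difference.

Section projections.
Context {R : realType} (U W : normedModType R).
Lemma differentiable_fst (p : U * W) : differentiable (fst : U * W -> U) p.
Proof.
have lf : linear (fst : U * W -> U) by [].
pose f : {linear (U * W)%type -> U} := HB.pack (fst : U * W -> U) (GRing.isLinear.Build _ _ _ _ _ lf).
apply: (linear_differentiable (f := f)) => x; exact: cvg_fst.
Qed.

Lemma differentiable_snd (p : U * W) : differentiable (snd : U * W -> W) p.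
Proof.
have lf : linear (snd : U * W -> W) by [].
pose f : {linear (U * W)%type -> W} := HB.pack (snd : U * W -> W) (GRing.isLinear.Build _ _ _ _ _ lf).
apply: (linear_differentiable (f := f)) => x; exact: cvg_snd.
Qed.
End projections.

(** * Test functions with separated time and velocity *)

Section product_test.
Context {R : realType} {N : nat}.
Notation V := 'rV[R]_N.
Variables (chi dchi : R -> R) (psi : V -> R).
Hypotheses (dc : forall t : R, is_derive t 1 chi (dchi t)) (cdc : continuous dchi)
  (spsi : measurable_smooth psi) (bpsi : bounded_support psi).

Let phi (p : R * V) : R := chi p.1 * psi p.2.

Let dchi1 (p : R * V) : differentiable (fun p : R * V => chi p.1) p.
Proof.
apply: (@differentiable_comp _ _ _ _ fst chi) => //; first exact: differentiable_fst.
by apply/derivable1_diffP; have [] := dc p.1.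
Qed.

Let dpsi2 (p : R * V) : differentiable (fun p : R * V => psi p.2) p.
Proof.
apply: (@differentiable_comp _ _ _ _ snd psi) => //; first exact: differentiable_snd.
exact: measurable_smooth_diff.
Qed.

Lemma derive_scale (c t : R) : 'D_c chi t = c * dchi t.
Proof.
have df : differentiable chi t by apply/derivable1_diffP; have [] := dc t.
rewrite deriveE// -[c in LHS]mulr1 linearZ /= -deriveE//.
by have [_ ->] := dc t.
Qed.

Lemma derive_product (h p : R * V) :
  'D_h phi p = chi p.1 * 'D_(h.2) psi p.2 + psi p.2 * (h.1 * dchi p.1).
Proof.
have := @deriveM R (R * V)%type (fun p => chi p.1) (fun p => psi p.2) p h
  (diff_derivable (dchi1 p)) (diff_derivable (dpsi2 p)).
by rewrite -derive_scale.
Qed.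

(** Only t >= 0 matters for the support, so [chi] needs to vanish near and after T but not for
    negative times. *)
Lemma time_test_product (T : R) :
  (exists2 d : R, 0 < d & forall t, T - d <= t -> chi t = 0) -> time_test T phi.
Proof.
move=> [d d0 chi0]; split.
  split=> [p|h p]; first exact: (differentiableM (dchi1 p) (dpsi2 p)).
  under eq_fun do rewrite derive_product.
  have c1 : {for p, continuous (fun p : R * V => chi p.1)}.
    exact/differentiable_continuous.
  have c2 : {for p, continuous (fun p : R * V => psi p.2)}.
    exact/differentiable_continuous.
  have c3 : {for p, continuous (fun p : R * V => dchi p.1)}.
    by apply: continuous_comp; [exact: cvg_fst|exact: cdc].
  have c4 : {for p, continuous (fun p : R * V => 'D_(h.2) psi p.2)}.
    have ck := (measurable_smooth_C1 spsi).2 h.2.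
    by apply: (@continuous_comp _ _ _ snd (fun v : V => 'D_(h.2) psi v) p); [exact: cvg_snd|exact: ck].
  exact: cvgD (cvgM c1 c4) (cvgM c2 (cvgM (cvg_cst _) c3)).
have [r Hr] := bpsi.
exists (`[0, T - d]%classic `*` [set v : V | forall j, `[- r, r]%classic (v ord0 j)]); split.
- apply: compact_setX; first exact: segment_compact.
  apply: (@rV_compact _ _ (fun=> `[- r, r]%classic)) => _; exact: segment_compact.
- move=> p [/=]; rewrite in_itv /= => /andP[p0 pT] _; rewrite p0 /=.
  by apply: le_lt_trans pT _; rewrite ltrBlDr ltrDl.
- move=> p /= p0; rewrite /phi mulf_eq0 => /norP[cp pp]; split => /=.
    rewrite in_itv /= p0 /= leNgt; apply: contra cp => /ltW/chi0 ->.
    exact: eqxx.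
  by move=> j; rewrite in_itv /= -ler_norml; exact: Hr.
Qed.

End product_test.

(** * Time derivatives of the tested solution *)

Section solution.
Context {R : realType} {N : nat}.
Notation V := 'rV[R]_N.
Notation S := (@sphere_measure R N).
Notation lam := (lebesgue_row R N).
Notation lam2 := (lebesgue_row R N \x lebesgue_row R N)%E.
Notation leb := (@lebesgue_measure R).
Notation w4 := (@moment_weight R N 4).
Notation m := (@energy_weight R N).

Variables (alpha : R -> {nonneg R}) (beta : R -> V -> probability V R).
Variables (bt : R -> R -> R -> R) (e : R -> R).
Hypotheses (Hbt : bounded_density bt) (He : restitution e)
  (Hform : inelastic_form alpha beta bt e).
Local Notation B := (collision_rate alpha beta).

Lemma collision_averageZ (E c : R) (psi : V -> R) (p : V * V) : 0 < E ->
  measurable_fun setT psi -> (forall v, `|psi v| <= m v) ->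
  collision_average bt e E (fun v => c * psi v) p = c * collision_average bt e E psi p.
Proof.
move=> E0 mpsi psim.
have i1 := integrable_EFinB (integrable_gain Hbt He E0 mpsi psim p (p.1 - p.2))
  (integrable_EFinZ (psi p.1 + psi p.2) (integrable_kernel Hbt (p.1 - p.2) E0)).
have i2 : S.-integrable setT (EFin \o (fun s => (gain e E psi p s - psi p.1 - psi p.2) *
    kernel bt E (p.1 - p.2) s)).
  rewrite (_ : EFin \o _ = EFin \o (fun s => gain e E psi p s * kernel bt E (p.1 - p.2) s -
    (psi p.1 + psi p.2) * kernel bt E (p.1 - p.2) s))//.
  by apply/funext => s; rewrite /= -mulrBl opprD addrA.
rewrite /collision_average -RintegralZl//; apply: eq_Rintegral => s _.
by rewrite /gain -mulrDr -!mulrBr mulrA.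
Qed.

(** At a fixed time the factor chi(t) of a product test function is a scalar, so linearity in the
    test function takes it out of the bracket; f is replaced by |f| at the same time. *)
Lemma Qweak_absZ (f psi : V -> R) (C c : R) : measurable_fun setT f -> nonneg_ae f ->
  0 < energy f -> BV_bounded C (fun v => `|f v|) ->
  measurable_fun setT psi -> (forall v, `|psi v| <= m v) ->
  Qweak B f (fun v => c * psi v) = c * Qweak B (fun v => `|f v|) psi.
Proof.
move=> mf f0 E0 [mF F0 Fw _ _] mpsi psim.
have EF := energy_abs mf f0.
have mcpsi : measurable_fun setT (fun v => c * psi v) by exact: measurable_funM.
rewrite (Qweak_collision_average Hbt Hform E0 mcpsi).
rewrite (Qweak_collision_average Hbt Hform _ mpsi) ?EF//.
have iF := integrable_collision Hbt He E0 mpsi psim mF F0 Fw.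
rewrite mulrCA; congr (_ * _); rewrite -RintegralZl//.
have mJ : measurable_fun setT (fun p => c * collision_average bt e (energy f) psi p).
  by apply: measurable_funM => //; exact: measurable_collision_average.
rewrite (eq_Rintegral _ (fun p _ => congr1 (fun x => _ * x)
  (collision_averageZ c p E0 mpsi psim))).
rewrite -(Rintegral_abs_prod mf f0 mJ).
by apply: eq_Rintegral => p _; rewrite mulrCA.
Qed.

Lemma L1_integrable_weight (f : V -> R) : L1 2 f ->
  lam.-integrable setT (EFin \o (fun v => `|f v| * m v)).
Proof.
move=> [mf fL]; apply/integrableP; split.
  apply/measurable_EFinP; apply: measurable_funM; last exact: measurable_energy_weight.
  exact: measurableT_comp.
apply: le_lt_trans fL; rewrite le_eqVlt; apply/orP; left; apply/eqP.
apply: eq_integral => v _; rewrite /= ger0_norm//.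
by rewrite mulr_ge0// energy_weight_ge0.
Qed.

Lemma L1_integrable_test (f psi : V -> R) : L1 2 f -> measurable_smooth psi ->
  bounded_support psi -> lam.-integrable setT (EFin \o (fun v => f v * psi v)).
Proof.
move=> Lf spsi bpsi; have im := L1_integrable_weight Lf; have [mf _] := Lf.
have [M M0 HM] := bounded_support_bounded spsi bpsi.
have mpsi := measurable_smooth_fun spsi.
apply: (le_integrable_EFin (measurable_funM mf mpsi) _ (integrable_EFinZ M im)) => v.
rewrite normrM mulrCA ler_wpM2l//; apply: le_trans (HM v) _.
by rewrite ler_peMr// energy_weight_ge1.
Qed.

Variables (T : R) (fin : V -> R) (f : R -> V -> R) (C : R).
Hypotheses (T0 : 0 < T) (Hf : boltzmann_solution B T fin f)
  (Ef : forall t, 0 <= t <= T -> 0 < energy (f t))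
  (HC : forall t, 0 <= t <= T -> BV_bounded C (fun v => `|f t v|)).

(** Product test functions reduce the weak formulation to an identity in time alone, to which
    [weak_derivative] applies. *)
Lemma solution_derivative (psi : V -> R) : measurable_smooth psi -> bounded_support psi ->
  (forall v, `|psi v| <= m v) ->
  continuous_on T (fun t => \int[lam]_v (f t v * psi v)) ->
  continuous_on T (fun t => Qweak B (fun v => `|f t v|) psi) ->
  exists P Pd : R -> R, [/\ forall t : R, is_derive t 1 P (Pd t),
    forall t, 0 <= t <= T -> Pd t = Qweak B (fun v => `|f t v|) psi,
    forall t, 0 <= t <= T -> P t = \int[lam]_v (f t v * psi v) &
    P 0 = \int[lam]_v (fin v * psi v)].
Proof.
move=> spsi bpsi psim ca cq; have mpsi := measurable_smooth_fun spsi.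
have [[fin1 _ _ _] [fL1 _] fnn fweak] := Hf.
apply: weak_derivative => // chi dchi dc cdc chi0.
have := fweak _ (time_test_product dc cdc spsi bpsi chi0).
rewrite (_ : \int[lam]_v (fin v * _) = chi 0 * \int[lam]_v (fin v * psi v)); last first.
  rewrite -RintegralZl//; last exact: L1_integrable_test.
  by apply: eq_Rintegral => v _; rewrite mulrCA.
move=> <-; apply: eq_Rintegral => t; rewrite inE /= in_itv /= => tT.
congr (_ + _).
  rewrite -RintegralZl//; last by apply: L1_integrable_test => //; exact: fL1.
  apply: eq_Rintegral => v _; rewrite (derive_product dc spsi) /=.
  have df : differentiable psi v by exact: measurable_smooth_diff.
  rewrite (deriveE _ df) linear0 mulr0 add0r mul1r.
  by rewrite mulrCA; congr (_ * _); rewrite mulrC.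
by rewrite (Qweak_absZ (chi t) _ (fnn _ tT) (Ef tT) (HC tT) mpsi psim)//; have [] := fL1 _ tT.
Qed.

End solution.

(** * Stability *)

Section gronwall.
Context {R : realType}.
Implicit Types (q : R -> R) (T t : R).

Lemma continuous_onP T q : (forall t, 0 <= t <= T -> forall eps, 0 < eps ->
    exists2 d : R, 0 < d & forall s, 0 <= s <= T -> `|s - t| < d -> `|q s - q t| <= eps) ->
  continuous_on T q.
Proof.
move=> H t tT; apply/cvgrPdist_le => eps e0.
have [d d0 Hd] := H t tT eps e0.
rewrite near_withinE; near=> s => sT.
have Hst : `|t - s| < d by near: s; exact: (nbhsx_ballx t d d0).
by rewrite distrC; apply: Hd; rewrite // distrC.
Unshelve. all: by end_near. Qed.

(* At a maximum of n(t) exp (- (c + 1) t) in ]0, T], the bound on the left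
   difference quotient forces n to vanish. *)
Lemma left_gronwall T (c : R) (n : R -> R) : 0 < T -> 0 <= c -> continuous_on T n ->
  (forall t, 0 <= n t) ->
  (forall t, 0 < t <= T -> forall eta, 0 < eta -> exists2 d : R, 0 < d &
    forall s, 0 <= s < t -> t - d < s -> n t - n s <= (t - s) * (c * n t + eta)) ->
  forall t, 0 <= t <= T -> n t <= n 0 * expR ((c + 1) * t).
Proof.
move=> T0 c0 cn n0 H t /[dup] tT /andP[t0 tT']; pose k := c + 1.
have k0 : 0 < k by rewrite ltr_wpDl.
pose y s := n (clamp T s) * expR (- (k * s)).
have cy : continuous y.
  move=> s; apply: cvgM; first exact: (continuous_on_clamp (ltW T0) cn).
  apply: (@continuous_comp _ _ _ (fun s => - (k * s)) expR); last exact: continuous_expR.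
  by apply: cvgN; apply: cvgM; [exact: cvg_cst|exact: cvg_id].
have [x] := EVT_max (ltW T0) (continuous_subspaceT cy).
rewrite in_itv /= => /[dup] xT /andP[x0 xT'] Hx.
have yE s : 0 <= s <= T -> y s = n s * expR (- (k * s)) by move=> sT; rewrite /y clamp_id.
have yle : y t <= n 0.
  apply: le_trans (Hx t _) _; first by rewrite in_itv /=.
  rewrite yE//; have [->|xn0] := eqVneq x 0; first by rewrite mulr0 oppr0 expR0 mulr1.
  have xp : 0 < x by rewrite lt_def xn0.
  have [nx|nx] := leP (n x) 0.
    apply: le_trans (n0 0); rewrite -[leRHS](mul0r (expR (- (k * x)))).
    by rewrite ler_wpM2r// expR_ge0.
  exfalso.
  have e0 : 0 < n x / 2 by rewrite divr_gt0.
  have [d d0 Hd] := H x (introT andP (conj xp xT')) _ e0.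
  (* The first two bounds keep x - h admissible. With the error eta = n(x) / 2, the third makes k -
     (c + 1/2) (1 + k h) positive, because k = c + 1 and k^2 h <= 1/2. *)
  pose h := Num.min (d / 2) (Num.min (x / 2) (2 * k ^+ 2)^-1).
  have h0 : 0 < h.
    by rewrite !lt_min !divr_gt0//= invr_gt0 mulr_gt0// exprn_gt0.
  have hd : h < d by apply: (@le_lt_trans _ _ (d / 2)); [rewrite ge_min lexx|lra].
  have hx : h < x.
    by apply: (@le_lt_trans _ _ (x / 2)); [rewrite /h !ge_min lexx !orbT|lra].
  have hk : h * (2 * k ^+ 2) <= 1.
    rewrite -ler_pdivlMr ?mul1r; last by rewrite mulr_gt0// exprn_gt0.
    by rewrite /h !ge_min lexx !orbT.
  have xh : 0 <= x - h by rewrite subr_ge0 ltW.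
  have xhx : x - h < x by rewrite ltrBlDr ltrDl.
  have xdh : x - d < x - h by rewrite ltrD2l ltrN2.
  have H1 := Hd (x - h) (introT andP (conj xh xhx)) xdh.
  have xhT : 0 <= x - h <= T by rewrite xh (le_trans (ltW xhx)).
  have := Hx (x - h); rewrite in_itv /= => /(_ xhT).
  rewrite !yE// => H2.
  (* Maximality of y at x, weakened by exp (k h) >= 1 + k h. *)
  have H3 : n (x - h) * (1 + k * h) <= n x.
    have E : expR (- (k * (x - h))) = expR (- (k * x)) * expR (k * h).
      by rewrite -expRD; congr expR; ring.
    rewrite E mulrCA [leRHS]mulrC ler_pM2l ?expR_gt0// in H2.
    by apply: le_trans H2; rewrite ler_wpM2l// expR_ge1Dx.
  rewrite subKr in H1.
  have H4 : n x * (k * h) <= h * (c * n x + n x / 2) * (1 + k * h).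
    have p1 : 0 <= 1 + k * h by rewrite addr_ge0// mulr_ge0// ltW.
    have := ler_wpM2r p1 H1; rewrite mulrBl; lra.
  have H5 : n x * h * (k - (c + 1 / 2) * (1 + k * h)) <= 0.
    by rewrite (_ : _ * _ * _ = n x * (k * h) - h * (c * n x + n x / 2) * (1 + k * h)); [rewrite subr_le0|field].
  have H6 : 0 < k - (c + 1 / 2) * (1 + k * h).
    have kh : 0 < k * h by rewrite mulr_gt0.
    have : 0 <= c * (k * h) by rewrite mulr_ge0// ltW.
    rewrite /k in hk kh *; nra.
  by move: H5; rewrite leNgt => /negP; apply; rewrite !mulr_gt0.
rewrite yE// in yle.
have E : expR (- (k * t)) * expR (k * t) = 1 by rewrite -expRD addNr expR0.
have : n t * expR (- (k * t)) * expR (k * t) <= n 0 * expR (k * t).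
  by rewrite ler_wpM2r// expR_ge0.
by rewrite -mulrA E mulr1.
Qed.

End gronwall.

(** * Comparison of the distances at two times *)

Section distances.
Context {R : realType} {N : nat}.
Notation V := 'rV[R]_N.
Notation lam := (lebesgue_row R N).
Notation m := (@energy_weight R N).

Variables (C : R) (F G F' G' : V -> R).
Hypotheses (HF : BV_bounded C F) (HG : BV_bounded C G)
  (HF' : BV_bounded C F') (HG' : BV_bounded C G').

Let m0 (v : V) : 0 <= m v. Proof. exact: energy_weight_ge0. Qed.
Let w10 (v : V) : 0 <= 1 + enorm v. Proof. by rewrite addr_ge0// enorm_ge0. Qed.

Let diff_le v : `|(F v - G v) - (F' v - G' v)| <= `|F v - F' v| + `|G v - G' v|.
Proof.
rewrite (_ : _ - _ = (F v - F' v) - (G v - G' v)); last by ring.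
exact: ler_normB.
Qed.

Lemma energy_distance_triangle :
  energy_distance F G <= energy_distance F' G' + (energy_distance F F' + energy_distance G G').
Proof.
have i1 := integrable_energy_distance HF HG; have i2 := integrable_energy_distance HF' HG'.
have i3 := integrable_energy_distance HF HF'; have i4 := integrable_energy_distance HG HG'.
rewrite /energy_distance -!RintegralD//; last exact: integrable_EFinD.
apply: le_Rintegral => //; first by apply: integrable_EFinD => //; exact: integrable_EFinD.
move=> v _; rewrite -!mulrDl ler_wpM2r//.
rewrite -lerBlDl; apply: le_trans (lerB_dist _ _) _; exact: diff_le.
Qed.

(** Lets a [psi] adapted to one pair of densities be used for a nearby pair: both the modulus and
    the tested term change by at most the difference of the pairs, whence the 2. *)
Lemma sign_defect_triangle (psi : V -> R) : measurable_fun setT psi ->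
  (forall v, `|psi v| <= m v) ->
  sign_defect F G psi <= sign_defect F' G' psi + 2 * (cubic_distance F F' + cubic_distance G G').
Proof.
move=> mpsi psim.
have i1 := integrable_sign_defect HF HG mpsi psim; have i2 := integrable_sign_defect HF' HG' mpsi psim.
have i3 := integrable_cubic_distance HF HF'; have i4 := integrable_cubic_distance HG HG'.
have i34 := integrable_EFinD i3 i4.
have i5 := integrable_EFinZ 2 i34.
rewrite /sign_defect /cubic_distance -(RintegralD measurableT i3 i4).
rewrite -[X in _ <= _ + X]RintegralZl// -(RintegralD measurableT i2 i5).
apply: (le_Rintegral measurableT i1 (integrable_EFinD i2 i5)) => v _.
rewrite -mulrDl [(1 + _) * _]mulrC !mulrA -mulrDl ler_wpM2r//.
have := diff_le v; have := m0 v; have := psim v.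
move: (F v - G v) (F' v - G' v) (`|F v - F' v| + _) (m v) (psi v) => a b z mv p pm mv0 abz.
have h1 : (`|a| - `|b|) * mv <= z * mv.
  by rewrite ler_wpM2r//; apply: le_trans abz; exact: lerB_dist.
have h2 : - ((a - b) * p) <= z * mv.
  apply: le_trans (ler_norm _) _; rewrite normrN normrM.
  by apply: ler_pM.
lra.
Qed.

(** The upper bound holds for every admissible [psi] and is used at the earlier time. The lower
    bound uses that the defect has a weight at least 1, and is used at the time to which [psi] is
    adapted. *)
Lemma energy_distance_sign (psi : V -> R) : measurable_fun setT psi ->
  (forall v, `|psi v| <= m v) ->
  lam.-integrable setT (EFin \o (fun v => (F v - G v) * psi v)) /\
  energy_distance F G - sign_defect F G psi <= \int[lam]_v ((F v - G v) * psi v) <= energy_distance F G.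
Proof.
move=> mpsi psim.
have i1 := integrable_sign_defect HF HG mpsi psim; have i2 := integrable_energy_distance HF HG.
have [mF _ _ _ _] := HF; have [mG _ _ _ _] := HG.
have ple v : (F v - G v) * psi v <= `|F v - G v| * m v.
  by rewrite (le_trans (ler_norm _))// normrM ler_wpM2l.
have i3 : lam.-integrable setT (EFin \o (fun v => (F v - G v) * psi v)).
  apply: (le_integrable_EFin _ _ i2); first by apply: measurable_funM => //; exact: measurable_funB.
  by move=> v; rewrite normrM ler_wpM2l.
split => //; apply/andP; split; last exact: le_Rintegral.
rewrite lerBlDr /energy_distance /sign_defect -RintegralD//.
apply: le_Rintegral => //; first exact: integrable_EFinD.
move=> v _; rewrite -lerBlDl ler_peMr ?subr_ge0//.
by rewrite lerDl enorm_ge0.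
Qed.

End distances.

Section L1_difference.
Context {R : realType} {N : nat}.
Notation V := 'rV[R]_N.
Notation lam := (lebesgue_row R N).
Notation m := (@energy_weight R N).

Let m0 (v : V) : 0 <= m v. Proof. exact: energy_weight_ge0. Qed.

Lemma L1_difference (f g : V -> R) : L1 2 f -> L1 2 g ->
  lam.-integrable setT (EFin \o (fun v => `|f v - g v| * m v)) /\
  L1norm 2 (f \- g) = (\int[lam]_v (`|f v - g v| * m v))%:E.
Proof.
move=> Lf Lg; have i1 := L1_integrable_weight Lf; have i2 := L1_integrable_weight Lg.
have [mf _] := Lf; have [mg _] := Lg.
have i : lam.-integrable setT (EFin \o (fun v => `|f v - g v| * m v)).
  apply: (le_integrable_EFin _ _ (integrable_EFinD i1 i2)).
    apply: measurable_funM; last exact: measurable_energy_weight.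
    by apply: measurableT_comp => //; exact: measurable_funB.
  move=> v; rewrite normrM normr_id (ger0_norm (m0 v)) -mulrDl ler_wpM2r//.
  exact: ler_normB.
by split => //; rewrite -(Rintegral_EFin i).
Qed.

Lemma energy_distance_abs_le (f g : V -> R) : L1 2 f -> L1 2 g ->
  energy_distance (fun v => `|f v|) (fun v => `|g v|) <= \int[lam]_v (`|f v - g v| * m v).
Proof.
move=> Lf Lg; have [i _] := L1_difference Lf Lg; have [mf _] := Lf; have [mg _] := Lg.
have le v : `| `|f v| - `|g v| | * m v <= `|f v - g v| * m v.
  by rewrite ler_wpM2r//; exact: ler_dist_dist.
apply: le_Rintegral => //; apply: (le_integrable_EFin _ _ i).
  apply: measurable_funM; last exact: measurable_energy_weight.
  by apply: measurableT_comp => //; apply: measurable_funB; exact: measurableT_comp.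
by move=> v; rewrite ger0_norm// mulr_ge0.
Qed.

Lemma energy_distance_abs (f g : V -> R) : L1 2 f -> L1 2 g -> nonneg_ae f -> nonneg_ae g ->
  energy_distance (fun v => `|f v|) (fun v => `|g v|) = \int[lam]_v (`|f v - g v| * m v).
Proof.
move=> [mf _] [mg _] f0 g0; rewrite /energy_distance /Rintegral; congr fine.
have mm := @measurable_energy_weight R N.
apply: ae_eq_integral => //.
- apply/measurable_EFinP; apply: measurable_funM => //.
  by apply: measurableT_comp => //; apply: measurable_funB; exact: measurableT_comp.
- apply/measurable_EFinP; apply: measurable_funM => //.
  by apply: measurableT_comp => //; exact: measurable_funB.
- by apply: filterS2 f0 g0 => v fv gv _; rewrite (ger0_norm fv) (ger0_norm gv).
Qed.

End L1_difference.

Section solution_continuity.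
Context {R : realType} {N : nat}.
Notation V := 'rV[R]_N.
Notation lam := (lebesgue_row R N).
Notation m := (@energy_weight R N).

Variables (alpha : R -> {nonneg R}) (beta : R -> V -> probability V R).
Variables (bt : R -> R -> R -> R) (e : R -> R).
Hypotheses (Hbt : bounded_density bt) (He : restitution e)
  (Hform : inelastic_form alpha beta bt e) (HL : @lipschitz_in_energy R N bt e).
Local Notation B := (collision_rate alpha beta).
Variable K : set R.
Hypothesis HK : compact_pos K.
Variables (T : R) (fin : V -> R) (f : R -> V -> R) (C : R).
Hypotheses (T0 : 0 < T) (Hf : boltzmann_solution B T fin f)
  (Kf : forall t, 0 <= t <= T -> K (energy (f t)))
  (HC : forall t, 0 <= t <= T -> BV_bounded C (fun v => `|f t v|)).

Local Notation F t := (fun v => `|f t v|).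

Lemma solution_energy_continuous t : 0 <= t <= T -> forall eps, 0 < eps ->
  exists2 d : R, 0 < d & forall s, 0 <= s <= T -> `|s - t| < d ->
    energy_distance (F s) (F t) <= eps.
Proof.
move=> tT eps e0; have [_ [fL1 fc] _ _] := Hf.
have /fine_cvgP[_ /cvgrPdist_lt/(_ _ e0)] := fc t tT.
rewrite near_withinE => /nbhs_ballP[d /= d0 Hd]; exists d => // s sT st.
have := Hd s; rewrite /ball /= distrC => /(_ st sT).
have [_ ->] := L1_difference (fL1 _ sT) (fL1 _ tT).
rewrite /= sub0r normrN => Hs.
apply: le_trans (energy_distance_abs_le (fL1 _ sT) (fL1 _ tT)) _.
exact: le_trans (ler_norm _) (ltW Hs).
Qed.

Let C0 t : 0 <= t <= T -> 0 <= C.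
Proof.
move=> /HC[_ f0 _ fC _]; apply: le_trans fC; apply: Rintegral_ge0 => v _.
by rewrite mulr_ge0// moment_weight_ge0.
Qed.

(** Continuity holds in the second-order norm and the fourth moments are bounded uniformly in time;
    interpolation gives the third order in between. *)
Lemma solution_cubic_continuous t : 0 <= t <= T -> forall eps, 0 < eps ->
  exists2 d : R, 0 < d & forall s, 0 <= s <= T -> `|s - t| < d ->
    cubic_distance (F s) (F t) <= eps.
Proof.
move=> tT eps e0; have CC := C0 tT.
(* [eta] is fixed first, so that the fourth moment part is at most eps / 2; only then is the energy
   distance made small against 3 + 1 / eta. *)
pose eta := eps / (2 * (4 * C + 1)).
have q0 : 0 < 4 * C + 1 by rewrite ltr_wpDl// mulr_ge0.
have eta0 : 0 < eta by rewrite divr_gt0// mulr_gt0.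
have p0 : 0 < 3 + eta^-1 by rewrite addr_gt0// invr_gt0.
have e1 : 0 < eps / 2 / (3 + eta^-1) by rewrite !divr_gt0.
have [d d0 Hd] := solution_energy_continuous tT e1.
exists d => // s sT st.
apply: le_trans (cubic_distance_interpolation (HC sT) (HC tT) eta0) _.
have h1 : (3 + eta^-1) * energy_distance (F s) (F t) <= eps / 2.
  by rewrite mulrC -ler_pdivlMr//; exact: Hd.
have h2 : eta * (4 * C) <= eps / 2.
  have -> : eps / 2 = eta * (4 * C + 1) by rewrite /eta; field; rewrite gt_eqF.
  by rewrite ler_wpM2l ?(ltW eta0)// lerDl.
lra.
Qed.

(** Discharges the two continuity hypotheses of [solution_derivative]: the tested solution varies at
    most like the energy distance, the bracket like the cubic distance. *)
Lemma solution_path (psi : V -> R) : measurable_smooth psi -> bounded_support psi ->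
  (forall v, `|psi v| <= m v) ->
  exists P Pd : R -> R, [/\ forall t : R, is_derive t 1 P (Pd t),
    forall t, 0 <= t <= T -> Pd t = Qweak B (F t) psi,
    forall t, 0 <= t <= T -> P t = \int[lam]_v (`|f t v| * psi v) &
    P 0 = \int[lam]_v (fin v * psi v)].
Proof.
move=> spsi bpsi psim; have mpsi := measurable_smooth_fun spsi.
have [_ [fL1 _] fnn _] := Hf.
have aE t : 0 <= t <= T -> \int[lam]_v (`|f t v| * psi v) = \int[lam]_v (f t v * psi v).
  by move=> tT; apply: Rintegral_abs => //; [have [] := fL1 _ tT|exact: fnn].
have Ef t : 0 <= t <= T -> 0 < energy (f t) by move=> tT; exact: HK.2 _ (Kf tT).
have KF t : 0 <= t <= T -> K (energy (F t)).
  by move=> tT; rewrite energy_abs; [exact: Kf|have [] := fL1 _ tT|exact: fnn].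
have ca : continuous_on T (fun t => \int[lam]_v (f t v * psi v)).
  apply: continuous_onP => t tT eps e0.
  have [d d0 Hd] := solution_energy_continuous tT e0.
  exists d => // s sT st; apply: le_trans (Hd s sT st).
  have Ls := fL1 _ sT; have Lt := fL1 _ tT.
  have is_ := L1_integrable_test Ls spsi bpsi; have it := L1_integrable_test Lt spsi bpsi.
  rewrite (energy_distance_abs Ls Lt (fnn _ sT) (fnn _ tT)) -RintegralB//.
  apply: normr_Rintegral_le.
  - exact: integrableEFin_fun (integrable_EFinB is_ it).
  - by move=> v; rewrite -mulrBl normrM ler_wpM2l.
  - by have [] := L1_difference Ls Lt.
have cq : continuous_on T (fun t => Qweak B (F t) psi).
  have [c c0 Hc] := Qweak_distance Hbt He Hform HL HK.
  apply: continuous_onP => t tT eps e0; have CC := C0 tT.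
  have q0 : 0 <= c * (C + C ^+ 2) by rewrite mulr_ge0// addr_ge0// sqr_ge0.
  have q1 : 0 < c * (C + C ^+ 2) + 1 by rewrite ltr_wpDl.
  have [d d0 Hd] := solution_cubic_continuous tT (divr_gt0 e0 q1).
  exists d => // s sT st.
  apply: le_trans (Hc _ _ _ _ (HC sT) (HC tT) (KF _ sT) (KF _ tT) mpsi psim) _.
  apply: le_trans (ler_wpM2l q0 (Hd s sT st)) _.
  rewrite mulrCA ler_piMr ?(ltW e0)// ler_pdivrMr// mul1r lerDl.
  exact: ler01.
have [P [Pd [dP PdE PE P0]]] := solution_derivative Hbt He Hform T0 Hf Ef HC spsi bpsi psim ca cq.
exists P, Pd; split => // t tT; by rewrite aE// PE.
Qed.

End solution_continuity.

(** * Evolution of the distance of two solutions *)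

Section stability.
Context {R : realType} {N : nat}.
Notation V := 'rV[R]_N.
Notation lam := (lebesgue_row R N).
Notation m := (@energy_weight R N).
Notation w4 := (@moment_weight R N 4).

Variables (alpha : R -> {nonneg R}) (beta : R -> V -> probability V R).
Variables (bt : R -> R -> R -> R) (e : R -> R).
Hypotheses (Hbt : bounded_density bt) (He : restitution e)
  (Hform : inelastic_form alpha beta bt e) (HL : @lipschitz_in_energy R N bt e).
Local Notation B := (collision_rate alpha beta).
Variable K : set R.
Hypothesis HK : compact_pos K.
Variables (T : R) (fin gin : V -> R) (f g : R -> V -> R) (C c : R).
Hypotheses (T0 : 0 < T)
  (Hf : boltzmann_solution B T fin f) (Hg : boltzmann_solution B T gin g)
  (Kf : forall t, 0 <= t <= T -> K (energy (f t)))
  (Kg : forall t, 0 <= t <= T -> K (energy (g t)))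
  (HC : forall t, 0 <= t <= T -> BV_bounded C (fun v => `|f t v|))
  (HD : forall t, 0 <= t <= T -> BV_bounded C (fun v => `|g t v|)).
Hypotheses (c0 : 0 <= c) (Hc : forall F G psi : V -> R, BV_bounded C F -> BV_bounded C G ->
    K (energy F) -> K (energy G) ->
    measurable_fun setT psi -> (forall v, `|psi v| <= m v) ->
    Qweak B F psi - Qweak B G psi <= c * (energy_distance F G + sign_defect F G psi)).

Local Notation F t := (fun v => `|f t v|).
Local Notation G t := (fun v => `|g t v|).

Let n t := energy_distance (F t) (G t).

Let n0 t : 0 <= n t. Proof. exact: energy_distance_ge0. Qed.

(** [sign_density] is applied with the weight (1 + |v|) m of the defect, and its result is
    multiplied by m. *)
Lemma sign_test t : 0 <= t <= T -> forall eps, 0 < eps -> exists psi : V -> R,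
  [/\ measurable_smooth psi, bounded_support psi, forall v, `|psi v| <= m v &
      sign_defect (F t) (G t) psi <= eps].
Proof.
move=> tT eps e0; have ic := integrable_cubic_distance (HC tT) (HD tT).
have [mF _ _ _ _] := HC tT; have [mG _ _ _ _] := HD tT.
have mm := @measurable_energy_weight R N; have mw := @measurable_cst_enorm R N.
have m0 (v : V) : 0 <= m v by exact: energy_weight_ge0.
have w0 (v : V) : 0 <= (1 + enorm v) * m v by rewrite mulr_ge0// addr_ge0// enorm_ge0.
have [psi [spsi bpsi psi1 Hpsi]] := sign_density (measurable_funB mF mG) (measurable_funM mw mm) w0 ic e0.
have sm : measurable_smooth (fun v => m v * psi v).
  by apply: measurable_smoothM => //; exact: measurable_smooth_energy_weight.
have pm v : `|m v * psi v| <= m v by rewrite normrM (ger0_norm (m0 v)) ler_piMr.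
exists (fun v => m v * psi v); split => //; first exact: bounded_supportM.
have i := integrable_sign_defect (HC tT) (HD tT) (measurable_smooth_fun sm) pm.
rewrite -lee_fin -(Rintegral_EFin i); apply: le_trans Hpsi.
rewrite le_eqVlt; apply/orP; left; apply/eqP; apply: eq_integral => v _; congr (_%:E).
by rewrite /=; move: (`|f t v|) (`|g t v|) (m v) (psi v) => a b x y; ring.
Qed.

(** A solution is linked to [fin] only through test functions, by the value P 0. The sign test at
    time 0 turns this into a bound on the norm. *)
Lemma stability_initial : n 0 <= \int[lam]_v (`|fin v - gin v| * m v).
Proof.
have T00 : 0 <= (0 : R) <= T by rewrite lexx ltW.
apply/ler_addgt0Pr => eps e0.
have [psi [spsi bpsi psim Hpsi]] := sign_test T00 e0.
have mpsi := measurable_smooth_fun spsi.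
have [Pf [_ [_ _ PfE Pf0]]] := solution_path Hbt He Hform HL HK T0 Hf Kf HC spsi bpsi psim.
have [Pg [_ [_ _ PgE Pg0]]] := solution_path Hbt He Hform HL HK T0 Hg Kg HD spsi bpsi psim.
have [i /andP[l _]] := energy_distance_sign (HC T00) (HD T00) mpsi psim.
have [[Lf _ _ _] [fL _] _ _] := Hf; have [[Lg _ _ _] [gL _] _ _] := Hg.
have abs_int (h : R -> V -> R) : L1 2 (h 0) ->
    lam.-integrable setT (EFin \o (fun v => `|h 0 v| * psi v)).
  move=> Lh; have [mh _] := Lh; have [M M0 HM] := bounded_support_bounded spsi bpsi.
  apply: (le_integrable_EFin _ _ (integrable_EFin_norm (L1_integrable_test Lh spsi bpsi))).
    by apply: measurable_funM => //; exact: measurableT_comp.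
  by move=> v; rewrite !normrM normr_id.
have if0 := abs_int f (fL _ T00); have ig0 := abs_int g (gL _ T00).
have E : \int[lam]_v ((`|f 0 v| - `|g 0 v|) * psi v) = \int[lam]_v ((fin v - gin v) * psi v).
  transitivity (\int[lam]_v (`|f 0 v| * psi v) - \int[lam]_v (`|g 0 v| * psi v)).
    by rewrite -RintegralB//; apply: eq_Rintegral => v _; rewrite mulrBl.
  rewrite -PfE// -PgE// Pf0 Pg0 -RintegralB//; [|exact: L1_integrable_test|exact: L1_integrable_test].
  by apply: eq_Rintegral => v _; rewrite mulrBl.
have [id _] := L1_difference Lf Lg.
have l2 : \int[lam]_v ((fin v - gin v) * psi v) <= \int[lam]_v (`|fin v - gin v| * m v).
  apply: le_trans (ler_norm _) _; apply: normr_Rintegral_le => //.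
    apply: measurable_funM => //; apply: measurable_funB; [by case: Lf|by case: Lg].
  by move=> v; rewrite normrM ler_wpM2l.
rewrite E in l; rewrite /n; lra.
Qed.

Lemma stability_continuous : continuous_on T n.
Proof.
apply: continuous_onP => t tT eps e0.
have e2 : 0 < eps / 2 by rewrite divr_gt0.
have [d1 d10 H1] := solution_energy_continuous Hf tT e2.
have [d2 d20 H2] := solution_energy_continuous Hg tT e2.
exists (Num.min d1 d2) => [|s sT]; first by rewrite lt_min d10.
rewrite lt_min => /andP[/(H1 s sT) h1 /(H2 s sT) h2].
have t1 := energy_distance_triangle (HC sT) (HD sT) (HC tT) (HD tT).
have t2 := energy_distance_triangle (HC tT) (HD tT) (HC sT) (HD sT).
rewrite (energy_distanceC (F t) (F s)) (energy_distanceC (G t) (G s)) in t2.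
by rewrite /n ler_norml; apply/andP; split; lra.
Qed.

(** The mean value theorem brings in an intermediate time x at which [psi] is not adapted; the error
    eta pays for moving the distance and the defect from x to t. *)
Lemma stability_left t : 0 < t <= T -> forall eta, 0 < eta -> exists2 d : R, 0 < d &
  forall s, 0 <= s < t -> t - d < s -> n t - n s <= (t - s) * (c * n t + eta).
Proof.
move=> /andP[t0 tT'] eta eta0; have tT : 0 <= t <= T by rewrite ltW.
(* Moving from x to t costs two cubic distances for the energy distance and twice two for the
   defect: six in all. *)
have q0 : 0 < 6 * c + 1 by rewrite ltr_wpDl// mulr_ge0.
have w0 : 0 < eta / (6 * c + 1) by rewrite divr_gt0.
have [d1 d10 H1] := solution_cubic_continuous Hf HC tT w0.
have [d2 d20 H2] := solution_cubic_continuous Hg HD tT w0.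
exists (Num.min d1 d2) => [|s /andP[s0 st] tds]; first by rewrite lt_min d10.
(* [d] is fixed before [psi]. The tolerance eps, and [psi] with it, is chosen once s and t are
   fixed, and then eps tends to 0. *)
apply/ler_addgt0Pr => eps e0.
(* The defect enters once through P(t) >= n(t) - ep and once through the derivative, as (t - s) c ep
   with t - s <= T. *)
have r0 : 0 < 1 + T * c by rewrite ltr_pwDl// mulr_ge0// ltW.
pose ep := eps / (1 + T * c).
have ep0 : 0 < ep by rewrite divr_gt0.
have [psi [spsi bpsi psim Hpsi]] := sign_test tT ep0.
have mpsi := measurable_smooth_fun spsi.
have [Pf [qf [dPf qfE PfE _]]] := solution_path Hbt He Hform HL HK T0 Hf Kf HC spsi bpsi psim.
have [Pg [qg [dPg qgE PgE _]]] := solution_path Hbt He Hform HL HK T0 Hg Kg HD spsi bpsi psim.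
have sT : 0 <= s <= T by rewrite s0 (le_trans (ltW st)).
have dP (x : R) : is_derive x 1 (fun x => Pf x - Pg x) (qf x - qg x) by exact: is_deriveB.
have [x] := MVT st (fun x _ => dP x) (continuous_subspaceT (derivable_is_continuous dP)).
rewrite in_itv /= => /andP[sx xt] E.
have xT : 0 <= x <= T by rewrite (le_trans s0 (ltW sx)) (le_trans (ltW xt)).
have xd : `|x - t| < Num.min d1 d2.
  by rewrite distrC gtr0_norm ?subr_gt0// ltrBlDr -ltrBlDl (lt_trans tds).
move: xd; rewrite lt_min => /andP[/(H1 x xT) h1 /(H2 x xT) h2].
have [_ /andP[lt _]] := energy_distance_sign (HC tT) (HD tT) mpsi psim.
have [_ /andP[_ ls]] := energy_distance_sign (HC sT) (HD sT) mpsi psim.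
have abs_int (h : R -> V -> R) y : L1 2 (h y) ->
    lam.-integrable setT (EFin \o (fun v => `|h y v| * psi v)).
  move=> Lh; have [mh _] := Lh.
  apply: (le_integrable_EFin _ _ (integrable_EFin_norm (L1_integrable_test Lh spsi bpsi))).
    by apply: measurable_funM => //; exact: measurableT_comp.
  by move=> v; rewrite !normrM normr_id.
have [_ [fL _] fnn _] := Hf; have [_ [gL _] gnn _] := Hg.
have PE y : 0 <= y <= T -> \int[lam]_v ((`|f y v| - `|g y v|) * psi v) = Pf y - Pg y.
  move=> yT; rewrite PfE// PgE// -RintegralB//; [|exact/abs_int/fL|exact/abs_int/gL].
  by apply: eq_Rintegral => v _; rewrite mulrBl.
rewrite PE// in lt; rewrite PE// in ls.
have KF y : 0 <= y <= T -> K (energy (F y)).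
  by move=> yT; rewrite energy_abs; [exact: Kf|have [] := fL _ yT|exact: fnn].
have KG y : 0 <= y <= T -> K (energy (G y)).
  by move=> yT; rewrite energy_abs; [exact: Kg|have [] := gL _ yT|exact: gnn].
have Hq := Hc (HC xT) (HD xT) (KF _ xT) (KG _ xT) mpsi psim.
rewrite -qfE// -qgE// in Hq.
have t1 := energy_distance_triangle (HC xT) (HD xT) (HC tT) (HD tT).
have t2 := sign_defect_triangle (HC xT) (HD xT) (HC tT) (HD tT) mpsi psim.
have u1 := energy_distance_le_cubic (HC xT) (HC tT).
have u2 := energy_distance_le_cubic (HD xT) (HD tT).
have {Hq} Hq : qf x - qg x <= c * (n t + 6 * (eta / (6 * c + 1)) + ep).
  apply: le_trans Hq _; rewrite ler_wpM2l//.
  by rewrite /n; lra.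
have ts0 : 0 < t - s by rewrite subr_gt0.
have H3 := ler_wpM2r (ltW ts0) Hq; rewrite -E in H3.
have H4 : c * (6 * (eta / (6 * c + 1))) <= eta.
  rewrite (_ : c * _ = eta * (6 * c / (6 * c + 1))); last by field; rewrite gt_eqF.
  by rewrite ler_piMr ?(ltW eta0)// ler_pdivrMr// mul1r lerDl.
have H5 : ep + (t - s) * (c * ep) <= eps.
  have -> : eps = ep + T * (c * ep) by rewrite /ep; field; rewrite gt_eqF.
  rewrite lerD2l; apply: (ler_wpM2r (mulr_ge0 c0 (ltW ep0))).
  by rewrite lerBlDr (le_trans tT')// lerDl.
have H6 := ler_wpM2l (ltW ts0) H4.
rewrite -/(n t) in lt; rewrite -/(n s) in ls.
move: lt ls Hpsi H3 H5 H6.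
move: (sign_defect _ _ _) (n t) (n s) (Pf t - Pg t) (Pf s - Pg s) (t - s) (eta / _) => r a b p1 p2 z w.
lra.
Qed.

Lemma stability t : 0 <= t <= T ->
  (L1norm 2 (f t \- g t)%R <= L1norm 2 (fin \- gin)%R * (expR ((c + 1) * t))%:E)%E.
Proof.
move=> tT.
have [[Lf _ _ _] [fL _] fnn _] := Hf; have [[Lg _ _ _] [gL _] gnn _] := Hg.
have [_ ->] := L1_difference (fL _ tT) (gL _ tT); have [_ ->] := L1_difference Lf Lg.
rewrite -EFinM lee_fin -(energy_distance_abs (fL _ tT) (gL _ tT) (fnn _ tT) (gnn _ tT)).
apply: le_trans (left_gronwall T0 c0 stability_continuous n0 stability_left tT) _.
by rewrite ler_wpM2r ?expR_ge0// stability_initial.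
Qed.

End stability.

Theorem proposition4p3 (R : realType) (N : nat)
    (alpha : R -> {nonneg R}) (beta : R -> 'rV[R]_N -> probability 'rV[R]_N R)
    (bt : R -> R -> R -> R) (e : R -> R) (K : set R) (C : R) :
  (2 <= N)%N ->
  carried_by_ball beta ->
  symmetric_rate beta ->
  continuous_rate alpha beta ->
  angular_spreading beta ->
  bounded_density bt ->
  restitution e ->
  inelastic_form alpha beta bt e ->
  @lipschitz_in_energy R N bt e ->
  compact_pos K ->
  exists C' : R,
    forall (T : R) (fin gin : 'rV[R]_N -> R) (f g : R -> 'rV[R]_N -> R),
      0 < T ->
      boltzmann_solution (collision_rate alpha beta) T fin f ->
      boltzmann_solution (collision_rate alpha beta) T gin g ->
      Linfty_L1 3 T f -> Linfty_L1 3 T g ->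
      (forall t, 0 <= t <= T ->
        [/\ mass (f t) = 1, mass (g t) = 1,
            forall i, momentum (f t) i = 0 &
            forall i, momentum (g t) i = 0]) ->
      (forall t, 0 <= t <= T -> K (energy (f t)) /\ K (energy (g t))) ->
      (forall t, 0 <= t <= T ->
        [/\ BV 4 (f t), BV 4 (g t),
            (BVnorm 4 (f t) <= C%:E)%E & (BVnorm 4 (g t) <= C%:E)%E]) ->
      forall t, 0 <= t <= T ->
        (L1norm 2 (f t \- g t)%R <=
         L1norm 2 (fin \- gin)%R * (expR (C' * t))%:E)%E.
Proof.
move=> _ _ _ _ _ Hbt He Hform HL HK.
have [c c0 Hc] := Qweak_difference Hbt He Hform HL HK.
(* C + N is the bound that [BV_bounded_abs] gives for |f| and |g|; the final 1 is the loss in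
   [left_gronwall]. *)
exists (c * ((C + N%:R) + (C + N%:R) ^+ 2) + 1) => T fin gin f g T0 Hf Hg _ _ _ HE HBV t tT.
have T00 : 0 <= (0 : R) <= T by rewrite lexx ltW.
have bounded (h : R -> 'rV[R]_N -> R) (hin : 'rV[R]_N -> R) s : 0 <= s <= T ->
    boltzmann_solution (collision_rate alpha beta) T hin h ->
    (BVnorm 4 (h s) <= C%:E)%E -> BV_bounded (C + N%:R) (fun v => `|h s v|).
  move=> sT [_ [hL _] hnn _]; apply: BV_bounded_abs; last exact: hnn.
  by have [] := hL _ sT.
have HC s : 0 <= s <= T -> BV_bounded (C + N%:R) (fun v => `|f s v|).
  by move=> sT; apply: (bounded _ _ _ sT Hf); have [] := HBV _ sT.
have HD s : 0 <= s <= T -> BV_bounded (C + N%:R) (fun v => `|g s v|).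
  by move=> sT; apply: (bounded _ _ _ sT Hg); have [] := HBV _ sT.
have C0 : 0 <= C + N%:R.
  have [_ f0 _ fC _] := HC _ T00; apply: le_trans fC; apply: Rintegral_ge0 => v _.
  by rewrite mulr_ge0// moment_weight_ge0.
apply: (stability Hbt He Hform HL HK T0 Hf Hg _ _ HC HD _ _ tT).
- by move=> s /HE[].
- by move=> s /HE[].
- by rewrite mulr_ge0// addr_ge0// sqr_ge0.
- by move=> F G psi; exact: Hc.
Qed.
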